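(* Let $\phi$ be a linear fractional transformation with $\phi(\mathbb{D})\subset\mathbb{D}$, and let $C_\phi f=f\circ\phi$ be the corresponding composition operator on the Hardy space $H^2(\mathbb{D})$. Then $C_\phi$ has the positive shadowing property if and only if $\phi$ is a hyperbolic automorphism or a hyperbolic non-automorphism of type I.
   Context: $\mathbb{D}$ is the open unit disk, $\mathbb{T}$ the unit circle, $\widehat{\mathbb{C}}=\mathbb{C}\cup\{\infty\}$. $H^2(\mathbb{D})$ is the Hilbert space of holomorphic $f:\mathbb{D}\to\mathbb{C}$ with $\|f\|_2=\left(\sup_{0<r<1}\frac{1}{2\pi}\int_0^{2\pi}|f(re^{i\theta})|^2d\theta\right)^{1/2}<\infty$. For every holomorphic self-map $\phi$ of $\mathbb{D}$, $C_\phi$ is a bounded linear operator on $H^2(\mathbb{D})$. A linear fractional transformation is a map $\phi:\widehat{\mathbb{C}}\to\widehat{\mathbb{C}}$, $\phi(z)=\frac{az+b}{cz+d}$, with $a,b,c,d\in\mathbb{C}$ and $ad-bc\neq 0$. A linear fractional transformation $\phi$ with $\phi(\mathbb{D})\subset\mathbb{D}$ that is not the identity has either one or two fixed points in $\widehat{\mathbb{C}}$. It is called hyperbolic if it has two fixed points, one of which lies in $\mathbb{T}$. A hyperbolic $\phi$ is a hyperbolic automorphism if the other fixed point lies in $\mathbb{T}$, and a hyperbolic non-automorphism of type I if the other fixed point lies in $\widehat{\mathbb{C}}\setminus\overline{\mathbb{D}}$. Let $T$ be a bounded linear operator on a complex Banach space $X$. For $\delta>0$, a $\delta$-pseudo-orbit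 of $T$ is a sequence $(x_n)_{n\ge 0}$ in $X$ with $\|Tx_n-x_{n+1}\|\le\delta$ for all $n\ge 0$. $T$ has the positive shadowing property if for every $\varepsilon>0$ there exists $\delta>0$ such that for every $\delta$-pseudo-orbit $(x_n)_{n\ge 0}$ of $T$ there is $x\in X$ with $\|T^nx-x_n\|\le\varepsilon$ for all $n\ge 0$. *)

(* Defs.v *)
From Stdlib Require Import Reals.
From Coquelicot Require Import Coquelicot.

Open Scope R_scope.

Definition in_disk (z : C) : Prop := Cmod z < 1.

Definition holomorphic_on_disk (f : C -> C) : Prop :=
  forall z : C, in_disk z -> @ex_derive C_AbsRing C_NormedModule f z.

(* Elements of H^2 are represented by total functions [C -> C]; everything below
   only looks at their values in the open unit disk, and two functions that agree
   there are at distance 0, i.e. represent the same element. *)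

Definition circle_mean (f : C -> C) (r : R) : R :=
  / (2 * PI) * RInt (fun t : R => (Cmod (f (r * cos t, r * sin t)) ^ 2)%R) 0 (2 * PI).

Definition Rbar_sqrt (x : Rbar) : Rbar :=
  match x with
  | Finite r => Finite (sqrt r)
  | p_infty => p_infty
  | m_infty => m_infty
  end.

Definition H2_norm (f : C -> C) : Rbar :=
  Rbar_sqrt (Lub_Rbar (fun m : R => exists r : R, 0 < r < 1 /\ m = circle_mean f r)).

Definition in_H2 (f : C -> C) : Prop :=
  holomorphic_on_disk f /\ Rbar_lt (H2_norm f) p_infty.

Definition H2_dist (f g : C -> C) : Rbar := H2_norm (fun z : C => Cminus (f z) (g z)).

(* Shadowing for a map [T] on the part [X] of the type [V], with distance [d]. *)

Definition pseudo_orbit {V : Type} (X : V -> Prop) (d : V -> V -> Rbar)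
    (T : V -> V) (delta : R) (x : nat -> V) : Prop :=
  (forall n : nat, X (x n)) /\
  (forall n : nat, Rbar_le (d (T (x n)) (x (S n))) delta).

Definition positive_shadowing {V : Type} (X : V -> Prop) (d : V -> V -> Rbar)
    (T : V -> V) : Prop :=
  forall eps : R, 0 < eps ->
  exists delta : R, 0 < delta /\
  forall x : nat -> V, pseudo_orbit X d T delta x ->
  exists y : V, X y /\
  forall n : nat, Rbar_le (d (Nat.iter n T y) (x n)) eps.

(* The Riemann sphere; [None] is the point at infinity. *)
Definition sphere : Type := option C.

(* The case split also covers the degenerate case: when [c = 0], [c z + d] never
   vanishes (as [a d - b c <> 0]) and infinity is fixed. *)
Definition mobius (a b c d : C) (p : sphere) : sphere :=
  match p with
  | Some z =>
      if Ceq_dec (Cplus (Cmult c z) d) (RtoC 0) then None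
      else Some (Cdiv (Cplus (Cmult a z) b) (Cplus (Cmult c z) d))
  | None => if Ceq_dec c (RtoC 0) then None else Some (Cdiv a c)
  end.

Definition linear_fractional (phi : sphere -> sphere) : Prop :=
  exists a b c d : C,
    Cminus (Cmult a d) (Cmult b c) <> RtoC 0 /\
    forall p : sphere, phi p = mobius a b c d p.

Definition in_open_disk (p : sphere) : Prop :=
  match p with Some z => in_disk z | None => False end.

Definition on_unit_circle (p : sphere) : Prop :=
  match p with Some z => Cmod z = 1 | None => False end.

Definition off_closed_disk (p : sphere) : Prop :=
  match p with Some z => 1 < Cmod z | None => True end.

Definition maps_disk_into_disk (phi : sphere -> sphere) : Prop :=
  forall p : sphere, in_open_disk p -> in_open_disk (phi p).

(* Exactly two fixed points, one on the unit circle and the other in [Q]. *)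
Definition hyperbolic_with (Q : sphere -> Prop) (phi : sphere -> sphere) : Prop :=
  exists p q : sphere,
    p <> q /\ (forall s : sphere, phi s = s <-> s = p \/ s = q) /\
    on_unit_circle p /\ Q q.

Definition hyperbolic_automorphism : (sphere -> sphere) -> Prop :=
  hyperbolic_with on_unit_circle.

Definition hyperbolic_nonautomorphism_I : (sphere -> sphere) -> Prop :=
  hyperbolic_with off_closed_disk.

(* The value 0 is never used at points of the disk when [phi] maps the disk into
   itself. *)
Definition composition_operator (phi : sphere -> sphere) (f : C -> C) : C -> C :=
  fun z : C => match phi (Some z) with Some w => f w | None => RtoC 0 end.

(* Main.v *)
Require Import Defs.
From Stdlib Require Import Reals Lra Lia ClassicalEpsilon Classical FunctionalExtensionality.
From Coquelicot Require Import Coquelicot.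

(** Write T for the composition operator f |-> f o phi.

    Sufficiency. If (x_n) is a pseudo-orbit and z_n = x_(n+1) - T x_n, it is
    enough to find a bounded solution of Y_(n+1) = T Y_n + z_n: then x_0 - Y_0
    has the orbit x_n - Y_n, and Y_n is as small as the z_n. Call p the
    attracting fixed point; it lies on the circle. A half-plane coordinate w with
    p at infinity and the other fixed point at -x <= 0 turns phi into
    w |-> mu (w + x) - x with mu > 1; here x = 0 is the automorphism and x > 0 is
    type I. Let D_a be the dilation w |-> a w and psi the translation w |-> w + x;
    then psi o phi^j = D_(mu^j) o psi. With a linear function m that vanishes
    at the boundary point w = 0 and equals 1 at p, every f splits as
      f = (f - (m f) o psi) + (m f) o psi.
    T contracts along the first term: its j-th image is the sum of
    ((1 - m) f) o D_(mu^j) o psi, small because 1 - m vanishes at p, and of a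
    difference of f o D_(mu^j) at two points whose hyperbolic distance is of order
    mu^(-j). The second term has the backward orbit
    ((m f) o D_(mu^-j)) o psi, small because m vanishes at w = 0: composition with
    psi is what makes backward iterates meaningful when phi is not invertible.
    Both decay like mu^(-j/2) in norm, so
      Y_n = sum_(j < n) T^j (z_(n-1-j) - (m z_(n-1-j)) o psi)
            - (sum_(j >= 0) (m z_(n+j)) o D_(mu^-(j+1))) o psi
    is bounded ([bounded_solution], [shadowing_of_affine_model]).

    The norm estimates all come from one principle ([subordination]): |f|^2 is
    dominated by the Poisson integral of its values on a circle of radius q < 1,
    and the mean over a circle of (Poisson integral) o s, for a holomorphic
    self-map s, is its value at s(0). So every norm is controlled by a single
    Poisson kernel. Poisson's formula rests on
    Cauchy's formula for complex differentiable functions, obtained from Goursat's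
    theorem on rectangles through the exponential map.

    Necessity. The constants n delta form a pseudo-orbit. A shadowing y
    satisfies |y(phi^n(z)) - n delta| <= C(z) ([shadowing_growth]). This excludes a
    fixed point z in the disk, and it excludes the parabolic case, where
    1 - |phi^n(0)|^2 decays at most like n^(-2) while
    y(z) = o((1 - |z|^2)^(-1/2)) on the Hardy space ([growth_little_o]). As phi
    always has a fixed point in the closed disk ([closed_disk_fixed_point]), only
    the two hyperbolic cases remain. *)

Open Scope R_scope.

(** * Complex limits and differentiability *)

(** The neighbourhoods of a complex number are built from coordinatewise balls;
    a ball for the modulus contains one of these and conversely, up to the
    factor sqrt 2. *)
Lemma locally_C_Cmod (z : C) (P : C -> Prop) :
  locally z P <-> exists d : R, 0 < d /\ forall y, Cmod (y - z) < d -> P y.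
Proof.
  split.
  - intros [e He]. exists e. split. apply cond_pos.
    intros y Hy. apply He. now apply C_NormedModule_mixin_compat1.
  - intros [d [Hd H]].
    assert (Hs : 0 < d / sqrt 2) by (apply Rdiv_lt_0_compat; [lra|apply sqrt_lt_R0; lra]).
    exists (mkposreal _ Hs). intros y Hy. apply H.
    assert (H2 := C_NormedModule_mixin_compat2 z y (mkposreal _ Hs) Hy). simpl in H2.
    replace d with (sqrt 2 * (d / sqrt 2)). exact H2.
    field. apply Rgt_not_eq, sqrt_lt_R0; lra.
Qed.

Lemma filterlim_C_Cmod {T : Type} (F : (T -> Prop) -> Prop) {FF : Filter F}
    (u : T -> C) (l : C) :
  filterlim u F (locally l) <->
  forall e : R, 0 < e -> F (fun x => Cmod (u x - l) < e).
Proof.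
  split.
  - intros H e He. apply (H (fun y => Cmod (y - l) < e)).
    apply locally_C_Cmod. exists e. auto.
  - intros H P HP. apply locally_C_Cmod in HP. destruct HP as [d [Hd HP]].
    unfold filtermap. generalize (H d Hd). apply filter_imp. auto.
Qed.

Lemma continuous_C_Cmod (f : C -> C) (z : C) :
  continuous f z <->
  forall e, 0 < e -> exists d, 0 < d /\
    forall y, Cmod (y - z) < d -> Cmod (f y - f z) < e.
Proof.
  unfold continuous. rewrite (filterlim_C_Cmod (locally z)). split; intros H e He.
  - now apply locally_C_Cmod, H.
  - apply locally_C_Cmod, H, He.
Qed.

Section Cont.
Context {T : UniformSpace}.
Implicit Types f g : T -> C.

Lemma cont_pair (f g : T -> R) x : continuous f x -> continuous g x ->
  continuous (fun y => (f y, g y) : C) x.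
Proof.
  intros Hf Hg. apply filterlim_locally. intros e.
  exact (filter_and _ _ (proj1 (filterlim_locally f (f x)) Hf e)
    (proj1 (filterlim_locally g (g x)) Hg e)).
Qed.
Lemma cont_Re f x : continuous f x -> continuous (fun y => Re (f y)) x.
Proof. intros H. apply (continuous_comp f (fun z : C => fst z)); auto. apply continuous_fst. Qed.
Lemma cont_Im f x : continuous f x -> continuous (fun y => Im (f y)) x.
Proof. intros H. apply (continuous_comp f (fun z : C => snd z)); auto. apply continuous_snd. Qed.
Lemma cont_Rmult (f g : T -> R) x : continuous f x -> continuous g x -> continuous (fun y => f y * g y) x.
Proof. apply (continuous_mult (K:=R_AbsRing)). Qed.
Lemma cont_Cplus f g x : continuous f x -> continuous g x -> continuous (fun y => f y + g y)%C x.
Proof. apply (continuous_plus (V:=C_R_NormedModule)). Qed.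
Lemma cont_Copp f x : continuous f x -> continuous (fun y => - f y)%C x.
Proof. apply (continuous_opp (V:=C_R_NormedModule)). Qed.
Lemma cont_Cminus f g x : continuous f x -> continuous g x -> continuous (fun y => f y - g y)%C x.
Proof. intros. apply cont_Cplus; auto. now apply cont_Copp. Qed.
Lemma cont_Cmult f g x : continuous f x -> continuous g x -> continuous (fun y => f y * g y)%C x.
Proof.
  intros Hf Hg. assert (F1 := cont_Re _ _ Hf). assert (F2 := cont_Im _ _ Hf).
  assert (G1 := cont_Re _ _ Hg). assert (G2 := cont_Im _ _ Hg). apply cont_pair.
  - apply (continuous_minus (V:=R_NormedModule)); now apply cont_Rmult.
  - apply (continuous_plus (V:=R_NormedModule)); now apply cont_Rmult.
Qed.
Lemma cont_RtoC (f : T -> R) x : continuous f x -> continuous (fun y => RtoC (f y)) x.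
Proof. intros H. apply cont_pair; auto. apply continuous_const. Qed.
Lemma cont_Cconj f x : continuous f x -> continuous (fun y => Cconj (f y)) x.
Proof.
  intros H. apply cont_pair. now apply cont_Re.
  apply (continuous_opp (V:=R_NormedModule)). now apply cont_Im.
Qed.
Lemma cont_Cmod f x : continuous f x -> continuous (fun y => Cmod (f y)) x.
Proof.
  intros H. assert (H1 := cont_Re _ _ H). assert (H2 := cont_Im _ _ H).
  apply continuous_ext with (fun y => sqrt (Re (f y) * Re (f y) + Im (f y) * Im (f y))).
  { intros y. unfold Cmod, Re, Im. f_equal. simpl. ring. }
  apply (continuous_comp (fun y => Re (f y) * Re (f y) + Im (f y) * Im (f y)) sqrt).
  2: apply continuous_sqrt. apply (continuous_plus (V:=R_NormedModule)); now apply cont_Rmult.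
Qed.
(** The inverse is the conjugate divided by the square of the modulus. *)
Lemma cont_Cinv f x : f x <> RtoC 0 -> continuous f x -> continuous (fun y => / f y)%C x.
Proof.
  intros H0 H. assert (Hm := cont_Cmod _ _ H).
  apply continuous_ext with (fun y => Cconj (f y) * RtoC (/ (Cmod (f y) * Cmod (f y))))%C.
  { intros y. change (Cconj (f y) * RtoC (/ (Cmod (f y) * Cmod (f y))) = / f y)%C.
    replace (Cmod (f y) * Cmod (f y)) with (Cmod (f y) ^ 2) by ring. rewrite Cmod2_alt.
    destruct (f y) as [a b]. unfold Cinv, Cconj, RtoC, Cmult. simpl. f_equal; unfold Rdiv; ring. }
  apply cont_Cmult. now apply cont_Cconj. apply cont_RtoC.
  apply (continuous_comp (fun y => Cmod (f y) * Cmod (f y)) Rinv). now apply cont_Rmult.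
  apply continuous_Rinv. apply Cmod_gt_0 in H0. nra.
Qed.
Lemma cont_Cdiv f g x : g x <> RtoC 0 -> continuous f x -> continuous g x -> continuous (fun y => f y / g y)%C x.
Proof. intros. apply cont_Cmult; auto. now apply cont_Cinv. Qed.
End Cont.

(** Terms whose type is the underlying uniform space are retyped in [C], where the
    ring structure is declared. *)
Ltac cnorm := repeat match goal with y : UniformSpace.sort _ |- _ => progress change C in y end.
Ltac cring := cnorm; match goal with |- @eq _ ?a ?b => change (@eq C a b) end; ring.
Ltac cfield := cnorm; match goal with |- @eq _ ?a ?b => change (@eq C a b) end; field.

(** Caratheodory's form of complex differentiability: [h] is the difference
    quotient, continued to [z] by the derivative. Stability under products,
    inverses and composition then reduces to that of continuity. *)
Definition cdiff (f : C -> C) (z : C) : Prop :=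
  exists h : C -> C, continuous h z /\
    locally z (fun y => f y = f z + (y - z) * h y)%C.

(** The difference quotient extended by [l] at [z] is the continuous factor. *)
Lemma cdiff_of_eps (f : C -> C) (z l : C) :
  (forall e, 0 < e -> exists d, 0 < d /\ forall y, Cmod (y - z) < d ->
     Cmod (f y - f z - (y - z) * l) <= e * Cmod (y - z)) -> cdiff f z.
Proof.
  intros H.
  pose (h := fun y => match Ceq_dec y z with
                      | left _ => l
                      | right _ => ((f y - f z) / (y - z))%C end).
  exists h. split.
  - apply continuous_C_Cmod. intros e He.
    destruct (H (e/2) ltac:(lra)) as [d [Hd0 Hd]].
    exists d. split. exact Hd0. intros y Hy.
    unfold h at 2. destruct (Ceq_dec z z) as [_|E]; [|now elim E].
    unfold h. destruct (Ceq_dec y z) as [->|Hyz].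
    + replace (l - l)%C with (RtoC 0) by ring. now rewrite Cmod_0.
    + specialize (Hd y Hy). assert (Hn := Cminus_eq_contra _ _ Hyz).
      assert (Hm : 0 < Cmod (y - z)) by now apply Cmod_gt_0.
      replace ((f y - f z) / (y - z) - l)%C
        with ((f y - f z - (y - z) * l) / (y - z))%C by (field; auto).
      rewrite Cmod_div by auto.
      apply Rle_lt_trans with (e/2); [|lra].
      apply Rmult_le_reg_r with (Cmod (y - z)); auto.
      unfold Rdiv at 1. rewrite Rmult_assoc, Rinv_l, Rmult_1_r; lra.
  - apply filter_forall. intros y. unfold h. destruct (Ceq_dec y z) as [->|Hyz].
    cring. cfield. now apply Cminus_eq_contra.
Qed.

(** The derivative of the definition of H^2 is taken for the modulus balls on
    the side of the argument and for the coordinatewise balls on the side of the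
    values, so the two notions agree only through [locally_C_Cmod]. *)
Lemma ex_derive_cdiff (f : C -> C) (z : C) :
  @ex_derive C_AbsRing C_NormedModule f z <-> cdiff f z.
Proof.
  split.
  - intros [l [_ H]]. specialize (H z (fun P HP => HP)).
    apply cdiff_of_eps with l. intros e He.
    destruct (H (mkposreal e He)) as [d Hd].
    exists d. split. apply cond_pos. exact Hd.
  - intros [h [Hh Hl]]. exists (h z). split.
    + apply is_linear_scal_l.
    + intros x Hx.
      assert (Ex : z = x).
      { apply (is_filter_lim_locally_unique (V:=AbsRing_NormedModule C_AbsRing)). exact Hx. }
      subst x. clear Hx. intros e.
      apply locally_C_Cmod in Hl. destruct Hl as [d1 [Hd1 H1]].
      destruct (proj1 (continuous_C_Cmod h z) Hh e (cond_pos e)) as [d2 [Hd2 H2]].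
      exists (mkposreal (Rmin d1 d2) (Rmin_glb_lt _ _ _ Hd1 Hd2)).
      intros y Hy. change (Cmod (y - z) < Rmin d1 d2) in Hy.
      assert (A1 := Rmin_l d1 d2). assert (A2 := Rmin_r d1 d2).
      change (Cmod (f y - f z - (y - z) * h z) <= e * Cmod (y - z)).
      rewrite H1 by lra.
      replace (f z + (y - z) * h y - f z - (y - z) * h z)%C with ((h y - h z) * (y - z))%C by ring.
      rewrite Cmod_mult. apply Rmult_le_compat_r. apply Cmod_ge_0.
      apply Rlt_le, H2. lra.
Qed.

Lemma cdiff_continuous f z : cdiff f z -> continuous f z.
Proof.
  intros [h [Hh Hl]].
  assert (H : continuous (fun y => f z + (y - z) * h y)%C z).
  { apply cont_Cplus. apply continuous_const. apply cont_Cmult; auto.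
    apply cont_Cminus. apply continuous_id. apply continuous_const. }
  apply continuous_ext_loc with (fun y => f z + (y - z) * h y)%C; auto.
  revert Hl. apply filter_imp. intros y Hy. now rewrite Hy.
Qed.

Lemma cdiff_ext_loc f g z : locally z (fun y => f y = g y) -> cdiff f z -> cdiff g z.
Proof.
  intros H [h [Hh Hl]]. exists h. split; auto.
  generalize (filter_and _ _ H Hl). apply filter_imp. intros y [E1 E2].
  rewrite <- E1, E2. f_equal. now apply (locally_singleton z).
Qed.

Lemma cdiff_ext f g z : (forall y, f y = g y) -> cdiff f z -> cdiff g z.
Proof. intros H. apply cdiff_ext_loc. now apply filter_forall. Qed.

Lemma cdiff_const c z : cdiff (fun _ => c) z.
Proof.
  exists (fun _ => RtoC 0). split. apply continuous_const.
  apply filter_forall. intros y. cring.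
Qed.

Lemma cdiff_id z : cdiff (fun y => y) z.
Proof.
  exists (fun _ => RtoC 1). split. apply continuous_const.
  apply filter_forall. intros y. cring.
Qed.

Lemma cdiff_plus f g z : cdiff f z -> cdiff g z -> cdiff (fun y => f y + g y)%C z.
Proof.
  intros [h [Hh H1]] [k [Hk H2]]. exists (fun y => h y + k y)%C.
  split. now apply cont_Cplus.
  generalize (filter_and _ _ H1 H2). apply filter_imp. intros y [-> ->]. cring.
Qed.

Lemma cdiff_mult f g z : cdiff f z -> cdiff g z -> cdiff (fun y => f y * g y)%C z.
Proof.
  intros Df [k [Hk H2]]. assert (Cf := cdiff_continuous _ _ Df). destruct Df as [h [Hh H1]].
  exists (fun y => h y * g z + f y * k y)%C.
  split. apply cont_Cplus; apply cont_Cmult; auto. apply continuous_const.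
  generalize (filter_and _ _ H1 H2). apply filter_imp. intros y [E1 ->].
  rewrite !E1. cring.
Qed.

Lemma cdiff_opp f z : cdiff f z -> cdiff (fun y => - f y)%C z.
Proof.
  intros [h [Hh H1]]. exists (fun y => - h y)%C. split. now apply cont_Copp.
  revert H1. apply filter_imp. intros y ->. cring.
Qed.

Lemma cdiff_minus f g z : cdiff f z -> cdiff g z -> cdiff (fun y => f y - g y)%C z.
Proof. intros. apply cdiff_plus; auto. now apply cdiff_opp. Qed.

Lemma cdiff_inv f z : f z <> RtoC 0 -> cdiff f z -> cdiff (fun y => / f y)%C z.
Proof.
  intros Hz Df. assert (Cf := cdiff_continuous _ _ Df). destruct Df as [h [Hh H1]].
  exists (fun y => - h y * (/ f y * / f z))%C. split.
  - apply cont_Cmult. now apply cont_Copp. apply cont_Cmult. now apply cont_Cinv.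
    apply continuous_const.
  - assert (H2 : locally z (fun y => f y <> RtoC 0)).
    { assert (Hm : 0 < Cmod (f z)) by now apply Cmod_gt_0.
      generalize (proj1 (filterlim_C_Cmod _ f (f z)) Cf _ Hm).
      apply filter_imp. intros y Hy E. rewrite E in Hy.
      replace (0 - f z)%C with (- f z)%C in Hy by cring. rewrite Cmod_opp in Hy. lra. }
    generalize (filter_and _ _ H1 H2). apply filter_imp. intros y [E1 E2].
    assert (E3 : ((y - z) * h y = f y - f z)%C) by (rewrite E1; ring).
    replace (/ f z + (y - z) * (- h y * (/ f y * / f z)))%C
      with (/ f z - ((y - z) * h y) * (/ f y * / f z))%C by cring.
    rewrite E3. cfield. auto.
Qed.

Lemma cdiff_div f g z : g z <> RtoC 0 -> cdiff f z -> cdiff g z -> cdiff (fun y => f y / g y)%C z.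
Proof. intros. apply cdiff_mult; auto. now apply cdiff_inv. Qed.

Lemma cdiff_comp f g z : cdiff f (g z) -> cdiff g z -> cdiff (fun y => f (g y)) z.
Proof.
  intros [h [Hh H1]] Dg. assert (Cg := cdiff_continuous _ _ Dg). destruct Dg as [k [Hk H2]].
  exists (fun y => k y * h (g y))%C. split.
  - apply cont_Cmult; auto. now apply (continuous_comp g h).
  - assert (H3 := Cg _ H1). unfold filtermap in H3.
    generalize (filter_and _ _ H2 H3). apply filter_imp. intros y [E1 E2].
    rewrite E2. replace (g y - g z)%C with ((y - z) * k y)%C by (rewrite E1; ring). cring.
Qed.

Lemma Cmod_lt_open r z : Cmod z < r -> locally z (fun y => Cmod y < r).
Proof.
  intros H. apply locally_C_Cmod. exists (r - Cmod z). split. lra.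
  intros y Hy. assert (T := Cmod_triangle (y - z) z).
  replace (y - z + z)%C with y in T by cring. lra.
Qed.

Notation CI := (@RInt C_R_CompleteNormedModule).
Notation ex_CI := (@ex_RInt C_R_NormedModule).
Notation is_CI := (@is_RInt C_R_NormedModule).

(** * Goursat's theorem on rectangles *)

Lemma norm_C_R (z : C) : @norm R_AbsRing C_R_NormedModule z = Cmod z.
Proof.
  destruct z as [x y]. unfold Cmod. simpl.
  unfold norm; simpl. unfold prod_norm. simpl. f_equal.
  unfold norm; simpl. unfold abs; simpl.
  rewrite !Rmult_1_r. f_equal; rewrite <- Rabs_mult; apply Rabs_pos_eq; nra.
Qed.

Lemma is_CI_pair (u : R -> C) a b l :
  is_RInt (fun t => Re (u t)) a b (Re l) -> is_RInt (fun t => Im (u t)) a b (Im l) ->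
  is_CI u a b l.
Proof.
  intros H1 H2. rewrite (surjective_pairing l).
  apply (is_RInt_fct_extend_pair (U:=R_NormedModule) (V:=R_NormedModule)); auto.
Qed.

Lemma is_CI_Re u a b l : is_CI u a b l -> is_RInt (fun t => Re (u t)) a b (Re l).
Proof. apply (is_RInt_fct_extend_fst (U:=R_NormedModule) (V:=R_NormedModule)). Qed.
Lemma is_CI_Im u a b l : is_CI u a b l -> is_RInt (fun t => Im (u t)) a b (Im l).
Proof. apply (is_RInt_fct_extend_snd (U:=R_NormedModule) (V:=R_NormedModule)). Qed.

Lemma is_CI_plus u v a b l m : is_CI u a b l -> is_CI v a b m ->
  is_CI (fun t => u t + v t)%C a b (l + m)%C.
Proof. apply (is_RInt_plus (V:=C_R_NormedModule)). Qed.

Lemma is_CI_scal u a b l (c : C) : is_CI u a b l -> is_CI (fun t => c * u t)%C a b (c * l)%C.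
Proof.
  intros H. assert (H1 := is_CI_Re _ _ _ _ H). assert (H2 := is_CI_Im _ _ _ _ H).
  apply is_CI_pair.
  - apply (is_RInt_ext (fun t => minus (scal (Re c) (Re (u t))) (scal (Im c) (Im (u t))))).
    intros t _. destruct c, (u t). reflexivity.
    replace (Re (c * l)) with (minus (scal (Re c) (Re l)) (scal (Im c) (Im l)))
      by (destruct c, l; reflexivity).
    apply (is_RInt_minus (V:=R_NormedModule)); now apply (is_RInt_scal (V:=R_NormedModule)).
  - apply (is_RInt_ext (fun t => plus (scal (Re c) (Im (u t))) (scal (Im c) (Re (u t))))).
    intros t _. destruct c, (u t). reflexivity.
    replace (Im (c * l)) with (plus (scal (Re c) (Im l)) (scal (Im c) (Re l)))
      by (destruct c, l; reflexivity).
    apply (is_RInt_plus (V:=R_NormedModule)); now apply (is_RInt_scal (V:=R_NormedModule)).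
Qed.

Lemma is_CI_minus u v a b l m : is_CI u a b l -> is_CI v a b m ->
  is_CI (fun t => u t - v t)%C a b (l - m)%C.
Proof. apply (is_RInt_minus (V:=C_R_NormedModule)). Qed.

Lemma CI_correct u a b : ex_CI u a b -> is_CI u a b (CI u a b).
Proof. apply (RInt_correct (V:=C_R_CompleteNormedModule)). Qed.

Lemma CI_unique u a b l : is_CI u a b l -> CI u a b = l.
Proof. apply (is_RInt_unique (V:=C_R_CompleteNormedModule)). Qed.

Lemma CI_bound u a b l M : a <= b -> (forall t, a <= t <= b -> Cmod (u t) <= M) ->
  is_CI u a b l -> Cmod l <= (b - a) * M.
Proof.
  intros Hab H Hl. rewrite <- norm_C_R.
  apply (norm_RInt_le_const (V:=C_R_NormedModule) u a b l M); auto.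
  intros t Ht. rewrite norm_C_R. auto.
Qed.

(** Restricted to a horizontal or a vertical side, an affine function of a
    complex variable is affine in the real parameter; this is the only explicit
    integral needed for Goursat's theorem. *)
Lemma is_CI_affine (al be : C) a b :
  is_CI (fun s => al + be * RtoC s)%C a b
    (al * RtoC (b - a) + be * RtoC ((b * b - a * a) / 2))%C.
Proof.
  assert (Hr : forall p q : R, is_RInt (fun s => p + q * s) a b (p * (b - a) + q * ((b*b-a*a)/2))).
  { intros p q.
    replace (p * (b - a) + q * ((b*b-a*a)/2)) with
      (minus ((fun s => p * s + q * (s * s / 2)) b) ((fun s => p * s + q * (s * s / 2)) a)).
    2: unfold minus, plus, opp; simpl; field.
    apply (is_RInt_derive (V:=R_CompleteNormedModule) (fun s => p * s + q * (s * s / 2))).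
    - intros x _. auto_derive; auto. field.
    - intros x _. apply (continuous_plus (V:=R_NormedModule)). apply continuous_const.
      apply (continuous_mult (K:=R_AbsRing)). apply continuous_const. apply continuous_id. }
  destruct al as [p q], be as [p' q'].
  apply is_CI_pair; simpl.
  - replace (p * (b - a) - q * 0 + (p' * ((b * b - a * a) / 2) - q' * 0))
      with (p * (b - a) + p' * ((b * b - a * a) / 2)) by ring.
    apply (is_RInt_ext (fun s => p + p' * s)). intros; simpl; ring. apply Hr.
  - replace (p * 0 + q * (b - a) + (p' * 0 + q' * ((b * b - a * a) / 2)))
      with (q * (b - a) + q' * ((b * b - a * a) / 2)) by ring.
    apply (is_RInt_ext (fun s => q + q' * s)). intros; simpl; ring. apply Hr.
Qed.

Lemma Ci_sqr : (Ci * Ci)%C = (- RtoC 1)%C.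
Proof. unfold Ci, Cmult, Copp, RtoC; simpl; f_equal; ring. Qed.

Lemma C_split (z : C) : z = (RtoC (Re z) + Ci * RtoC (Im z))%C.
Proof. destruct z; unfold Ci, RtoC, Cmult, Cplus; simpl; f_equal; ring. Qed.

(** The integral of [G] along the positively oriented boundary of the rectangle
    [x, x+a] x [y, y+b]. *)
Definition boundary_int (G : C -> C) (x y a b : R) : C :=
  (CI (fun s => G (s, y)) x (x + a) + Ci * CI (fun t => G ((x + a)%R, t)) y (y + b)
   - CI (fun s => G (s, (y + b)%R)) x (x + a) - Ci * CI (fun t => G (x, t)) y (y + b))%C.

Definition in_rect (x y a b : R) (z : C) := x <= fst z <= x + a /\ y <= snd z <= y + b.

Section Rect.
Variable (G : C -> C).

Lemma ex_CI_h x1 x2 y : x1 <= x2 -> (forall s, x1 <= s <= x2 -> continuous G (s, y)) ->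
  ex_CI (fun s => G (s, y)) x1 x2.
Proof.
  intros H12 H. apply (ex_RInt_continuous (V:=C_R_CompleteNormedModule)).
  intros s. rewrite Rmin_left, Rmax_right by auto. intros Hs.
  apply (continuous_comp (fun s => (s, y) : C) G). 2: auto.
  apply cont_pair. apply continuous_id. apply continuous_const.
Qed.

Lemma ex_CI_v x y1 y2 : y1 <= y2 -> (forall t, y1 <= t <= y2 -> continuous G (x, t)) ->
  ex_CI (fun t => G (x, t)) y1 y2.
Proof.
  intros H12 H. apply (ex_RInt_continuous (V:=C_R_CompleteNormedModule)).
  intros s. rewrite Rmin_left, Rmax_right by auto. intros Hs.
  apply (continuous_comp (fun t => (x, t) : C) G). 2: auto.
  apply cont_pair. apply continuous_const. apply continuous_id.
Qed.

(** The four inner sides are traversed twice, in opposite directions. *)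
Lemma boundary_int_split x y a b : 0 <= a -> 0 <= b ->
  (forall z, in_rect x y (2 * a) (2 * b) z -> continuous G z) ->
  boundary_int G x y (2 * a) (2 * b) =
  (boundary_int G x y a b + boundary_int G (x + a) y a b
   + boundary_int G x (y + b) a b + boundary_int G (x + a) (y + b) a b)%C.
Proof.
  intros Ha Hb HG. unfold boundary_int, in_rect in *.
  replace (x + 2 * a) with (x + a + a) by ring.
  replace (y + 2 * b) with (y + b + b) by ring.
  assert (Hh : forall t, y <= t <= y + 2 * b ->
    CI (fun s => G (s, t)) x (x + a + a)
    = (CI (fun s => G (s, t)) x (x + a) + CI (fun s => G (s, t)) (x + a) (x + a + a))%C).
  { intros t Ht. symmetry.
    apply (RInt_Chasles (V:=C_R_CompleteNormedModule)); apply ex_CI_h; try lra;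
    intros; apply HG; simpl; lra. }
  assert (Hv : forall s, x <= s <= x + 2 * a ->
    CI (fun t => G (s, t)) y (y + b + b)
    = (CI (fun t => G (s, t)) y (y + b) + CI (fun t => G (s, t)) (y + b) (y + b + b))%C).
  { intros t Ht. symmetry.
    apply (RInt_Chasles (V:=C_R_CompleteNormedModule)); apply ex_CI_v; try lra;
    intros; apply HG; simpl; lra. }
  rewrite !Hh by lra. rewrite !Hv by lra. ring.
Qed.

(** The boundary integral of an affine function vanishes, so only the error to
    the affine function contributes, and it does so in proportion to the
    perimeter. *)
Lemma boundary_int_near_affine x y a b al be M : 0 <= a -> 0 <= b ->
  (forall z, in_rect x y a b z -> continuous G z) ->
  (forall z, in_rect x y a b z -> Cmod (G z - (al + be * z)) <= M) ->
  Cmod (boundary_int G x y a b) <= 2 * (a + b) * M.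
Proof.
  intros Ha Hb Gc HM. unfold in_rect in *.
  assert (Hh : forall t, y <= t <= y + b ->
    Cmod (CI (fun s => G (s, t)) x (x + a) - ((al + be * (Ci * RtoC t)) * RtoC (x + a - x)
       + be * RtoC (((x + a) * (x + a) - x * x) / 2))%C) <= a * M).
  { intros t Ht. replace (a * M) with ((x + a - x) * M) by ring.
    apply CI_bound with (fun s => G (s, t) - (al + be * (Ci * RtoC t) + be * RtoC s))%C. lra.
    - intros s Hs. replace (al + be * (Ci * t) + be * s)%C with (al + be * (s, t))%C.
      apply HM; simpl; lra.
      rewrite (C_split (s, t)). simpl. ring.
    - apply is_CI_minus. apply CI_correct, ex_CI_h. lra. intros; apply Gc; simpl; lra.
      apply is_CI_affine. }
  assert (Hv : forall s, x <= s <= x + a ->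
    Cmod (CI (fun t => G (s, t)) y (y + b) - ((al + be * RtoC s) * RtoC (y + b - y)
       + be * Ci * RtoC (((y + b) * (y + b) - y * y) / 2))%C) <= b * M).
  { intros s Hs. replace (b * M) with ((y + b - y) * M) by ring.
    apply CI_bound with (fun t => G (s, t) - (al + be * RtoC s + be * Ci * RtoC t))%C. lra.
    - intros t Ht. replace (al + be * s + be * Ci * t)%C with (al + be * (s, t))%C.
      apply HM; simpl; lra.
      rewrite (C_split (s, t)). simpl. ring.
    - apply is_CI_minus. apply CI_correct, ex_CI_v. lra. intros; apply Gc; simpl; lra.
      apply is_CI_affine. }
  unfold boundary_int.
  assert (E1 := Hh y ltac:(lra)). assert (E2 := Hh (y + b) ltac:(lra)).
  assert (E3 := Hv x ltac:(lra)). assert (E4 := Hv (x + a) ltac:(lra)).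
  replace (2 * (a + b) * M) with (a * M + b * M + a * M + b * M) by ring.
  set (I1 := CI (fun s => G (s, y)) x (x + a)) in *.
  set (I2 := CI (fun s => G (s, y + b)) x (x + a)) in *.
  set (I3 := CI (fun t => G (x, t)) y (y + b)) in *.
  set (I4 := CI (fun t => G (x + a, t)) y (y + b)) in *.
  match type of E1 with Cmod (I1 - ?A) <= _ => set (A1 := A) in * end.
  match type of E2 with Cmod (I2 - ?A) <= _ => set (A2 := A) in * end.
  match type of E3 with Cmod (I3 - ?A) <= _ => set (A3 := A) in * end.
  match type of E4 with Cmod (I4 - ?A) <= _ => set (A4 := A) in * end.
  assert (EA : (A1 + Ci * A4 - A2 - Ci * A3)%C = 0).
  { unfold A1, A2, A3, A4.
    replace (RtoC (x + a)) with (x + a)%C by (now rewrite RtoC_plus).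
    replace (RtoC (y + b)) with (y + b)%C by (now rewrite RtoC_plus).
    replace (x + a - x)%R with a by ring. replace (y + b - y)%R with b by ring. ring. }
  replace (I1 + Ci * I4 - I2 - Ci * I3)%C with
    ((I1 - A1) + Ci * (I4 - A4) + - (I2 - A2) + - (Ci * (I3 - A3)) + (A1 + Ci * A4 - A2 - Ci * A3))%C by ring.
  rewrite EA, Cplus_0_r.
  eapply Rle_trans. apply Cmod_triangle. apply Rplus_le_compat.
  eapply Rle_trans. apply Cmod_triangle. apply Rplus_le_compat.
  eapply Rle_trans. apply Cmod_triangle. apply Rplus_le_compat.
  exact E1.
  rewrite Cmod_mult, Cmod_Ci, Rmult_1_l. exact E4.
  rewrite Cmod_opp. exact E2.
  rewrite Cmod_opp, Cmod_mult, Cmod_Ci, Rmult_1_l. exact E3.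
Qed.
End Rect.

(** A choice of quarters, each inside the previous one, converges to a point
    that belongs to all of them. *)
Lemma nested_dyadic (P : nat -> R -> R -> Prop) (x0 y0 a b : R) :
  0 < a -> 0 < b -> P O x0 y0 ->
  (forall k x y, P k x y -> exists x' y', P (S k) x' y' /\
     (x' = x \/ x' = x + a / 2 ^ (S k)) /\ (y' = y \/ y' = y + b / 2 ^ (S k))) ->
  exists X Y, in_rect x0 y0 a b (X, Y) /\
    forall k, exists x y, P k x y /\ in_rect x y (a / 2 ^ k) (b / 2 ^ k) (X, Y)
      /\ x0 <= x /\ x + a / 2 ^ k <= x0 + a /\ y0 <= y /\ y + b / 2 ^ k <= y0 + b.
Proof.
  intros Ha Hb H0 HS.
  (* a quarter of the current rectangle that satisfies the property; the pair itself is
     the default value of the choice *)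
  pose (next := fun (k : nat) (p : R * R) =>
    epsilon (inhabits p) (fun q => P (S k) (fst q) (snd q) /\
     (fst q = fst p \/ fst q = fst p + a / 2 ^ (S k)) /\
     (snd q = snd p \/ snd q = snd p + b / 2 ^ (S k)))).
  pose (q := fix q (k : nat) := match k with O => (x0, y0) | S k => next k (q k) end).
  assert (Hq : forall k, P k (fst (q k)) (snd (q k))
    /\ (P k (fst (q k)) (snd (q k)) ->
     (fst (q (S k)) = fst (q k) \/ fst (q (S k)) = fst (q k) + a / 2 ^ (S k)) /\
     (snd (q (S k)) = snd (q k) \/ snd (q (S k)) = snd (q k) + b / 2 ^ (S k)))).
  { assert (Hn : forall k p, P k (fst p) (snd p) -> let r := next k p in
      P (S k) (fst r) (snd r) /\
     (fst r = fst p \/ fst r = fst p + a / 2 ^ (S k)) /\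
     (snd r = snd p \/ snd r = snd p + b / 2 ^ (S k))).
    { intros k p Hp. unfold next. cbv zeta. apply epsilon_spec.
      destruct (HS _ _ _ Hp) as [x' [y' H]]. exists (x', y'). exact H. }
    intros k. split. 2: now intros Hk; apply (Hn k (q k)).
    induction k. exact H0. apply (Hn k (q k)), IHk. }
  assert (Hstep : forall c, 0 < c -> forall k, c / 2 ^ (S k) = c / 2 ^ k / 2 /\ 0 < c / 2 ^ k).
  { intros c Hc k. assert (0 < 2 ^ k) by (apply pow_lt; lra). split.
    simpl. field. lra. now apply Rdiv_lt_0_compat. }
  assert (Hlim : forall c (u : nat -> R), 0 < c ->
    (forall k, u (S k) = u k \/ u (S k) = u k + c / 2 ^ (S k)) ->
    exists U, forall k, u k <= U <= u k + c / 2 ^ k /\ u O <= u k /\ u k + c / 2 ^ k <= u O + c).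
  { intros c u Hc Hu.
    assert (Hi : forall k, u k <= u (S k) /\ u (S k) + c / 2 ^ (S k) <= u k + c / 2 ^ k).
    { intros k. destruct (Hstep c Hc k) as [E E']. destruct (Hu k) as [-> | ->]; rewrite E; lra. }
    assert (Hinc : forall n m, (n <= m)%nat -> u n <= u m /\ u m + c / 2 ^ m <= u n + c / 2 ^ n).
    { induction 1. lra. destruct (Hi m). lra. }
    assert (Hup : forall n m, u n <= u m + c / 2 ^ m).
    { intros n m. destruct (Nat.le_ge_cases n m) as [L|L].
      - destruct (Hinc _ _ L). destruct (Hstep c Hc m). lra.
      - destruct (Hinc _ _ L). destruct (Hstep c Hc n). lra. }
    destruct (completeness (fun v => exists k, v = u k)) as [U [HU1 HU2]].
    - exists (u O + c / 2 ^ O). intros v [k ->]. apply Hup.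
    - exists (u O), O. reflexivity.
    - exists U. intros k. repeat split.
      + apply HU1. now exists k.
      + apply HU2. intros v [n ->]. apply Hup.
      + apply (Hinc O k); lia.
      + destruct (Hinc O k) as [_ E]. lia. simpl in E. lra. }
  destruct (Hlim a (fun k => fst (q k)) Ha) as [X HX].
  { intros k. destruct (Hq k) as [A B]. apply B, A. }
  destruct (Hlim b (fun k => snd (q k)) Hb) as [Y HY].
  { intros k. destruct (Hq k) as [A B]. apply B, A. }
  exists X, Y. split.
  - destruct (HX O) as [A _]. destruct (HY O) as [B _]. unfold in_rect. simpl in *. lra.
  - intros k. exists (fst (q k)), (snd (q k)). split. apply Hq.
    destruct (HX k) as [A A']. destruct (HY k) as [B B']. unfold in_rect. simpl in *. lra.
Qed.

Lemma Cmod_le_abs (z : C) : Cmod z <= Rabs (Re z) + Rabs (Im z).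
Proof.
  rewrite (C_split z) at 1.
  eapply Rle_trans. apply Cmod_triangle. rewrite Cmod_mult, Cmod_Ci, !Cmod_R. lra.
Qed.

(** If the boundary integral were nonzero, one of the four quarters would carry
    at least a quarter of its modulus, and so on down to a point X + iY. Near
    that point [G] is affine up to o(diameter), which makes the integrals over
    the quarters o(4^-k): a contradiction. *)
Theorem goursat (G : C -> C) (x y a b : R) : 0 < a -> 0 < b ->
  (forall z, in_rect x y a b z -> cdiff G z) -> boundary_int G x y a b = RtoC 0.
Proof.
  intros Ha Hb HG.
  assert (HGc : forall z, in_rect x y a b z -> continuous G z).
  { intros z Hz. apply cdiff_continuous, HG, Hz. }
  apply Cmod_eq_0. apply Rle_antisym; [|apply Cmod_ge_0]. apply Rnot_lt_le. intros HJ.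
  set (J := Cmod (boundary_int G x y a b)) in *.
  pose (Q := fun (k : nat) (x' y' : R) =>
     x <= x' /\ x' + a / 2 ^ k <= x + a /\ y <= y' /\ y' + b / 2 ^ k <= y + b).
  pose (P := fun (k : nat) (x' y' : R) =>
     J / 4 ^ k <= Cmod (boundary_int G x' y' (a / 2 ^ k) (b / 2 ^ k)) /\ Q k x' y').
  assert (Hstep : forall c, 0 < c -> forall k, c / 2 ^ k = 2 * (c / 2 ^ (S k)) /\ 0 < c / 2 ^ S k).
  { intros c Hc k. assert (0 < 2 ^ k) by (apply pow_lt; lra). split.
    simpl. field. lra. apply Rdiv_lt_0_compat; auto. simpl. lra. }
  destruct (nested_dyadic P x y a b Ha Hb) as [X [Y [HXY HP]]].
  - unfold P, Q. simpl. rewrite !Rdiv_1_r. fold J. lra.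
  - intros k x' y' [HJk Hx].
    destruct (Hstep a Ha k) as [Ea Ea']. destruct (Hstep b Hb k) as [Eb Eb'].
    unfold Q in Hx. rewrite Ea, Eb in Hx, HJk. unfold P, Q.
    set (a' := a / 2 ^ S k) in *. set (b' := b / 2 ^ S k) in *.
    rewrite boundary_int_split in HJk; try lra.
    2: { intros z [Hz1 Hz2]. apply HGc. unfold in_rect. lra. }
    set (J1 := boundary_int G x' y' a' b') in *.
    set (J2 := boundary_int G (x' + a') y' a' b') in *.
    set (J3 := boundary_int G x' (y' + b') a' b') in *.
    set (J4 := boundary_int G (x' + a') (y' + b') a' b') in *.
    assert (Et : J / 4 ^ k = 4 * (J / 4 ^ S k)).
    { assert (0 < 4 ^ k) by (apply pow_lt; lra). simpl. field. lra. }
    assert (T1 := Cmod_triangle (J1 + J2 + J3) J4).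
    assert (T2 := Cmod_triangle (J1 + J2) J3).
    assert (T3 := Cmod_triangle J1 J2).
    destruct (Rle_lt_dec (J / 4 ^ S k) (Cmod J1)) as [L1|L1].
    { exists x', y'. fold J1. repeat split; auto; lra. }
    destruct (Rle_lt_dec (J / 4 ^ S k) (Cmod J2)) as [L2|L2].
    { exists (x' + a'), y'. fold J2. repeat split; auto; lra. }
    destruct (Rle_lt_dec (J / 4 ^ S k) (Cmod J3)) as [L3|L3].
    { exists x', (y' + b'). fold J3. repeat split; auto; lra. }
    exists (x' + a'), (y' + b'). fold J4. repeat split; auto; lra.
  - destruct (HG _ HXY) as [h [Hh Hl]].
    set (z0 := (X, Y) : C) in *.
    (* With this tolerance, the bound on the integral over a small rectangle is half of
       the lower bound that it inherits from [J]. *)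
    pose (e := J / (4 * ((a + b) * (a + b)))).
    assert (Hab : 0 < (a + b) * (a + b)) by (apply Rmult_lt_0_compat; lra).
    assert (He : 0 < e) by (apply Rdiv_lt_0_compat; lra).
    destruct (proj1 (continuous_C_Cmod h z0) Hh e He) as [d1 [Hd1 H1]].
    apply locally_C_Cmod in Hl. destruct Hl as [d2 [Hd2 H2]].
    assert (Hd : 0 < Rmin d1 d2) by (apply Rmin_glb_lt; auto).
    assert (M1 := Rmin_l d1 d2). assert (M2 := Rmin_r d1 d2).
    destruct (pow_lt_1_zero (/2)) with (y := Rmin d1 d2 / (a + b)) as [N HN].
    { rewrite Rabs_pos_eq; lra. } { apply Rdiv_lt_0_compat; lra. }
    specialize (HN N (le_n _)). rewrite Rabs_pos_eq in HN by (apply pow_le; lra).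
    rewrite pow_inv in HN.
    destruct (HP N) as [x' [y' [[HJN HQ] [Hin _]]]].
    set (p := 2 ^ N) in *. assert (Hp : 0 < p) by (apply pow_lt; lra).
    assert (Hp' : 0 < / p) by now apply Rinv_0_lt_compat.
    assert (Hdiam : a / p + b / p < Rmin d1 d2).
    { replace (a / p + b / p) with ((a + b) * / p) by (field; lra).
      apply Rlt_le_trans with ((a + b) * (Rmin d1 d2 / (a + b))).
      apply Rmult_lt_compat_l; lra. right; field; lra. }
    assert (HB : Cmod (boundary_int G x' y' (a / p) (b / p))
      <= 2 * (a / p + b / p) * (e * (a / p + b / p))).
    { unfold Q in HQ.
      apply (boundary_int_near_affine G x' y' (a/p) (b/p) (G z0 - z0 * h z0) (h z0)).
      - apply Rlt_le, Rdiv_lt_0_compat; lra.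
      - apply Rlt_le, Rdiv_lt_0_compat; lra.
      - intros z [Hz1 Hz2]. apply HGc. fold p in HQ. unfold in_rect; lra.
      - intros z Hz.
        assert (Hzz : Cmod (z - z0) <= a / p + b / p).
        { eapply Rle_trans. apply Cmod_le_abs.
          destruct z as [zx zy]. unfold in_rect, z0 in *. simpl in *.
          apply Rplus_le_compat; apply Rabs_le; lra. }
        rewrite (H2 z) by lra.
        replace (G z0 + (z - z0) * h z - (G z0 - z0 * h z0 + h z0 * z))%C
          with ((h z - h z0) * (z - z0))%C by ring.
        rewrite Cmod_mult.
        apply Rmult_le_compat; try apply Cmod_ge_0. apply Rlt_le, H1. lra. lra. }
    fold p in HJN.
    replace (4 ^ N) with (p * p) in HJN.
    2: { unfold p. rewrite <- Rpow_mult_distr. now replace (2*2) with 4 by ring. }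
    replace (2 * (a / p + b / p) * (e * (a / p + b / p))) with (J / (p * p) / 2) in HB.
    2: { unfold e. field. split; lra. }
    assert (0 < J / (p * p)) by (apply Rdiv_lt_0_compat; nra). lra.
Qed.

(** * Means over circles *)

Definition circ (r t : R) : C := (r * cos t, r * sin t).

Lemma Cmod_circ r t : 0 <= r -> Cmod (circ r t) = r.
Proof.
  intros H. unfold Cmod, circ. simpl.
  replace (r * cos t * (r * cos t * 1) + r * sin t * (r * sin t * 1)) with (r * r * (Rsqr (sin t) + Rsqr (cos t))) by (unfold Rsqr; ring).
  rewrite sin2_cos2, Rmult_1_r. now apply sqrt_square.
Qed.

Lemma cont_circ (r t : R) : continuous (circ r) t.
Proof.
  apply cont_pair; apply (continuous_mult (K:=R_AbsRing)); try apply continuous_const.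
  apply continuous_cos. apply continuous_sin.
Qed.

Lemma cont_comp_circ (f : C -> C) (r t : R) : continuous f (circ r t) -> continuous (fun t => f (circ r t)) t.
Proof. intros H. apply (continuous_comp (circ r) f); auto. apply cont_circ. Qed.

Lemma circ_period r : circ r (0 + 2 * PI) = circ r 0.
Proof. unfold circ. rewrite Rplus_0_l, cos_2PI, sin_2PI, cos_0, sin_0. reflexivity. Qed.

(** The exponential, in polar form: it maps vertical lines to the circles [circ
    r], which turns means over circles into integrals over vertical sides of
    rectangles. *)
Definition cexp (z : C) : C := circ (exp (fst z)) (snd z).

Lemma cexp_plus z w : cexp (z + w) = (cexp z * cexp w)%C.
Proof.
  unfold cexp, circ, Cmult. simpl. rewrite exp_plus, cos_plus, sin_plus. f_equal; ring.
Qed.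

Lemma derivable_pt_lim_eps f l : derivable_pt_lim f 0 l ->
  forall e, 0 < e -> exists d, 0 < d /\ forall x, Rabs x < d -> Rabs (f x - f 0 - l * x) <= e * Rabs x.
Proof.
  intros H e He. destruct (H e He) as [d Hd]. exists d. split. apply cond_pos.
  intros x Hx. destruct (Req_dec x 0) as [->|Hx0].
  - replace (f 0 - f 0 - l * 0) with 0 by ring. rewrite Rabs_R0. lra.
  - specialize (Hd x Hx0 Hx). rewrite Rplus_0_l in Hd.
    replace (f x - f 0 - l * x) with (((f x - f 0) / x - l) * x) by (field; auto).
    rewrite Rabs_mult. apply Rmult_le_compat_r. apply Rabs_pos. lra.
Qed.

(** By the addition formula only the point 0 matters, where the derivatives of
    exp, cos and sin at 0 give the expansion 1 + z + o(z). *)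
Lemma cdiff_cexp z : cdiff cexp z.
Proof.
  assert (H0 : cdiff cexp (RtoC 0)).
  { apply cdiff_of_eps with (RtoC 1). intros e He.
    (* [e'] bounds the relative errors; the five error terms below are at most
       [e' * m] or [2 * (e' * m)], seven times [e' * m] in total. *)
    pose (e' := Rmin 1 (e / 7)).
    assert (He' : 0 < e') by (apply Rmin_glb_lt; lra).
    assert (He1 : e' <= 1) by apply Rmin_l. assert (He2 : e' <= e / 7) by apply Rmin_r.
    clearbody e'.
    destruct (derivable_pt_lim_eps exp 1) with (e := e') as [d1 [Hd1 H1]]; auto.
    { generalize (derivable_pt_lim_exp 0). now rewrite exp_0. }
    destruct (derivable_pt_lim_eps sin 1) with (e := e') as [d2 [Hd2 H2]]; auto.
    { generalize (derivable_pt_lim_sin 0). now rewrite cos_0. }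
    destruct (derivable_pt_lim_eps cos 0) with (e := e') as [d3 [Hd3 H3]]; auto.
    { generalize (derivable_pt_lim_cos 0). now rewrite sin_0, Ropp_0. }
    exists (Rmin e' (Rmin d1 (Rmin d2 d3))). split. repeat apply Rmin_glb_lt; auto.
    intros [x y] Hxy. replace ((x, y) - 0)%C with ((x, y) : C) in * by (unfold Cminus, Cplus, Copp; simpl; f_equal; ring).
    assert (A1 := Rmin_l e' (Rmin d1 (Rmin d2 d3))). assert (A2 := Rmin_r e' (Rmin d1 (Rmin d2 d3))).
    assert (A3 := Rmin_l d1 (Rmin d2 d3)). assert (A4 := Rmin_r d1 (Rmin d2 d3)).
    assert (A5 := Rmin_l d2 d3). assert (A6 := Rmin_r d2 d3).
    assert (B := Rmax_Cmod (x, y)). simpl in B.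
    assert (B1 := Rmax_l (Rabs x) (Rabs y)). assert (B2 := Rmax_r (Rabs x) (Rabs y)).
    specialize (H1 x ltac:(lra)). specialize (H2 y ltac:(lra)). specialize (H3 y ltac:(lra)).
    rewrite exp_0 in H1. rewrite sin_0 in H2. rewrite cos_0 in H3.
    set (m := Cmod (x, y)) in *.
    assert (Bx : Rabs x <= m) by lra. assert (By : Rabs y <= m) by lra. assert (Bx1 : Rabs x <= e') by lra.
    eapply Rle_trans. apply Cmod_le_abs.
    unfold cexp, circ, Cminus, Cplus, Copp, Cmult. simpl. rewrite exp_0, cos_0, sin_0.
    set (E := exp x - 1 - 1 * x) in *.
    set (S := sin y - 0 - 1 * y) in *. set (K := cos y - 1 - 0 * y) in *.
    assert (Bc : Rabs (cos y) <= 1) by (apply Rabs_le; generalize (COS_bound y); lra).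
    assert (Bs : Rabs (sin y) <= 1) by (apply Rabs_le; generalize (SIN_bound y); lra).
    replace (exp x * cos y + - (1 * 1) + - (x * 1 - y * 0)) with (E * cos y + (1 + x) * K) by (unfold E, K; ring).
    replace (exp x * sin y + - (1 * 0) + - (x * 0 + y * 1)) with (E * sin y + (1 + x) * S + x * y) by (unfold E, S; ring).
    assert (Rabs (1 + x) <= 2). { eapply Rle_trans. apply Rabs_triang. rewrite Rabs_R1. lra. }
    assert (Hm : 0 <= m) by apply Cmod_ge_0.
    assert (Em : e' * Rabs x <= e' * m) by (apply Rmult_le_compat_l; lra).
    assert (Em' : e' * Rabs y <= e' * m) by (apply Rmult_le_compat_l; lra).
    assert (P1 : Rabs (E * cos y) <= e' * m).
    { rewrite Rabs_mult. generalize (Rabs_pos E) (Rabs_pos (cos y)). nra. }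
    assert (P2 : Rabs (E * sin y) <= e' * m).
    { rewrite Rabs_mult. generalize (Rabs_pos E) (Rabs_pos (sin y)). nra. }
    assert (P3 : Rabs ((1 + x) * K) <= 2 * (e' * m)).
    { rewrite Rabs_mult. generalize (Rabs_pos K) (Rabs_pos (1 + x)). nra. }
    assert (P4 : Rabs ((1 + x) * S) <= 2 * (e' * m)).
    { rewrite Rabs_mult. generalize (Rabs_pos S) (Rabs_pos (1 + x)). nra. }
    assert (P5 : Rabs (x * y) <= e' * m).
    { rewrite Rabs_mult. generalize (Rabs_pos x) (Rabs_pos y). nra. }
    apply Rle_trans with (7 * (e' * m)).
    - assert (Q1 := Rabs_triang (E * cos y) ((1 + x) * K)).
      assert (Q2 := Rabs_triang (E * sin y + (1 + x) * S) (x * y)).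
      assert (Q3 := Rabs_triang (E * sin y) ((1 + x) * S)). nra.
    - nra. }
  apply cdiff_ext with (fun y => cexp z * cexp (y - z))%C.
  { intros y. rewrite <- cexp_plus. f_equal. cring. }
  apply cdiff_mult. apply cdiff_const.
  apply (cdiff_comp cexp (fun y => y - z)%C).
  replace (z - z)%C with (RtoC 0) by ring. exact H0.
  apply cdiff_minus. apply cdiff_id. apply cdiff_const.
Qed.

(** The normalised integrals over a period, of a complex and of a real function;
    [rmean] is the one that occurs in the circle means of the Hardy space. *)
Definition mean (u : R -> C) : C := (RtoC (/ (2 * PI)) * CI u 0 (2 * PI))%C.
Definition rmean (u : R -> R) : R := / (2 * PI) * RInt u 0 (2 * PI).

Lemma two_PI_pos : 0 < 2 * PI.
Proof. generalize PI_RGT_0. lra. Qed.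

Definition cont (u : R -> C) := forall t, continuous u t.
Definition rcont (u : R -> R) := forall t : R, continuous u t.

Lemma cont_is_CI u a b : cont u -> is_CI u a b (CI u a b).
Proof.
  intros H. apply CI_correct.
  apply (ex_RInt_continuous (V:=C_R_CompleteNormedModule)). intros; apply H.
Qed.

Lemma rcont_ex u a b : rcont u -> ex_RInt u a b.
Proof. intros H. apply (ex_RInt_continuous (V:=R_CompleteNormedModule)). intros; apply H. Qed.

Lemma mean_of_is_CI u l : is_CI u 0 (2 * PI) (RtoC (2 * PI) * l)%C -> mean u = l.
Proof.
  intros H. unfold mean. rewrite (CI_unique _ _ _ _ H), Cmult_assoc, <- RtoC_mult.
  rewrite Rinv_l. now rewrite Cmult_1_l. apply Rgt_not_eq, two_PI_pos.
Qed.

Lemma cont_is_mean u : cont u -> is_CI u 0 (2 * PI) (RtoC (2 * PI) * mean u)%C.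
Proof.
  intros H. unfold mean. rewrite Cmult_assoc, <- RtoC_mult, Rinv_r, Cmult_1_l.
  now apply cont_is_CI. apply Rgt_not_eq, two_PI_pos.
Qed.

Lemma mean_ext u v : (forall t, u t = v t) -> mean u = mean v.
Proof. intros H. f_equal. apply functional_extensionality; auto. Qed.

Lemma mean_plus u v : cont u -> cont v -> mean (fun t => u t + v t)%C = (mean u + mean v)%C.
Proof.
  intros Hu Hv. apply mean_of_is_CI. rewrite Cmult_plus_distr_l.
  apply is_CI_plus; now apply cont_is_mean.
Qed.

Lemma mean_minus u v : cont u -> cont v -> mean (fun t => u t - v t)%C = (mean u - mean v)%C.
Proof.
  intros Hu Hv. apply mean_of_is_CI.
  replace (RtoC (2 * PI) * (mean u - mean v))%C with (RtoC (2 * PI) * mean u - RtoC (2 * PI) * mean v)%C by ring.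
  apply is_CI_minus; now apply cont_is_mean.
Qed.

Lemma mean_scal c u : cont u -> mean (fun t => c * u t)%C = (c * mean u)%C.
Proof.
  intros Hu. apply mean_of_is_CI.
  replace (RtoC (2 * PI) * (c * mean u))%C with (c * (RtoC (2 * PI) * mean u))%C by ring.
  apply is_CI_scal; now apply cont_is_mean.
Qed.

Lemma mean_const c : mean (fun _ => c) = c.
Proof.
  apply mean_of_is_CI. generalize (is_CI_affine c (RtoC 0) 0 (2 * PI)).
  replace (c * RtoC (2 * PI - 0) + RtoC 0 * RtoC ((2 * PI * (2 * PI) - 0 * 0) / 2))%C
    with (RtoC (2 * PI) * c)%C. 2: { rewrite Rminus_0_r. ring. }
  apply (is_RInt_ext (V:=C_R_NormedModule)). intros. cring.
Qed.

Lemma rmean_plus u v : rcont u -> rcont v -> rmean (fun t => u t + v t) = rmean u + rmean v.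
Proof.
  intros Hu Hv. unfold rmean. rewrite <- Rmult_plus_distr_l. f_equal.
  apply (RInt_plus (V:=R_CompleteNormedModule)); now apply rcont_ex.
Qed.

Lemma rmean_scal c u : rcont u -> rmean (fun t => c * u t) = c * rmean u.
Proof.
  intros Hu. unfold rmean.
  replace (c * (/ (2 * PI) * RInt u 0 (2 * PI))) with (/ (2 * PI) * (c * RInt u 0 (2 * PI))) by ring. f_equal.
  apply (RInt_scal (V:=R_CompleteNormedModule)); now apply rcont_ex.
Qed.

Lemma rmean_ext u v : (forall t, u t = v t) -> rmean u = rmean v.
Proof. intros H. f_equal. apply functional_extensionality; auto. Qed.

Lemma rmean_le u v : rcont u -> rcont v -> (forall t, u t <= v t) -> rmean u <= rmean v.
Proof.
  intros Hu Hv H. unfold rmean. apply Rmult_le_compat_l.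
  apply Rlt_le, Rinv_0_lt_compat, two_PI_pos.
  apply RInt_le. apply Rlt_le, two_PI_pos. now apply rcont_ex. now apply rcont_ex. auto.
Qed.

Lemma rmean_const c : rmean (fun _ => c) = c.
Proof.
  unfold rmean. rewrite (is_RInt_unique (V:=R_CompleteNormedModule) _ _ _ ((2 * PI) * c) ).
  field. generalize PI_RGT_0. lra.
  replace (2 * PI * c) with (scal (2 * PI - 0) c).
  apply (is_RInt_const (V:=R_NormedModule)).
  rewrite Rminus_0_r. reflexivity.
Qed.

Lemma rcont_const c : rcont (fun _ => c).
Proof. intros t. apply continuous_const. Qed.

Lemma rmean_pos u : rcont u -> (forall t, 0 <= u t) -> 0 <= rmean u.
Proof. intros Hu H. rewrite <- (rmean_const 0). apply rmean_le; auto. apply rcont_const. Qed.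

Lemma Re_mean u : cont u -> Re (mean u) = rmean (fun t => Re (u t)).
Proof.
  intros Hu. assert (H := is_CI_Re _ _ _ _ (cont_is_mean u Hu)).
  unfold rmean. rewrite (is_RInt_unique _ _ _ _ H).
  replace (Re (RtoC (2 * PI) * mean u)) with (2 * PI * Re (mean u)).
  field. generalize PI_RGT_0; lra.
  destruct (mean u); simpl; ring.
Qed.

Lemma mean_RtoC u : rcont u -> mean (fun t => RtoC (u t)) = RtoC (rmean u).
Proof.
  intros Hu. apply mean_of_is_CI. unfold rmean.
  replace (RtoC (2 * PI) * RtoC (/ (2 * PI) * RInt u 0 (2 * PI)))%C with (RtoC (RInt u 0 (2 * PI))).
  2: { rewrite <- RtoC_mult. f_equal. set (I := RInt u 0 (2 * PI) : R). change (I = 2 * PI * (/ (2 * PI) * I)).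
       field. generalize PI_RGT_0; lra. }
  apply is_CI_pair; simpl.
  apply (RInt_correct (V:=R_CompleteNormedModule)). now apply rcont_ex.
  assert (H0 := is_RInt_const (V:=R_NormedModule) 0 (2 * PI) 0).
  refine (eq_ind _ (is_RInt (V:=R_NormedModule) (fun _ => 0) 0 (2 * PI)) H0 _ _).
  apply (Rmult_0_r (2 * PI - 0)).
Qed.

Lemma rcont_Cmod u : cont u -> rcont (fun t => Cmod (u t)).
Proof. intros H t. now apply cont_Cmod. Qed.
Lemma rcont_Re u : cont u -> rcont (fun t => Re (u t)).
Proof. intros H t. now apply cont_Re. Qed.
Lemma cont_const c : cont (fun _ => c).
Proof. intros t. apply continuous_const. Qed.
Lemma cont_mult u v : cont u -> cont v -> cont (fun t => u t * v t)%C.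
Proof. intros H1 H2 t. now apply cont_Cmult. Qed.
Lemma cont_minus u v : cont u -> cont v -> cont (fun t => u t - v t)%C.
Proof. intros H1 H2 t. now apply cont_Cminus. Qed.
Lemma cont_div u v : (forall t, v t <> RtoC 0) -> cont u -> cont v -> cont (fun t => u t / v t)%C.
Proof. intros H0 H1 H2 t. now apply cont_Cdiv. Qed.
Lemma cont_ofR u : rcont u -> cont (fun t => RtoC (u t)).
Proof. intros H t. apply cont_RtoC, H. Qed.
Lemma rcont_plus u v : rcont u -> rcont v -> rcont (fun t => u t + v t).
Proof. intros H1 H2 t. apply (continuous_plus (V:=R_NormedModule)); auto. Qed.
Lemma rcont_mult u v : rcont u -> rcont v -> rcont (fun t => u t * v t).
Proof. intros H1 H2 t. apply (continuous_mult (K:=R_AbsRing)); auto. Qed.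
Lemma rcont_pow2 u : rcont u -> rcont (fun t => u t ^ 2).
Proof.
  intros H t. apply continuous_ext with (fun t => u t * u t). intros; simpl; ring.
  now apply rcont_mult.
Qed.

(** Rotate the mean to the positive real axis, then compare real parts. *)
Lemma Cmod_mean_le u : cont u -> Cmod (mean u) <= rmean (fun t => Cmod (u t)).
Proof.
  intros Hu. destruct (Ceq_dec (mean u) (RtoC 0)) as [->|Hm].
  { rewrite Cmod_0. apply rmean_pos. now apply rcont_Cmod. intros; apply Cmod_ge_0. }
  assert (Hm' : 0 < Cmod (mean u)) by now apply Cmod_gt_0.
  set (c := (Cconj (mean u) / RtoC (Cmod (mean u)))%C).
  assert (Hc : Cmod c = 1).
  { unfold c. rewrite Cmod_div, Cmod_conj, Cmod_R, Rabs_pos_eq by (try lra; intros E; apply RtoC_inj in E; lra).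
    field. lra. }
  assert (E : Cmod (mean u) = Re (mean (fun t => c * u t)%C)).
  { rewrite mean_scal by auto. unfold c.
    replace (Cconj (mean u) / Cmod (mean u) * mean u)%C with ((mean u * Cconj (mean u)) / Cmod (mean u))%C.
    2: { field. intros E; apply RtoC_inj in E; lra. }
    rewrite <- Cmod2_conj, <- RtoC_div by lra. simpl. field. lra. }
  rewrite E, Re_mean by (apply cont_mult; auto; apply cont_const).
  apply rmean_le.
  - apply rcont_Re, cont_mult; auto; apply cont_const.
  - now apply rcont_Cmod.
  - intros t. eapply Rle_trans. apply Rle_abs. eapply Rle_trans. apply re_le_Cmod.
    rewrite Cmod_mult, Hc. lra.
Qed.

Lemma Cmod_mean_bound u M : cont u -> (forall t, Cmod (u t) <= M) -> Cmod (mean u) <= M.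
Proof.
  intros Hu H. eapply Rle_trans. now apply Cmod_mean_le.
  rewrite <- (rmean_const M). apply rmean_le; auto. now apply rcont_Cmod. apply rcont_const.
Qed.

(** Pulled back by the exponential, an annulus becomes a strip, and the two
    circles become the vertical sides of a rectangle whose horizontal sides
    cancel by periodicity. *)
Lemma annulus_mean (F : C -> C) (r1 r2 : R) : 0 <= r1 ->
  (forall z, r1 < Cmod z < r2 -> cdiff F z) ->
  forall r r', r1 < r < r2 -> r1 < r' < r2 ->
  mean (fun t => F (circ r t)) = mean (fun t => F (circ r' t)).
Proof.
  intros H1 HF.
  assert (Hlt : forall r r', r1 < r < r2 -> r1 < r' < r2 -> r < r' ->
    mean (fun t => F (circ r t)) = mean (fun t => F (circ r' t))).
  { intros r r' Hr Hr' Hrr.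
    assert (HJ : boundary_int (fun z => F (cexp z)) (ln r) 0 (ln r' - ln r) (2 * PI) = RtoC 0).
    { apply goursat. generalize (ln_increasing r r'); lra. apply two_PI_pos.
      intros z [Hz _]. apply (cdiff_comp F cexp). 2: apply cdiff_cexp.
      apply HF. unfold cexp. rewrite Cmod_circ by (apply Rlt_le, exp_pos).
      assert (Er : exp (ln r) = r) by (apply exp_ln; lra).
      assert (Er' : exp (ln r') = r') by (apply exp_ln; lra).
      assert (exp (ln r) <= exp (fst z)).
      { destruct (Req_dec (ln r) (fst z)) as [->|]. lra. apply Rlt_le, exp_increasing; lra. }
      assert (exp (fst z) <= exp (ln r')).
      { destruct (Req_dec (ln r') (fst z)) as [->|]. lra. apply Rlt_le, exp_increasing; lra. }
      lra. }
    unfold boundary_int in HJ.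
    replace (ln r + (ln r' - ln r)) with (ln r') in HJ by ring.
    unfold cexp in HJ. simpl in HJ. rewrite Rplus_0_l in HJ.
    rewrite !exp_ln in HJ by lra.
    unfold mean. f_equal.
    match type of HJ with (?A + Ci * ?B - ?A' - Ci * ?B' = _)%C =>
      assert (EA : A' = A) end.
    { apply (RInt_ext (V:=C_R_CompleteNormedModule)). intros x _.
      rewrite <- (circ_period (exp x)), Rplus_0_l. reflexivity. }
    rewrite EA in HJ.
    match type of HJ with (?A + Ci * ?B - ?A - Ci * ?B' = _)%C =>
      change (B' = B); set (X := A) in *; set (Y := B) in *; set (Z := B') in * end.
    replace Z with (Y + Ci * (X + Ci * Y - X - Ci * Z))%C. rewrite HJ. cring.
    replace (Y + Ci * (X + Ci * Y - X - Ci * Z))%C with (Y + (Ci * Ci) * (Y - Z))%C by ring.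
    rewrite Ci_sqr. ring. }
  intros r r' Hr Hr'. destruct (Rtotal_order r r') as [L|[->|L]]; auto.
  symmetry; auto.
Qed.

(** * The mean value property, Cauchy's formula and Poisson's formula *)

Lemma Cmod_sub_sym (z w : C) : Cmod (z - w) = Cmod (w - z).
Proof. rewrite <- Cmod_opp. f_equal. ring. Qed.

Lemma Cmod_triangle_sub (z w : C) : Cmod z - Cmod w <= Cmod (z - w).
Proof. assert (T := Cmod_triangle (z - w) w). replace (z - w + w)%C with z in T by ring. lra. Qed.

Lemma Cminus_neq_0 (z w : C) : Cmod w < Cmod z -> (z - w)%C <> RtoC 0.
Proof. intros H. apply Cmod_gt_0. generalize (Cmod_triangle_sub z w). lra. Qed.

Lemma mean_bound_period u M : cont u -> (forall t, 0 <= t <= 2 * PI -> Cmod (u t) <= M) -> Cmod (mean u) <= M.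
Proof.
  intros Hu H. assert (P := two_PI_pos).
  assert (B := CI_bound u 0 (2 * PI) _ M ltac:(lra) H (cont_is_CI u 0 (2 * PI) Hu)).
  unfold mean. rewrite Cmod_mult, Cmod_R, Rabs_pos_eq by (apply Rlt_le, Rinv_0_lt_compat; lra).
  apply Rmult_le_reg_l with (2 * PI). lra.
  rewrite <- Rmult_assoc, Rinv_r, Rmult_1_l by lra. lra.
Qed.

Lemma mean_conj u : cont u -> mean (fun t => Cconj (u t)) = Cconj (mean u).
Proof.
  intros Hu. assert (H := cont_is_mean u Hu). apply mean_of_is_CI.
  assert (H1 := is_CI_Re _ _ _ _ H). assert (H2 := is_CI_Im _ _ _ _ H).
  apply is_CI_pair.
  - replace (Re (RtoC (2 * PI) * Cconj (mean u))) with (Re (RtoC (2 * PI) * mean u)).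
    exact H1. destruct (mean u); simpl; ring.
  - replace (Im (RtoC (2 * PI) * Cconj (mean u))) with (opp (Im (RtoC (2 * PI) * mean u))).
    apply (is_RInt_opp (V:=R_NormedModule)). exact H2.
    destruct (mean u); unfold opp; simpl; ring.
Qed.

Lemma cont_circ_cdiff (F : C -> C) R r : 0 <= r < R -> (forall z, Cmod z < R -> cdiff F z) ->
  cont (fun t => F (circ r t)).
Proof.
  intros Hr HF t. apply cont_comp_circ, cdiff_continuous, HF. rewrite Cmod_circ; lra.
Qed.

Lemma circ_sub (r r' t : R) : (circ r t - circ r' t)%C = circ (r - r') t.
Proof. unfold circ, Cminus, Cplus, Copp; simpl; f_equal; ring. Qed.

Lemma Cmod_circ_abs r t : Cmod (circ r t) = Rabs r.
Proof.
  destruct (Rle_dec 0 r). rewrite Cmod_circ, Rabs_pos_eq; auto.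
  replace (circ r t) with (- circ (- r) t)%C.
  rewrite Cmod_opp, Cmod_circ, Rabs_left; lra.
  unfold circ, Copp; simpl; f_equal; ring.
Qed.

Lemma C_eq_of_small (z w : C) : (forall e, 0 < e -> Cmod (z - w) <= e) -> z = w.
Proof.
  intros H. apply Ceq_minus, Cmod_eq_0, Rle_antisym; [|apply Cmod_ge_0].
  apply le_epsilon. intros e He. rewrite Rplus_0_l. auto.
Qed.

(** The means over concentric circles agree, and over small circles they
    approach the value at the centre. *)
Theorem mean_value (F : C -> C) (R r : R) : 0 < r < R ->
  (forall z, Cmod z < R -> cdiff F z) -> mean (fun t => F (circ r t)) = F (RtoC 0).
Proof.
  intros Hr HF.
  assert (Hc : continuous F (RtoC 0)).
  { apply cdiff_continuous, HF. rewrite Cmod_0. lra. }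
  apply C_eq_of_small. intros e He. destruct (proj1 (continuous_C_Cmod _ _) Hc e He) as [d [Hd H]].
    pose (s := Rmin (R / 2) (d / 2)).
    assert (Hs : 0 < s) by (apply Rmin_glb_lt; lra).
    assert (Hs1 : s <= R / 2) by apply Rmin_l. assert (Hs2 : s <= d / 2) by apply Rmin_r.
    clearbody s.
    rewrite (annulus_mean F 0 R) with (r' := s); try lra.
    2: { intros z Hz. apply HF. lra. }
    rewrite <- (mean_const (F (RtoC 0))), <- mean_minus.
    2: { apply cont_circ_cdiff with R; auto; lra. }
    2: apply cont_const.
    apply Cmod_mean_bound.
    - apply cont_minus. apply cont_circ_cdiff with R; auto; lra. apply cont_const.
    - intros t. apply Rlt_le, H. replace (circ s t - 0)%C with (circ s t) by ring.
      rewrite Cmod_circ; lra.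
Qed.

(** Uniform continuity on the compact circle of radius [r0], obtained from a
    Lebesgue number of the gauge of continuity. *)
Lemma mean_circ_continuous (h : C -> C) (R r0 : R) : 0 < r0 < R ->
  (forall z, Cmod z < R -> continuous h z) ->
  forall e, 0 < e -> exists d, 0 < d /\ forall r, Rabs (r - r0) < d -> 0 < r < R ->
    Cmod (mean (fun t => h (circ r t)) - mean (fun t => h (circ r0 t))) <= e.
Proof.
  intros Hr0 Hh e He.
  assert (HP : forall t, exists d : posreal, forall r t', Rabs (r - r0) < d -> Rabs (t' - t) < d ->
     Cmod (h (circ r t') - h (circ r0 t')) <= e).
  { intros t. assert (Hw : Cmod (circ r0 t) < R) by (rewrite Cmod_circ; lra).
    destruct (proj1 (continuous_C_Cmod _ _) (Hh _ Hw) (e/2) ltac:(lra)) as [d [Hd H]].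
    assert (Hct := cont_circ r0 t). unfold continuous in Hct.
    rewrite (filterlim_C_Cmod (locally t)) in Hct.
    destruct (Hct (d/2) ltac:(lra)) as [n Hn].
    assert (Hm : 0 < Rmin (d/2) n) by (apply Rmin_glb_lt; [lra|apply cond_pos]).
    exists (mkposreal _ Hm). simpl. intros r t' H1 H2.
    assert (M1 := Rmin_l (d/2) n). assert (M2 := Rmin_r (d/2) n).
    assert (A1 : Cmod (circ r0 t' - circ r0 t) < d / 2). { apply Hn. apply Rlt_le_trans with (1 := H2). exact M2. }
    assert (A2 : Cmod (circ r t' - circ r0 t') < d / 2). { rewrite circ_sub, Cmod_circ_abs. lra. }
    assert (A3 : Cmod (circ r t' - circ r0 t) < d).
    { replace (circ r t' - circ r0 t)%C with ((circ r t' - circ r0 t') + (circ r0 t' - circ r0 t))%C by ring.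
      eapply Rle_lt_trans. apply Cmod_triangle. lra. }
    replace (h (circ r t') - h (circ r0 t'))%C with ((h (circ r t') - h (circ r0 t)) - (h (circ r0 t') - h (circ r0 t)))%C by ring.
    eapply Rle_trans. apply Cmod_triangle. rewrite Cmod_opp.
    generalize (H _ A3) (H (circ r0 t') ltac:(lra)). lra. }
  pose (delta := fun t => proj1_sig (constructive_indefinite_description _ (HP t))).
  destruct (compactness_value_1d 0 (2 * PI) delta) as [d Hd].
  exists d. split. apply cond_pos. intros r Hrd Hr.
  assert (Hcont : forall s, 0 < s < R -> cont (fun t => h (circ s t))).
  { intros s Hs t. apply cont_comp_circ, Hh. rewrite Cmod_circ; lra. }
  rewrite <- mean_minus by (apply Hcont; lra).
  apply mean_bound_period. apply cont_minus; apply Hcont; lra.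
  intros t Ht. apply Rnot_lt_le. intros Hlt. apply (Hd t Ht). intros [x [Hx [Hx1 Hx2]]].
  revert Hlt. apply Rle_not_lt.
  apply (proj2_sig (constructive_indefinite_description _ (HP x))).
  fold (delta x). lra. exact Hx1.
Qed.

(** R^2 / conj a, the mirror image of [a] in the circle of radius [R], is
    outside of that circle; the disk [R1] leaves room between them. *)
Lemma reflected_disk (a : C) (R : R) : Cmod a < R -> exists R1, R < R1 /\
  forall z, Cmod z < R1 -> (RtoC (R * R) - Cconj a * z)%C <> RtoC 0.
Proof.
  intros Ha. assert (Ha0 := Cmod_ge_0 a).
  (* [b] replaces [Cmod a], which may be 0, in the quotient [R * R / Cmod a]. *)
  pose (b := (Cmod a + R) / 2).
  assert (Hb : 0 < b < R) by (unfold b; lra).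
  assert (Hab : Cmod a <= b) by (unfold b; lra).
  exists (R * R / b). split.
  - apply Rmult_lt_reg_r with b. lra. unfold Rdiv. rewrite Rmult_assoc, Rinv_l by lra. nra.
  - intros z Hz. apply Cminus_neq_0. rewrite Cmod_mult, Cmod_conj, Cmod_R, Rabs_pos_eq by nra.
    apply Rle_lt_trans with (b * Cmod z). apply Rmult_le_compat_r; auto; apply Cmod_ge_0.
    replace (R * R) with (b * (R * R / b)) by (field; lra). apply Rmult_lt_compat_l; lra.
Qed.

Lemma circ_conj R t : (circ R t * Cconj (circ R t))%C = RtoC (R * R).
Proof. rewrite <- Cmod2_conj, Cmod_circ_abs, pow2_abs. f_equal. ring. Qed.

(** On the circle, z / (z - a) is the conjugate of R^2 / (R^2 - conj a z), a
    function that is holomorphic on a larger disk and equals 1 at 0. *)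
Lemma mean_geometric (a : C) (R : R) : Cmod a < R ->
  mean (fun t => circ R t / (circ R t - a))%C = RtoC 1.
Proof.
  intros Ha. assert (Ha0 := Cmod_ge_0 a).
  destruct (reflected_disk a R Ha) as [R1 [HR1 Hden]].
  pose (G := fun z => (RtoC (R * R) / (RtoC (R * R) - Cconj a * z))%C).
  assert (HG : forall z, Cmod z < R1 -> cdiff G z).
  { intros z Hz. apply (cdiff_div (fun _ => RtoC (R * R)) (fun z => (RtoC (R * R) - Cconj a * z)%C)).
    now apply Hden. apply cdiff_const. apply cdiff_minus. apply cdiff_const.
    apply cdiff_mult. apply cdiff_const. apply cdiff_id. }
  assert (HRR : RtoC (R * R) <> 0) by (intros E; apply RtoC_inj in E; nra).
  rewrite (mean_ext _ (fun t => Cconj (G (circ R t)))).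
  - rewrite mean_conj, (mean_value G R1) by (auto; try lra; apply cont_circ_cdiff with R1; auto; lra).
    unfold G. replace (RtoC (R * R) / (RtoC (R * R) - Cconj a * 0))%C with (RtoC 1) by (field; auto).
    unfold Cconj, RtoC; simpl; f_equal; ring.
  - intros t. unfold G. assert (Hz : Cmod (circ R t) = R) by (apply Cmod_circ; lra).
    specialize (Hden (circ R t) ltac:(lra)). rewrite <- (circ_conj R t) in *.
    set (z := circ R t) in *.
    assert (Hza : (z - a)%C <> RtoC 0) by (apply Cminus_neq_0; lra).
    assert (Hz' : Cconj z <> RtoC 0) by (intros E; apply HRR; rewrite E; ring).
    rewrite Cdiv_conj, Cminus_conj, !Cmult_conj, !Cconj_conj by auto.
    field. split; auto.
    replace (Cconj z * z - a * Cconj z)%C with (Cconj z * (z - a))%C by ring.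
    now apply Cmult_neq_0.
Qed.

(** The function k(z) = z (f(z) - f(a)) / (z - a) is continuous on the whole
    disk and differentiable off [a]. Its mean vanishes for radii below |a| by
    the mean value property, is constant for radii above |a|, and is continuous
    in the radius: it vanishes for all radii. *)
Theorem cauchy_formula (f : C -> C) (a : C) (R : R) : Cmod a < R < 1 ->
  (forall z, Cmod z < 1 -> cdiff f z) ->
  mean (fun t => circ R t * f (circ R t) / (circ R t - a))%C = f a.
Proof.
  intros HR Hf. assert (Ha0 := Cmod_ge_0 a).
  destruct (Hf a ltac:(lra)) as [h0 [Hh0 Hl0]].
  pose (h := fun z => match Ceq_dec z a with left _ => h0 a | right _ => ((f z - f a) / (z - a))%C end).
  assert (Hne : forall z, z <> a -> (z - a)%C <> RtoC 0) by (intros; now apply Cminus_eq_contra).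
  assert (Hha : continuous h a).
  { apply continuous_ext_loc with h0; auto. revert Hl0. apply filter_imp. intros y Hy.
    unfold h. destruct (Ceq_dec y a) as [->|Hya]; auto.
    rewrite Hy. cfield. auto. }
  assert (Hhd : forall z, Cmod z < 1 -> z <> a -> cdiff h z).
  { intros z Hz Hza. apply cdiff_ext_loc with (fun z => (f z - f a) / (z - a))%C.
    - assert (Hm : 0 < Cmod (z - a)) by (apply Cmod_gt_0; auto).
      apply locally_C_Cmod. exists (Cmod (z - a)). split; auto. intros y Hy. unfold h.
      destruct (Ceq_dec y a) as [->|]; auto. rewrite Cmod_sub_sym in Hy. lra.
    - apply (cdiff_div (fun z => (f z - f a))%C (fun z => z - a)%C); auto.
      apply cdiff_minus; auto. apply cdiff_const. apply cdiff_minus. apply cdiff_id. apply cdiff_const. }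
  assert (Hhc : forall z, Cmod z < 1 -> continuous h z).
  { intros z Hz. destruct (Ceq_dec z a) as [->|Hza]; auto. apply cdiff_continuous; auto. }
  pose (k := fun z => (z * h z)%C).
  assert (Hkc : forall z, Cmod z < 1 -> continuous k z).
  { intros z Hz. apply cont_Cmult; auto. apply continuous_id. }
  assert (Hkd : forall z, Cmod z < 1 -> z <> a -> cdiff k z).
  { intros z Hz Hza. apply cdiff_mult; auto. apply cdiff_id. }
  assert (Hk : mean (fun t => k (circ R t)) = RtoC 0).
  { destruct (Ceq_dec a (RtoC 0)) as [Ea|Ea].
    - transitivity (f (RtoC 0) - f a)%C. 2: subst a; ring.
      rewrite <- (mean_value (fun z => f z - f a)%C 1 R).
      + apply mean_ext. intros t. unfold k, h.
        assert (Cmod (circ R t) = R) by (apply Cmod_circ; lra).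
        destruct (Ceq_dec (circ R t) a) as [E|E]. rewrite E in H; lra.
        rewrite Ea. field. apply Cmod_gt_0. rewrite Ea in *. lra.
      + split; lra.
      + intros z Hz. apply cdiff_minus; auto. apply cdiff_const.
    - assert (Ha : 0 < Cmod a) by now apply Cmod_gt_0.
      assert (Hin : forall r, 0 < r < Cmod a -> mean (fun t => k (circ r t)) = RtoC 0).
      { intros r Hr. rewrite (mean_value k (Cmod a)); auto.
        unfold k. ring. intros z Hz. apply Hkd. lra. intros ->. lra. }
      assert (Hmid : mean (fun t => k (circ (Cmod a) t)) = RtoC 0).
      { symmetry. apply C_eq_of_small. intros e He.
        destruct (mean_circ_continuous k 1 (Cmod a) ltac:(lra) Hkc e He) as [d [Hd H]].
        pose (r := Rmax (Cmod a / 2) (Cmod a - d / 2)).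
        assert (Hr : 0 < r < Cmod a).
        { split. apply Rlt_le_trans with (Cmod a / 2). lra. apply Rmax_l.
          apply Rmax_lub_lt; lra. }
        assert (Hr' : Cmod a - d / 2 <= r) by apply Rmax_r.
        specialize (H r). rewrite (Hin r Hr) in H.
        apply H. rewrite Rabs_left; lra. lra. }
      apply C_eq_of_small. intros e He.
      destruct (mean_circ_continuous k 1 (Cmod a) ltac:(lra) Hkc e He) as [d [Hd H]].
      pose (r := Rmin R (Cmod a + d / 2)).
      assert (Hr : Cmod a < r) by (apply Rmin_glb_lt; lra).
      assert (Hr1 : r <= R) by apply Rmin_l. assert (Hr2 : r <= Cmod a + d / 2) by apply Rmin_r.
      clearbody r.
      rewrite (annulus_mean k (Cmod a) 1) with (r' := r); try lra.
      2: { intros z Hz. apply Hkd. lra. intros ->. lra. }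
      specialize (H r). rewrite Hmid in H.
      apply H. rewrite Rabs_pos_eq; lra. lra. }
  assert (Hz0 : forall t, (circ R t - a)%C <> RtoC 0).
  { intros t. apply Cminus_neq_0. rewrite Cmod_circ; lra. }
  assert (Cc : cont (circ R)) by (intros t; apply cont_circ).
  assert (Cf : cont (fun t => f (circ R t))) by (apply cont_circ_cdiff with 1; auto; lra).
  assert (C1 : cont (fun t => circ R t / (circ R t - a))%C).
  { apply cont_div; auto. apply cont_minus; auto. apply cont_const. }
  assert (C2 : cont (fun t => circ R t * f (circ R t) / (circ R t - a))%C).
  { apply cont_div; auto. now apply cont_mult. apply cont_minus; auto. apply cont_const. }
  rewrite (mean_ext _ (fun t => circ R t * f (circ R t) / (circ R t - a) - f a * (circ R t / (circ R t - a)))%C) in Hk.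
  2: { intros t. unfold k, h. destruct (Ceq_dec (circ R t) a) as [E|E].
       elim (Hz0 t). rewrite E. ring. field. auto. }
  rewrite mean_minus, mean_scal, mean_geometric in Hk; auto; try lra.
  2: { apply cont_mult; auto. apply cont_const. }
  match type of Hk with (?m - _)%C = _ => replace m with (m - f a * 1 + f a)%C by ring end.
  rewrite Hk. ring.
Qed.

(** The Poisson kernel of the disk of radius [rad], normalised so that its mean
    is 1. *)
Definition poisson (rad : R) (a : C) (t : R) : R := (rad ^ 2 - Cmod a ^ 2) / Cmod (circ rad t - a) ^ 2.

Lemma poisson_den R a t : Cmod a < R -> 0 < Cmod (circ R t - a).
Proof.
  intros H. assert (H0 := Cmod_ge_0 a). generalize (Cmod_triangle_sub (circ R t) a).
  rewrite Cmod_circ; lra.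
Qed.

Lemma poisson_pos R a t : Cmod a < R -> 0 < poisson R a t.
Proof.
  intros H. assert (H0 := Cmod_ge_0 a). apply Rdiv_lt_0_compat. simpl; nra.
  apply pow_lt. now apply poisson_den.
Qed.

Lemma rcont_div u v : (forall t, v t <> 0) -> rcont u -> rcont v -> rcont (fun t => u t / v t).
Proof.
  intros H0 H1 H2 t. apply (continuous_mult (K:=R_AbsRing)). apply H1.
  apply (continuous_comp v Rinv). apply H2. apply continuous_Rinv, H0.
Qed.

Lemma cont_circ_minus R a : cont (fun t => circ R t - a)%C.
Proof. apply cont_minus. intros t; apply cont_circ. apply cont_const. Qed.

Lemma rcont_poisson R a : Cmod a < R -> rcont (poisson R a).
Proof.
  intros H. apply rcont_div. intros t. apply Rgt_not_eq, pow_lt, poisson_den, H.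
  apply rcont_const. apply rcont_pow2, rcont_Cmod, cont_circ_minus.
Qed.

(** On the circle, the kernel is the sum of the Cauchy kernel z / (z - a) and of
    conj a z / (R^2 - conj a z), which is holomorphic on a larger disk and
    vanishes at 0. *)
Theorem poisson_formula (f : C -> C) (a : C) (R : R) : Cmod a < R < 1 ->
  (forall z, Cmod z < 1 -> cdiff f z) ->
  mean (fun t => RtoC (poisson R a t) * f (circ R t))%C = f a.
Proof.
  intros HR Hf. assert (Ha0 := Cmod_ge_0 a).
  destruct (reflected_disk a R (proj1 HR)) as [R2 [HR2 Hden]].
  pose (G := fun z => (f z * (Cconj a * z / (RtoC (R * R) - Cconj a * z)))%C).
  pose (R1 := Rmin 1 R2).
  assert (HR1 : R < R1) by (apply Rmin_glb_lt; lra).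
  assert (HG : forall z, Cmod z < R1 -> cdiff G z).
  { intros z Hz. assert (M1 := Rmin_l 1 R2). assert (M2 := Rmin_r 1 R2).
    fold R1 in M1, M2. apply cdiff_mult. apply Hf; lra.
    apply (cdiff_div (fun z => Cconj a * z)%C (fun z => (RtoC (R * R) - Cconj a * z)%C)).
    apply Hden; lra. apply cdiff_mult. apply cdiff_const. apply cdiff_id.
    apply cdiff_minus. apply cdiff_const.
    apply cdiff_mult. apply cdiff_const. apply cdiff_id. }
  assert (EG := mean_value G R1 R ltac:(lra) HG).
  replace (G (RtoC 0)) with (RtoC 0) in EG.
  2: { unfold G. rewrite Cmult_0_r. unfold Cdiv. ring. }
  assert (CG : cont (fun t => G (circ R t))) by (apply cont_circ_cdiff with R1; auto; lra).
  assert (Hz0 : forall t, (circ R t - a)%C <> RtoC 0).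
  { intros t. apply Cminus_neq_0. rewrite Cmod_circ; lra. }
  assert (Cc : cont (circ R)) by (intros t; apply cont_circ).
  assert (Cf : cont (fun t => f (circ R t))) by (apply cont_circ_cdiff with 1; auto; lra).
  assert (C2 : cont (fun t => circ R t * f (circ R t) / (circ R t - a))%C).
  { apply cont_div; auto. now apply cont_mult. apply cont_circ_minus. }
  rewrite (mean_ext _ (fun t => circ R t * f (circ R t) / (circ R t - a) + G (circ R t))%C).
  - rewrite mean_plus, EG, cauchy_formula; auto. ring.
  - intros t. unfold G, poisson. set (z := circ R t).
    assert (Hz : Cmod z = R) by (apply Cmod_circ; lra).
    assert (Hzz : RtoC (R * R) = (z * Cconj z)%C) by (symmetry; apply circ_conj).
    assert (Hza : (z - a)%C <> RtoC 0) by apply Hz0.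
    assert (Hd : (RtoC (R * R) - Cconj a * z)%C <> RtoC 0) by (apply Hden; lra).
    assert (Hza' : Cconj (z - a) <> RtoC 0) by (apply Cmod_gt_0; rewrite Cmod_conj; now apply Cmod_gt_0).
    rewrite RtoC_div by (apply Rgt_not_eq, pow_lt; now apply Cmod_gt_0).
    rewrite RtoC_minus, !Cmod2_conj.
    replace (RtoC (R ^ 2)) with (RtoC (R * R)) by (f_equal; ring).
    rewrite Hzz in Hd |- *.
    rewrite Cminus_conj in Hza' |- *.
    field. repeat split; auto.
Qed.

Lemma rmean_poisson (a : C) (R : R) : Cmod a < R < 1 -> rmean (poisson R a) = 1.
Proof.
  intros HR. apply RtoC_inj. rewrite <- mean_RtoC by (apply rcont_poisson; lra).
  rewrite <- (poisson_formula (fun _ => RtoC 1) a R); auto.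
  apply mean_ext. intros t. ring. intros; apply cdiff_const.
Qed.

Definition poisson_int (u : R -> R) (rad : R) (a : C) : R := rmean (fun t => poisson rad a t * u t).

(** The difference quotient of the Cauchy kernel is explicit, and its mean is
    the continuous factor of Caratheodory's form. *)
Lemma cauchy_transform_cdiff (u : R -> C) (R : R) (z : C) : cont u -> Cmod z < R ->
  cdiff (fun z => mean (fun t => u t * (circ R t / (circ R t - z)))%C) z.
Proof.
  intros Hu Hz. assert (Hz0 := Cmod_ge_0 z).
  pose (k := fun y => mean (fun t => u t * (circ R t / ((circ R t - y) * (circ R t - z))))%C).
  pose (d := (R - Cmod z) / 2). assert (Hd : 0 < d) by (unfold d; lra).
  assert (Hy1 : forall y, Cmod (y - z) < d -> Cmod y < R - d).
  { intros y Hy. generalize (Cmod_triangle_sub y z). unfold d in *. lra. }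
  clearbody d.
  assert (Hye : forall y t, Cmod (y - z) < d -> d < Cmod (circ R t - y)).
  { intros y t Hy. assert (A := Hy1 y Hy). generalize (Cmod_triangle_sub (circ R t) y).
    rewrite Cmod_circ; lra. }
  assert (Hzz : Cmod (z - z) < d). { replace (z - z)%C with (RtoC 0) by ring. now rewrite Cmod_0. }
  assert (Hne : forall y t, Cmod (y - z) < d -> (circ R t - y)%C <> RtoC 0).
  { intros y t Hy. apply Cmod_gt_0. generalize (Hye y t Hy). lra. }
  assert (Cc : cont (circ R)) by (intros t; apply cont_circ).
  assert (CK : forall y, Cmod (y - z) < d -> cont (fun t => u t * (circ R t / ((circ R t - y) * (circ R t - z))))%C).
  { intros y Hy. apply cont_mult; auto. apply cont_div; auto.
    intros t. apply Cmult_neq_0; auto. apply cont_mult; apply cont_circ_minus. }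
  assert (CF : forall y, Cmod (y - z) < d -> cont (fun t => u t * (circ R t / (circ R t - y)))%C).
  { intros y Hy. apply cont_mult; auto. apply cont_div; auto. apply cont_circ_minus. }
  exists k. split.
  - apply continuous_C_Cmod. intros e He.
    pose (M := rmean (fun t => Cmod (u t))).
    assert (HM : 0 <= M). { apply rmean_pos. now apply rcont_Cmod. intros; apply Cmod_ge_0. }
    pose (L := R / (d * d * d)). assert (Hddd : 0 < d * d * d) by (repeat apply Rmult_lt_0_compat; auto).
    assert (HL : 0 < L) by (apply Rdiv_lt_0_compat; lra).
    pose (d' := Rmin d (e / (L * (M + 1)))).
    assert (HLM : 0 < L * (M + 1)) by (apply Rmult_lt_0_compat; lra).
    assert (Hd' : 0 < d') by (apply Rmin_glb_lt; auto; now apply Rdiv_lt_0_compat).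
    assert (D1 : d' <= d) by apply Rmin_l. assert (D2 : d' <= e / (L * (M + 1))) by apply Rmin_r.
    clearbody d'.
    exists d'. split; auto. intros y Hy.
    assert (Hyd : Cmod (y - z) < d) by lra.
    unfold k. rewrite <- mean_minus by (apply CK; auto).
    rewrite (mean_ext _ (fun t => (y - z) * (u t * (circ R t / ((circ R t - y) * ((circ R t - z) * (circ R t - z)))))))%C.
    2: { intros t. field. split; auto. }
    assert (CQ : cont (fun t => u t * (circ R t / ((circ R t - y) * ((circ R t - z) * (circ R t - z)))))%C).
    { apply cont_mult; auto. apply cont_div; auto.
      intros t. repeat apply Cmult_neq_0; auto.
      apply cont_mult; [|apply cont_mult]; apply cont_circ_minus. }
    rewrite mean_scal, Cmod_mult by auto.
    assert (B : Cmod (mean (fun t => u t * (circ R t / ((circ R t - y) * ((circ R t - z) * (circ R t - z)))))%C) <= L * M).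
    { eapply Rle_trans. apply Cmod_mean_le; auto.
      unfold M. rewrite <- rmean_scal by now apply rcont_Cmod.
      apply rmean_le. now apply rcont_Cmod. apply rcont_mult. apply rcont_const. now apply rcont_Cmod.
      intros t. rewrite Cmod_mult, Rmult_comm. apply Rmult_le_compat_r. apply Cmod_ge_0.
      rewrite Cmod_div by (repeat apply Cmult_neq_0; auto). rewrite !Cmod_mult, Cmod_circ by lra.
      unfold L, Rdiv. apply Rmult_le_compat_l. lra. apply Rinv_le_contravar; auto.
      assert (N1 := Hye y t Hyd). assert (N2 := Hye z t Hzz). rewrite Rmult_assoc.
      apply Rmult_le_compat; try lra. apply Rmult_le_pos; lra. apply Rmult_le_compat; lra. }
    apply Rle_lt_trans with (Cmod (y - z) * (L * M)).
    apply Rmult_le_compat_l; auto; apply Cmod_ge_0.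
    apply Rle_lt_trans with (d' * (L * M)). apply Rmult_le_compat_r; [apply Rmult_le_pos|]; lra.
    apply Rlt_le_trans with (d' * (L * (M + 1))). apply Rmult_lt_compat_l; auto. apply Rmult_lt_compat_l; lra.
    apply Rle_trans with (e / (L * (M + 1)) * (L * (M + 1))). apply Rmult_le_compat_r; lra.
    right. field. split; lra.
  - apply locally_C_Cmod. exists d. split; auto. intros y Hy. unfold k.
    rewrite <- mean_scal by (apply CK; auto). rewrite <- mean_plus.
    2: apply CF; auto. 2: { apply cont_mult. apply cont_const. apply CK; auto. }
    apply mean_ext. intros t. field. split; auto.
Qed.

(** The kernel is harmonic in [z], being the real part of (e + z) / (e - z),
    with e on the circle. *)
Lemma poisson_Re (t R : R) (z : C) : Cmod z < R ->
  poisson R z t = Re (RtoC 2 * (circ R t / (circ R t - z)) - 1)%C.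
Proof.
  intros H. assert (H0 := Cmod_ge_0 z). assert (D := poisson_den R z t H).
  assert (Hne : (circ R t - z)%C <> RtoC 0) by now apply Cmod_gt_0.
  assert (Hne' : Cconj (circ R t - z) <> RtoC 0) by (apply Cmod_gt_0; now rewrite Cmod_conj).
  unfold poisson. rewrite <- (Cmod_circ R t) at 1 by lra.
  set (e := circ R t) in *.
  replace (RtoC 2 * (e / (e - z)) - 1)%C with (((e + z) * Cconj (e - z)) / RtoC (Cmod (e - z) ^ 2))%C.
  2: { rewrite Cmod2_conj. field. auto. }
  unfold Cdiv, Rdiv. rewrite <- RtoC_inv by (apply Rgt_not_eq, pow_lt; auto).
  rewrite !Cmod2_alt. set (q := / _).
  destruct e as [e1 e2], z as [z1 z2]. simpl. ring.
Qed.

Lemma rcont_mult_poisson u R a : rcont u -> Cmod a < R -> rcont (fun t => poisson R a t * u t).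
Proof. intros. apply rcont_mult; auto. now apply rcont_poisson. Qed.

Lemma poisson_int_eq_Re u R a : rcont u -> Cmod a < R ->
  poisson_int u R a = Re (RtoC 2 * mean (fun t => RtoC (u t) * (circ R t / (circ R t - a))) - RtoC (rmean u))%C.
Proof.
  intros Hu Ha. assert (Ha0 := Cmod_ge_0 a).
  assert (Hne : forall t, (circ R t - a)%C <> RtoC 0).
  { intros t. apply Cmod_gt_0. now apply poisson_den. }
  assert (CF : cont (fun t => RtoC (u t) * (circ R t / (circ R t - a)))%C).
  { apply cont_mult. now apply cont_ofR. apply cont_div; auto. intros t; apply cont_circ. apply cont_circ_minus. }
  rewrite <- mean_RtoC, <- mean_scal, <- mean_minus; auto.
  2: { apply cont_mult; auto. apply cont_const. } 2: now apply cont_ofR.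
  rewrite Re_mean.
  2: { apply cont_minus. apply cont_mult; auto. apply cont_const. now apply cont_ofR. }
  apply rmean_ext. intros t. rewrite poisson_Re by auto.
  replace (2 * (RtoC (u t) * (circ R t / (circ R t - a))) - RtoC (u t))%C
    with (RtoC (u t) * (RtoC 2 * (circ R t / (circ R t - a)) - 1))%C by ring.
  set (w := (RtoC 2 * (circ R t / (circ R t - a)) - 1)%C). destruct w; simpl; ring.
Qed.

(** A Poisson integral is the real part of a holomorphic function, and remains
    so after composition with the holomorphic [s]. Arguing with this holomorphic
    function replaces an exchange of two integrals. *)
Theorem poisson_int_mean_value (u : R -> R) (s : C -> C) (r r1 R : R) :
  rcont u -> 0 < r < r1 -> (forall z, Cmod z < r1 -> cdiff s z) ->
  (forall z, Cmod z < r1 -> Cmod (s z) < R) ->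
  rcont (fun t => poisson_int u R (s (circ r t))) /\
  rmean (fun t => poisson_int u R (s (circ r t))) = poisson_int u R (s (RtoC 0)).
Proof.
  intros Hu Hr Hs HsR.
  pose (F := fun z => (RtoC 2 * mean (fun t => RtoC (u t) * (circ R t / (circ R t - s z))) - RtoC (rmean u))%C).
  assert (HF : forall z, Cmod z < r1 -> cdiff F z).
  { intros z Hz. apply cdiff_minus. 2: apply cdiff_const. apply cdiff_mult. apply cdiff_const.
    apply (cdiff_comp (fun w => mean (fun t => RtoC (u t) * (circ R t / (circ R t - w)))%C) s); auto.
    apply cauchy_transform_cdiff; auto. now apply cont_ofR. }
  assert (E : forall z, Cmod z < r1 -> poisson_int u R (s z) = Re (F z)).
  { intros z Hz. unfold F. apply poisson_int_eq_Re; auto. }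
  assert (Hc : forall t, Cmod (circ r t) < r1) by (intros; rewrite Cmod_circ; lra).
  assert (CF : cont (fun t => F (circ r t))) by (apply cont_circ_cdiff with r1; auto; lra).
  split.
  - intros t. apply continuous_ext with (fun t => Re (F (circ r t))).
    intros t'. symmetry. now apply E. now apply rcont_Re.
  - rewrite (rmean_ext _ (fun t => Re (F (circ r t)))) by (intros; apply E; auto).
    rewrite <- Re_mean, (mean_value F r1), <- E; auto. rewrite Cmod_0; lra.
Qed.

(** * The Hardy space *)

Definition hol (f : C -> C) : Prop := forall z, Cmod z < 1 -> cdiff f z.

Lemma hol_iff f : holomorphic_on_disk f <-> hol f.
Proof.
  unfold holomorphic_on_disk, in_disk, hol. split; intros H z Hz; apply ex_derive_cdiff; auto.
Qed.

(** The square of the norm is at most [N]. Squares are used throughout: they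
    make every estimate linear in the circle means. *)
Definition H2_bound (f : C -> C) (N : R) : Prop := forall r, 0 < r < 1 -> circle_mean f r <= N.

Definition circle_sq (f : C -> C) (r t : R) : R := Cmod (f (circ r t)) ^ 2.

Lemma circle_mean_eq f r : circle_mean f r = rmean (circle_sq f r).
Proof. reflexivity. Qed.

Lemma hol_cont_circ f r : hol f -> 0 <= r < 1 -> cont (fun t => f (circ r t)).
Proof. intros. apply cont_circ_cdiff with 1; auto. Qed.

Lemma rcont_circle_sq f r : hol f -> 0 <= r < 1 -> rcont (circle_sq f r).
Proof. intros. apply rcont_pow2, rcont_Cmod, hol_cont_circ; auto. Qed.

Lemma hol_mult f g : hol f -> hol g -> hol (fun z => f z * g z)%C.
Proof. intros Hf Hg z Hz. apply cdiff_mult; auto. Qed.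
Lemma hol_plus f g : hol f -> hol g -> hol (fun z => f z + g z)%C.
Proof. intros Hf Hg z Hz. apply cdiff_plus; auto. Qed.
Lemma hol_minus f g : hol f -> hol g -> hol (fun z => f z - g z)%C.
Proof. intros Hf Hg z Hz. apply cdiff_minus; auto. Qed.
Lemma hol_const c : hol (fun _ => c).
Proof. intros z _. apply cdiff_const. Qed.
Lemma hol_id : hol (fun z => z).
Proof. intros z _. apply cdiff_id. Qed.

Lemma hol_ext f g : (forall z, Cmod z < 1 -> f z = g z) -> hol f -> hol g.
Proof.
  intros H Hf z Hz. apply cdiff_ext_loc with f; auto.
  generalize (Cmod_lt_open 1 z Hz). apply filter_imp. auto.
Qed.

Lemma H2_bound_ext f g N : (forall z, Cmod z < 1 -> f z = g z) -> H2_bound f N -> H2_bound g N.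
Proof.
  intros H Hf r Hr. rewrite circle_mean_eq, <- (rmean_ext (circle_sq f r)). apply Hf; auto.
  intros t. unfold circle_sq. rewrite H; auto. rewrite Cmod_circ; lra.
Qed.

Lemma H2_bound_le f N M : N <= M -> H2_bound f N -> H2_bound f M.
Proof. intros H Hf r Hr. specialize (Hf r Hr). lra. Qed.

Lemma circle_mean_le_comb f g h r al be : hol f -> hol g -> hol h -> 0 < r < 1 ->
  (forall z, Cmod z < 1 -> Cmod (h z) ^ 2 <= al * Cmod (f z) ^ 2 + be * Cmod (g z) ^ 2) ->
  circle_mean h r <= al * circle_mean f r + be * circle_mean g r.
Proof.
  intros Hf Hg Hh Hr H. rewrite !circle_mean_eq.
  assert (Sf := rcont_circle_sq f r Hf ltac:(lra)). assert (Sg := rcont_circle_sq g r Hg ltac:(lra)).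
  rewrite <- !rmean_scal, <- rmean_plus; auto; try (apply rcont_mult; auto; apply rcont_const).
  apply rmean_le. apply rcont_circle_sq; auto; lra.
  apply rcont_plus; apply rcont_mult; auto; apply rcont_const.
  intros t. unfold circle_sq. apply H. rewrite Cmod_circ; lra.
Qed.

Lemma circle_mean_pos f r : hol f -> 0 < r < 1 -> 0 <= circle_mean f r.
Proof.
  intros Hf Hr. rewrite circle_mean_eq. apply rmean_pos. apply rcont_circle_sq; auto; lra.
  intros t. apply pow2_ge_0.
Qed.

Lemma H2_bound_pos f N : hol f -> H2_bound f N -> 0 <= N.
Proof.
  intros Hf H. eapply Rle_trans. apply (circle_mean_pos f (1/2)); auto; lra. apply H. lra.
Qed.

(** Convexity of the square, at the weights 1 - s and s. The free weight [s] is
    what sums geometric series without the triangle inequality for the norm. *)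
Lemma sq_sum_le a b s : 0 < s < 1 -> (a + b) ^ 2 <= / (1 - s) * a ^ 2 + / s * b ^ 2.
Proof.
  intros Hs. assert (H : 0 <= (s * a - (1 - s) * b) ^ 2) by apply pow2_ge_0.
  apply Rmult_le_reg_l with (s * (1 - s)). nra.
  replace (s * (1 - s) * (/ (1 - s) * a ^ 2 + / s * b ^ 2)) with (s * a ^ 2 + (1 - s) * b ^ 2) by (field; lra).
  nra.
Qed.

Lemma Cmod_plus_sq z w s : 0 < s < 1 -> Cmod (z + w) ^ 2 <= / (1 - s) * Cmod z ^ 2 + / s * Cmod w ^ 2.
Proof.
  intros Hs. eapply Rle_trans. 2: now apply sq_sum_le.
  apply pow_incr. split. apply Cmod_ge_0. apply Cmod_triangle.
Qed.

Lemma H2_bound_plus_s f g N M s : 0 < s < 1 -> hol f -> hol g -> H2_bound f N -> H2_bound g M ->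
  H2_bound (fun z => f z + g z)%C (/ (1 - s) * N + / s * M).
Proof.
  intros Hs Hf Hg HN HM r Hr. specialize (HN r Hr). specialize (HM r Hr).
  eapply Rle_trans. apply (circle_mean_le_comb f g _ r (/ (1 - s)) (/ s)); auto.
  now apply hol_plus. intros; now apply Cmod_plus_sq.
  apply Rplus_le_compat; apply Rmult_le_compat_l; auto; apply Rlt_le, Rinv_0_lt_compat; lra.
Qed.

Lemma H2_bound_plus f g N M : hol f -> hol g -> H2_bound f N -> H2_bound g M ->
  H2_bound (fun z => f z + g z)%C (2 * N + 2 * M).
Proof.
  intros. replace (2 * N + 2 * M) with (/ (1 - /2) * N + / (/2) * M) by field.
  apply H2_bound_plus_s; auto; lra.
Qed.

Lemma H2_bound_mult f m N M : hol f -> hol m -> (forall z, Cmod z < 1 -> Cmod (m z) <= M) ->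
  H2_bound f N -> H2_bound (fun z => m z * f z)%C (M ^ 2 * N).
Proof.
  intros Hf Hm H HN r Hr.
  eapply Rle_trans. apply (circle_mean_le_comb f f _ r (M ^ 2) 0); auto. now apply hol_mult.
  - intros z Hz. rewrite Cmod_mult, Rpow_mult_distr, Rmult_0_l, Rplus_0_r.
    apply Rmult_le_compat_r. apply pow2_ge_0. apply pow_incr. split. apply Cmod_ge_0. auto.
  - rewrite Rmult_0_l, Rplus_0_r. apply Rmult_le_compat_l. apply pow2_ge_0. auto.
Qed.

Lemma H2_bound_minus f g N M : hol f -> hol g -> H2_bound f N -> H2_bound g M ->
  H2_bound (fun z => f z - g z)%C (2 * N + 2 * M).
Proof.
  intros Hf Hg HN HM.
  apply H2_bound_ext with (fun z => f z + (- RtoC 1) * g z)%C. intros; ring.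
  apply H2_bound_plus; auto. apply hol_mult; auto. apply hol_const.
  apply H2_bound_le with (1 ^ 2 * M). lra. apply H2_bound_mult; auto. apply hol_const.
  intros. rewrite Cmod_opp, Cmod_1. lra.
Qed.

Lemma H2_bound_sub_sym f g N : H2_bound (fun z => f z - g z)%C N -> H2_bound (fun z => g z - f z)%C N.
Proof.
  intros H r Hr. rewrite circle_mean_eq, (rmean_ext _ (circle_sq (fun z => f z - g z)%C r)). now apply H.
  intros t. unfold circle_sq. now rewrite Cmod_sub_sym.
Qed.

Lemma H2_bound_const (v : C) : H2_bound (fun _ => v) (Cmod v ^ 2).
Proof.
  intros r Hr. rewrite circle_mean_eq. unfold circle_sq. rewrite rmean_const. lra.
Qed.

Lemma H2_norm_le f e : 0 <= e -> Rbar_le (H2_norm f) e <-> H2_bound f (e ^ 2).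
Proof.
  intros He. unfold H2_norm.
  destruct (Lub_Rbar_correct (fun m => exists r, 0 < r < 1 /\ m = circle_mean f r)) as [H1 H2].
  set (L := Lub_Rbar _) in *.
  assert (HL : Rbar_le (Rbar_sqrt L) e <-> Rbar_le L (e ^ 2)).
  { destruct L as [l| |]; simpl; try tauto. split; intros H.
    - destruct (Rle_dec l 0). nra.
      rewrite <- (sqrt_sqrt l) by lra. assert (Hs := sqrt_pos l). nra.
    - rewrite <- (sqrt_pow2 e He). apply sqrt_le_1_alt. simpl. exact H. }
  rewrite HL. split.
  - intros H r Hr. assert (A := Rbar_le_trans _ _ _ (H1 _ (ex_intro _ r (conj Hr eq_refl))) H).
    exact A.
  - intros H. apply H2. intros m [r [Hr ->]]. apply H. exact Hr.
Qed.

Lemma in_H2_iff f : in_H2 f <-> hol f /\ exists N, H2_bound f N.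
Proof.
  unfold in_H2. rewrite hol_iff. split; intros [Hf H]; split; auto.
  - assert (HE : exists e, 0 <= e /\ Rbar_le (H2_norm f) (Finite e)).
    { destruct (H2_norm f) as [l| |].
      - exists (Rabs l). split. apply Rabs_pos. apply Rle_abs.
      - elim H.
      - exists 0. split. lra. exact I. }
    destruct HE as [e [He Hle]]. exists (e ^ 2). now apply H2_norm_le.
  - destruct H as [N HN]. assert (HN0 := H2_bound_pos f N Hf HN).
    apply Rbar_le_lt_trans with (Finite (sqrt N)). 2: exact I.
    apply H2_norm_le. apply sqrt_pos. now rewrite pow2_sqrt.
Qed.

(** The uniform bound on smaller disks places the image of a circle inside the
    circles |z| = q < 1 that carry Poisson integrals. *)
Definition selfmap (s : C -> C) : Prop :=
  hol s /\ forall r, r < 1 -> exists rho, rho < 1 /\ forall z, Cmod z <= r -> Cmod (s z) <= rho.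

Lemma selfmap_lt s z : selfmap s -> Cmod z < 1 -> Cmod (s z) < 1.
Proof. intros [_ H] Hz. destruct (H _ Hz) as [rho [H1 H2]]. specialize (H2 z). lra. Qed.

Lemma hol_comp_lt f s : hol f -> hol s -> (forall z, Cmod z < 1 -> Cmod (s z) < 1) ->
  hol (fun z => f (s z)).
Proof. intros Hf Hs H z Hz. apply (cdiff_comp f s); auto. Qed.

Lemma hol_comp f s : hol f -> selfmap s -> hol (fun z => f (s z)).
Proof. intros Hf Hs. apply hol_comp_lt; auto. apply Hs. intros z. now apply selfmap_lt. Qed.

Lemma selfmap_comp s s' : selfmap s -> selfmap s' -> selfmap (fun z => s (s' z)).
Proof.
  intros Hs Hs'. split. apply hol_comp; auto. apply Hs.
  intros r Hr. destruct (proj2 Hs' r Hr) as [r' [Hr' H1]].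
  destruct (proj2 Hs r' Hr') as [r'' [Hr'' H2]]. exists r''. auto.
Qed.

(** Poisson's formula for f^2 instead of f. *)
Lemma poisson_majorant f a r : hol f -> Cmod a < r < 1 -> Cmod (f a) ^ 2 <= poisson_int (circle_sq f r) r a.
Proof.
  intros Hf Hr. assert (Ha := Cmod_ge_0 a).
  rewrite <- Cmod_pow. replace (f a ^ 2)%C with (f a * f a)%C by ring.
  rewrite <- (poisson_formula (fun z => f z * f z)%C a r Hr).
  2: { apply hol_mult; auto. }
  eapply Rle_trans. apply Cmod_mean_le.
  { apply cont_mult. apply cont_ofR, rcont_poisson; lra.
    apply cont_mult; apply hol_cont_circ; auto; lra. }
  right. apply rmean_ext. intros t. unfold circle_sq.
  rewrite !Cmod_mult, Cmod_R, Rabs_pos_eq. ring. apply Rlt_le, poisson_pos; lra.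
Qed.

Lemma poisson_int_le u v K r a : 0 <= Cmod a < r -> rcont u -> rcont v ->
  (forall t, poisson r a t * u t <= K * v t) -> poisson_int u r a <= K * rmean v.
Proof.
  intros Ha Hu Hv H. rewrite <- rmean_scal by auto. apply rmean_le; auto.
  apply rcont_mult_poisson; auto; lra. apply rcont_mult; auto. apply rcont_const.
Qed.

(** The kernel is at most (r + |a|) / (r - |a|), and r - |a| is at least half of
    1 - |a|. *)
Lemma poisson_upper a r t : (1 + Cmod a) / 2 <= r < 1 -> Cmod a < 1 ->
  poisson r a t <= 8 / (1 - Cmod a ^ 2).
Proof.
  intros Hr Ha. assert (Ha0 := Cmod_ge_0 a). set (m := Cmod a) in *.
  assert (D : r - m <= Cmod (circ r t - a)).
  { generalize (Cmod_triangle_sub (circ r t) a). rewrite Cmod_circ; unfold m in *; lra. }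
  set (x := Cmod (circ r t - a)) in *. unfold poisson. fold m x.
  assert (0 < r - m) by lra.
  assert (Hm : 0 < 1 - m ^ 2) by nra.
  apply Rle_trans with ((r ^ 2 - m ^ 2) / (r - m) ^ 2).
  - apply Rmult_le_compat_l. nra. apply Rinv_le_contravar. apply pow_lt; lra. apply pow_incr; lra.
  - replace ((r ^ 2 - m ^ 2) / (r - m) ^ 2) with ((r + m) / (r - m)) by (field; lra).
    apply Rle_trans with (2 / ((1 - m) / 2)).
    apply Rmult_le_compat. lra. apply Rlt_le, Rinv_0_lt_compat; lra. lra. apply Rinv_le_contravar; lra.
    replace (2 / ((1 - m) / 2)) with (4 / (1 - m)) by (field; lra).
    apply Rmult_le_reg_r with (1 - m ^ 2); auto.
    unfold Rdiv at 2. rewrite Rmult_assoc, Rinv_l, Rmult_1_r by lra.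
    replace (4 / (1 - m) * (1 - m ^ 2)) with (4 * (1 + m)) by (field; lra). lra.
Qed.

Lemma eval_const_pos a : Cmod a < 1 -> 0 <= 8 / (1 - Cmod a ^ 2).
Proof. intros H. assert (H0 := Cmod_ge_0 a). apply Rlt_le, Rdiv_lt_0_compat; nra. Qed.

Lemma poisson_int_H2_bound f N a r : hol f -> H2_bound f N -> Cmod a < 1 -> (1 + Cmod a) / 2 <= r < 1 ->
  poisson_int (circle_sq f r) r a <= 8 / (1 - Cmod a ^ 2) * N.
Proof.
  intros Hf HN Ha Hr. assert (Ha0 := Cmod_ge_0 a).
  apply Rle_trans with (8 / (1 - Cmod a ^ 2) * rmean (circle_sq f r)).
  - apply poisson_int_le; auto. lra. apply rcont_circle_sq; auto; lra. apply rcont_circle_sq; auto; lra.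
    intros t. apply Rmult_le_compat_r. apply pow2_ge_0. now apply poisson_upper.
  - apply Rmult_le_compat_l. now apply eval_const_pos. apply HN. lra.
Qed.

Lemma point_eval f N a : hol f -> H2_bound f N -> Cmod a < 1 ->
  Cmod (f a) ^ 2 <= 8 / (1 - Cmod a ^ 2) * N.
Proof.
  intros Hf HN Ha. assert (Ha0 := Cmod_ge_0 a).
  eapply Rle_trans. apply (poisson_majorant f a ((1 + Cmod a) / 2)); auto; lra.
  apply poisson_int_H2_bound; auto; lra.
Qed.

(** All norm estimates pass through this principle. The pointwise bound is
    averaged over the circle of radius [r]; the average of the Poisson integral
    along [s] is its value at s(0), which involves a single Poisson kernel. *)
Theorem subordination (f g s : C -> C) (K B : R) : hol f -> hol g -> selfmap s -> 0 <= K ->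
  (forall r, 0 < r < 1 -> exists r0, r0 < 1 /\ forall q, r0 < q < 1 ->
     forall z, Cmod z = r -> Cmod (s z) < q -> Cmod (g z) ^ 2 <= K * poisson_int (circle_sq f q) q (s z)) ->
  (exists r1, r1 < 1 /\ forall q, r1 < q < 1 -> poisson_int (circle_sq f q) q (s (RtoC 0)) <= B) ->
  H2_bound g (K * B).
Proof.
  intros Hf Hg Hs HK Hr0 [r1 [Hr1 HB]] r Hr.
  destruct (Hr0 r Hr) as [r0 [Hr0' H0]].
  destruct (proj2 Hs ((1 + r) / 2) ltac:(lra)) as [rho [Hrho H2]].
  pose (q := (1 + Rmax 0 (Rmax rho (Rmax r0 r1))) / 2).
  assert (A1 := Rmax_l 0 (Rmax rho (Rmax r0 r1))). assert (A2 := Rmax_r 0 (Rmax rho (Rmax r0 r1))).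
  assert (A3 := Rmax_l rho (Rmax r0 r1)). assert (A4 := Rmax_r rho (Rmax r0 r1)).
  assert (A5 := Rmax_l r0 r1). assert (A6 := Rmax_r r0 r1).
  assert (A7 : Rmax 0 (Rmax rho (Rmax r0 r1)) < 1) by (repeat apply Rmax_lub_lt; lra).
  assert (Hq : 0 < q < 1 /\ rho < q /\ r0 < q /\ r1 < q) by (unfold q; lra). clearbody q.
  destruct (poisson_int_mean_value (circle_sq f q) s r ((1 + r) / 2) q) as [C1 E1]; try lra.
  - apply rcont_circle_sq; auto; lra.
  - intros z Hz. apply Hs. lra.
  - intros z Hz. specialize (H2 z). lra.
  - rewrite circle_mean_eq. apply Rle_trans with (rmean (fun t => K * poisson_int (circle_sq f q) q (s (circ r t)))).
    + apply rmean_le. apply rcont_circle_sq; auto; lra. apply rcont_mult; auto. apply rcont_const.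
      intros t. assert (E : Cmod (circ r t) = r) by (apply Cmod_circ; lra).
      unfold circle_sq at 1. apply (H0 q); auto; try lra. specialize (H2 (circ r t)). lra.
    + rewrite rmean_scal, E1 by auto. apply Rmult_le_compat_l; auto. apply HB; lra.
Qed.

Lemma H2_bound_comp f s N : hol f -> selfmap s -> H2_bound f N ->
  H2_bound (fun z => f (s z)) (8 / (1 - Cmod (s (RtoC 0)) ^ 2) * N).
Proof.
  intros Hf Hs HN. rewrite <- (Rmult_1_l (_ * N)).
  assert (H0 : Cmod (s 0) < 1) by (apply selfmap_lt; auto; rewrite Cmod_0; lra).
  assert (H00 := Cmod_ge_0 (s 0)).
  apply subordination with (f := f) (s := s); auto; try lra. now apply hol_comp.
  - intros r Hr. exists 0. split. lra. intros q Hq z Hz Hsz. rewrite Rmult_1_l.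
    apply poisson_majorant; auto; lra.
  - exists ((1 + Cmod (s 0)) / 2). split. lra. intros q Hq. apply poisson_int_H2_bound; auto; lra.
Qed.

(** The Poisson kernel of a = s(0) is of size 1 / (1 - |a|^2) near [a], and of
    size 1 - |a|^2 away from it. If [a] tends to the boundary point [p]
    nontangentially, the factor |p - z|^2 cancels the peak of the kernel, and
    the bound gains two powers of 1 - |a|^2. *)
Lemma H2_bound_comp_vanishing g s N p K : hol g -> selfmap s -> H2_bound g N -> 0 <= K ->
  Cmod (p - s (RtoC 0)) <= K * (1 - Cmod (s (RtoC 0)) ^ 2) ->
  H2_bound (fun z => (p - s z) * g (s z))%C
    ((1 + 4 * K) ^ 2 * (1 - Cmod (s (RtoC 0)) ^ 2) * N).
Proof.
  intros Hg Hs HN HK Hp. rewrite <- (Rmult_1_l (_ * N)).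
  set (a := s (RtoC 0)) in *.
  assert (H0 : Cmod a < 1) by (apply selfmap_lt; auto; rewrite Cmod_0; lra).
  assert (H00 := Cmod_ge_0 a).
  pose (f := fun z => ((p - z) * g z)%C).
  assert (Hf : hol f). { apply hol_mult; auto. apply hol_minus. apply hol_const. apply hol_id. }
  apply subordination with (f := f) (s := s); auto; try lra. apply (hol_comp f s); auto.
  - intros r Hr. exists 0. split. lra. intros q Hq z Hz Hsz. rewrite Rmult_1_l.
    apply (poisson_majorant f); auto; lra.
  - exists ((1 + Cmod a) / 2). split. lra. intros q Hq. fold a.
    assert (HN0 := H2_bound_pos _ _ Hg HN).
    apply Rle_trans with ((1 + 4 * K) ^ 2 * (1 - Cmod a ^ 2) * rmean (circle_sq g q)).
    + apply poisson_int_le; try lra. apply rcont_circle_sq; auto; lra. apply rcont_circle_sq; auto; lra.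
      intros t. unfold circle_sq, f. set (e := circ q t).
      rewrite Cmod_mult, Rpow_mult_distr, <- Rmult_assoc. apply Rmult_le_compat_r. apply pow2_ge_0.
      assert (D := Cmod_triangle_sub e a).
      assert (D2 : Cmod (p - e) <= Cmod (p - a) + Cmod (e - a)).
      { rewrite (Cmod_sub_sym e a). replace (p - e)%C with ((p - a) + (a - e))%C by ring. apply Cmod_triangle. }
      unfold e in D at 1. rewrite Cmod_circ in D by lra.
      unfold poisson. fold e. set (x := Cmod (e - a)) in *. set (m := Cmod a) in *.
      assert (Hx : Cmod (p - a) <= 4 * K * x).
      { apply Rle_trans with (1 := Hp). replace (K * (1 - m ^ 2)) with ((1 + m) * K * (1 - m)) by ring.
        apply Rle_trans with (2 * K * (1 - m)). apply Rmult_le_compat_r; nra.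
        replace (4 * K * x) with (2 * K * (2 * x)) by ring. apply Rmult_le_compat_l; lra. }
      assert (H : Cmod (p - e) ^ 2 <= (1 + 4 * K) ^ 2 * x ^ 2).
      { rewrite <- Rpow_mult_distr. apply pow_incr. split. apply Cmod_ge_0. lra. }
      assert (Hxp : 0 < x ^ 2) by (apply pow_lt; lra).
      apply Rle_trans with ((q ^ 2 - m ^ 2) / x ^ 2 * ((1 + 4 * K) ^ 2 * x ^ 2)).
      apply Rmult_le_compat_l; auto. apply Rlt_le, Rdiv_lt_0_compat; auto; nra.
      replace ((q ^ 2 - m ^ 2) / x ^ 2 * ((1 + 4 * K) ^ 2 * x ^ 2)) with ((1 + 4 * K) ^ 2 * (q ^ 2 - m ^ 2)) by (field; lra).
      apply Rmult_le_compat_l. apply pow2_ge_0. nra.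
    + apply Rmult_le_compat_l. apply Rmult_le_pos. apply pow2_ge_0. nra. apply HN. lra.
Qed.

(** The variance for the probability density [poisson r a] is nonnegative. *)
Lemma poisson_jensen u r a : Cmod a < r < 1 -> rcont u ->
  (rmean (fun t => poisson r a t * u t)) ^ 2 <= rmean (fun t => poisson r a t * u t ^ 2).
Proof.
  intros Hr Hu. assert (Hr' : Cmod a < r) by lra.
  set (m := rmean (fun t => poisson r a t * u t)).
  assert (C1 := rcont_mult_poisson _ _ _ Hu Hr').
  assert (C2 := rcont_mult_poisson _ _ _ (rcont_pow2 _ Hu) Hr').
  assert (C0 := rcont_poisson r a Hr').
  assert (H : 0 <= rmean (fun t => (poisson r a t * u t ^ 2 + (- 2 * m) * (poisson r a t * u t)) + m ^ 2 * poisson r a t)).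
  { apply rmean_pos. apply rcont_plus; [apply rcont_plus|]; auto; apply rcont_mult; auto; apply rcont_const.
    intros t. replace (poisson r a t * u t ^ 2 + -2 * m * (poisson r a t * u t) + m ^ 2 * poisson r a t)
      with (poisson r a t * (u t - m) ^ 2) by ring.
    apply Rmult_le_pos. apply Rlt_le, poisson_pos; lra. apply pow2_ge_0. }
  rewrite !rmean_plus, !rmean_scal, rmean_poisson in H; auto; try (apply rcont_mult; auto; apply rcont_const).
  fold m in H. nra.
  apply rcont_plus; auto; apply rcont_mult; auto; apply rcont_const.
Qed.

(** A quantitative form of Harnack's inequality: the relative variation of the
    Poisson kernel between [a] and [b] is bounded by their distance in the scale
    of the distance to the boundary. The radius [r] is close enough to 1 for
    that scale to be the one of the unit disk. *)
Lemma poisson_harnack r a b t eta K : 0 <= eta -> 0 <= K -> Cmod a < r < 1 -> Cmod b < r ->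
  1 - Cmod a ^ 2 <= 2 * (r ^ 2 - Cmod a ^ 2) -> 1 - Cmod b <= 2 * (r - Cmod b) ->
  Cmod (a - b) <= eta * (1 - Cmod a ^ 2) -> Cmod (a - b) <= K * (1 - Cmod b ^ 2) ->
  Rabs (poisson r a t - poisson r b t) <= (4 * eta * (1 + 4 * K)) * poisson r a t.
Proof.
  intros He HK Ha Hb Har Hbr H1 H2. assert (Ha0 := Cmod_ge_0 a). assert (Hb0 := Cmod_ge_0 b).
  assert (Da := poisson_den r a t ltac:(lra)). assert (Db := poisson_den r b t Hb).
  assert (Na : (circ r t - a)%C <> RtoC 0) by now apply Cmod_gt_0.
  assert (Nb : (circ r t - b)%C <> RtoC 0) by now apply Cmod_gt_0.
  assert (Dc := Cmod_triangle_sub (circ r t) b). rewrite Cmod_circ in Dc by lra.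
  assert (E : Rabs (poisson r a t - poisson r b t) <=
     2 * r * Cmod (a - b) / (Cmod (circ r t - a) * Cmod (circ r t - b))).
  { rewrite !poisson_Re by lra.
    match goal with |- Rabs (Re ?x - Re ?y) <= _ => replace (Re x - Re y) with (Re (x - y)%C) by (destruct x, y; reflexivity) end.
    eapply Rle_trans. apply re_le_Cmod. right.
    match goal with |- Cmod ?x = _ => replace x with (RtoC 2 * circ r t * (a - b) / ((circ r t - a) * (circ r t - b)))%C by (field; auto) end.
    rewrite Cmod_div, !Cmod_mult, Cmod_circ, Cmod_R, Rabs_pos_eq; auto; try lra.
    apply Cmult_neq_0; auto. }
  eapply Rle_trans. exact E. unfold poisson.
  assert (D3 : Cmod (circ r t - a) <= Cmod (circ r t - b) + Cmod (a - b)).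
  { rewrite (Cmod_sub_sym a b). replace (circ r t - a)%C with ((circ r t - b) + (b - a))%C by ring. apply Cmod_triangle. }
  set (x := Cmod (circ r t - a)) in *. set (y := Cmod (circ r t - b)) in *.
  set (d := Cmod (a - b)) in *. set (m := Cmod a) in *. set (n := Cmod b) in *.
  assert (Hd0 : 0 <= d) by apply Cmod_ge_0.
  assert (Hxy : x <= (1 + 4 * K) * y).
  { assert (K * (1 - n ^ 2) <= 4 * K * y).
    { replace (4 * K * y) with (K * (4 * y)) by ring. apply Rmult_le_compat_l; auto. nra. }
    lra. }
  apply Rmult_le_reg_r with (x * x * y). repeat apply Rmult_lt_0_compat; auto.
  replace (2 * r * d / (x * y) * (x * x * y)) with (2 * r * (d * x)) by (field; lra).
  replace (4 * eta * (1 + 4 * K) * ((r ^ 2 - m ^ 2) / x ^ 2) * (x * x * y))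
    with (2 * ((eta * (2 * (r ^ 2 - m ^ 2))) * ((1 + 4 * K) * y))) by (field; lra).
  assert (Hdm : d <= eta * (2 * (r ^ 2 - m ^ 2))).
  { apply Rle_trans with (1 := H1). now apply Rmult_le_compat_l. }
  assert (Hprod : d * x <= (eta * (2 * (r ^ 2 - m ^ 2))) * ((1 + 4 * K) * y)).
  { apply Rmult_le_compat; lra. }
  assert (0 <= d * x) by (apply Rmult_le_pos; lra).
  nra.
Qed.

(** Two self-maps that are uniformly close in the hyperbolic metric have
    composition operators that are close in norm: the difference f(s1 z) - f(s2
    z) is an integral against a difference of Poisson kernels, which is at most
    a small multiple of one of them. *)
Lemma H2_bound_comp_diff f s1 s2 N eta K : hol f -> H2_bound f N -> selfmap s1 -> selfmap s2 ->
  0 <= eta -> 0 <= K ->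
  (forall z, Cmod z < 1 -> Cmod (s1 z - s2 z) <= eta * (1 - Cmod (s1 z) ^ 2)
     /\ Cmod (s1 z - s2 z) <= K * (1 - Cmod (s2 z) ^ 2)) ->
  H2_bound (fun z => f (s1 z) - f (s2 z))%C
    ((4 * eta * (1 + 4 * K)) ^ 2 * (8 / (1 - Cmod (s1 (RtoC 0)) ^ 2) * N)).
Proof.
  intros Hf HN Hs1 Hs2 He HK H.
  assert (H0 : Cmod (s1 0) < 1) by (apply selfmap_lt; auto; rewrite Cmod_0; lra).
  assert (H00 := Cmod_ge_0 (s1 0)).
  apply subordination with (f := f) (s := s1); auto.
  - apply hol_minus; apply hol_comp; auto.
  - apply pow2_ge_0.
  - intros r Hr.
    destruct (proj2 Hs1 r ltac:(lra)) as [rho1 [Hrho1 B1]].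
    destruct (proj2 Hs2 r ltac:(lra)) as [rho2 [Hrho2 B2]].
    pose (rho := Rmax rho1 rho2).
    assert (Hrho : rho < 1) by (apply Rmax_lub_lt; auto).
    assert (R1 : rho1 <= rho) by apply Rmax_l. assert (R2 : rho2 <= rho) by apply Rmax_r. clearbody rho.
    (* From this radius on, [q ^ 2 - Cmod a ^ 2] and [q - Cmod b] are at least half of
       [1 - Cmod a ^ 2] and [1 - Cmod b]. *)
    exists (1 - (1 - rho ^ 2) / 4).
    destruct (Rlt_le_dec rho 0) as [Hneg|Hpos].
    { exfalso. assert (B := B1 (RtoC 0)). rewrite Cmod_0 in B. specialize (B ltac:(lra)). lra. }
    split. nra.
    intros q Hq z Hz Hsq.
    assert (HD : Cmod z < 1) by lra. destruct (H z HD) as [HA HB].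
    specialize (B1 z ltac:(lra)). specialize (B2 z ltac:(lra)).
    set (a := s1 z) in *. set (b := s2 z) in *.
    assert (Ha0 := Cmod_ge_0 a). assert (Hb0 := Cmod_ge_0 b).
    assert (Hb : Cmod b < q) by nra.
    assert (Ea : f a = mean (fun t => RtoC (poisson q a t) * f (circ q t))%C) by (symmetry; apply poisson_formula; auto; lra).
    assert (Eb : f b = mean (fun t => RtoC (poisson q b t) * f (circ q t))%C) by (symmetry; apply poisson_formula; auto; lra).
    assert (Cf : cont (fun t => f (circ q t))) by (apply hol_cont_circ; auto; lra).
    assert (Pa : rcont (poisson q a)) by (apply rcont_poisson; lra).
    assert (Pb : rcont (poisson q b)) by (apply rcont_poisson; lra).
    set (c := 4 * eta * (1 + 4 * K)).
    assert (Hc : 0 <= c) by (unfold c; nra).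
    assert (L : Cmod (f a - f b) <= c * rmean (fun t => poisson q a t * Cmod (f (circ q t)))).
    { rewrite Ea, Eb, <- mean_minus by (apply cont_mult; auto; now apply cont_ofR).
      eapply Rle_trans. apply Cmod_mean_le. apply cont_minus; apply cont_mult; auto; now apply cont_ofR.
      rewrite <- rmean_scal by (apply rcont_mult; auto; now apply rcont_Cmod).
      apply rmean_le.
      apply rcont_Cmod, cont_minus; apply cont_mult; auto; now apply cont_ofR.
      apply rcont_mult. apply rcont_const. apply rcont_mult; auto. now apply rcont_Cmod.
      intros t. replace (RtoC (poisson q a t) * f (circ q t) - RtoC (poisson q b t) * f (circ q t))%C
        with (RtoC (poisson q a t - poisson q b t) * f (circ q t))%C by (rewrite RtoC_minus; ring).
      rewrite Cmod_mult, Cmod_R, <- Rmult_assoc. apply Rmult_le_compat_r. apply Cmod_ge_0.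
      apply poisson_harnack; auto; try lra; nra. }
    apply Rle_trans with ((c * rmean (fun t => poisson q a t * Cmod (f (circ q t)))) ^ 2).
    apply pow_incr. split; auto. apply Cmod_ge_0.
    rewrite Rpow_mult_distr. apply Rmult_le_compat_l. apply pow2_ge_0.
    apply (poisson_jensen (fun t => Cmod (f (circ q t)))). lra. now apply rcont_Cmod.
  - exists ((1 + Cmod (s1 0)) / 2). split. lra. intros q Hq. apply poisson_int_H2_bound; auto; lra.
Qed.

(** * Locally uniform limits and geometric sums *)

Section Limit.
Variables (F : nat -> C -> C) (S : C -> C).
Hypothesis HF : forall n, hol (F n).
Hypothesis Hlim : forall r, r < 1 -> forall e, 0 < e -> exists n, forall z, Cmod z <= r -> Cmod (F n z - S z) <= e.

Lemma limit_continuous z : Cmod z < 1 -> continuous S z.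
Proof.
  intros Hz. assert (Hz0 := Cmod_ge_0 z). apply continuous_C_Cmod. intros e He.
  destruct (Hlim ((1 + Cmod z) / 2) ltac:(lra) (e / 4) ltac:(lra)) as [n Hn].
  destruct (proj1 (continuous_C_Cmod _ _) (cdiff_continuous _ _ (HF n z Hz)) (e / 4) ltac:(lra)) as [d [Hd H]].
  assert (Hd' : 0 < Rmin d ((1 - Cmod z) / 2)) by (apply Rmin_glb_lt; lra).
  assert (M1 := Rmin_l d ((1 - Cmod z) / 2)). assert (M2 := Rmin_r d ((1 - Cmod z) / 2)).
  exists (Rmin d ((1 - Cmod z) / 2)). split; auto. intros y Hy.
  assert (T := Cmod_triangle_sub y z).
  assert (B1 := Hn y ltac:(lra)). assert (B2 := Hn z ltac:(lra)). assert (B3 := H y ltac:(lra)).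
  replace (S y - S z)%C with (- (F n y - S y) + (F n y - F n z) + (F n z - S z))%C by ring.
  eapply Rle_lt_trans. apply Cmod_triangle.
  eapply Rle_lt_trans. apply Rplus_le_compat_r, Cmod_triangle. rewrite Cmod_opp. lra.
Qed.

(** A locally uniform limit inherits Cauchy's formula, and the Cauchy transform
    of a continuous function is holomorphic. *)
Lemma limit_hol : hol S.
Proof.
  intros z Hz. assert (Hz0 := Cmod_ge_0 z).
  pose (r := (1 + Cmod z) / 2). assert (Hr : Cmod z < r < 1) by (unfold r; lra). clearbody r.
  assert (Cc : cont (circ r)) by (intros t; apply cont_circ).
  assert (CS : cont (fun t => S (circ r t))).
  { intros t. apply cont_comp_circ, limit_continuous. rewrite Cmod_circ; lra. }
  apply cdiff_ext_loc with (fun z => mean (fun t => S (circ r t) * (circ r t / (circ r t - z))))%C.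
  2: { apply cauchy_transform_cdiff; auto; lra. }
  generalize (Cmod_lt_open r z (proj1 Hr)). apply filter_imp. intros y Hy.
  assert (Hy0 := Cmod_ge_0 y).
  assert (Hne : forall t, (circ r t - y)%C <> RtoC 0) by (intros; apply Cminus_neq_0; rewrite Cmod_circ; lra).
  set (m := mean _).
  apply C_eq_of_small. intros e He.
    pose (k := r / (r - Cmod y)).
    assert (Hk : 0 < k) by (apply Rdiv_lt_0_compat; lra).
    assert (He' : 0 < e / (1 + k)) by (apply Rdiv_lt_0_compat; lra).
    destruct (Hlim r ltac:(lra) _ He') as [n Hn].
    assert (En := cauchy_formula (F n) y r ltac:(lra) (HF n)).
    assert (CFn : cont (fun t => F n (circ r t))) by (apply hol_cont_circ; [apply HF|lra]).
    assert (Cq : cont (fun t => circ r t / (circ r t - y))%C) by (apply cont_div; auto; apply cont_circ_minus).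
    replace (m - S y)%C with ((m - F n y) + (F n y - S y))%C by ring.
    eapply Rle_trans. apply Cmod_triangle.
    replace e with (e / (1 + k) * k + e / (1 + k)) by (field; lra).
    apply Rplus_le_compat. 2: apply Hn; lra.
    rewrite <- En. unfold m.
    rewrite (mean_ext (fun t => circ r t * F n (circ r t) / (circ r t - y))%C (fun t => F n (circ r t) * (circ r t / (circ r t - y)))%C).
    2: { intros t. field. auto. }
    rewrite <- mean_minus by (apply cont_mult; auto).
    apply Cmod_mean_bound. apply cont_minus; apply cont_mult; auto.
    intros t. replace (S (circ r t) * (circ r t / (circ r t - y)) - F n (circ r t) * (circ r t / (circ r t - y)))%C
      with ((S (circ r t) - F n (circ r t)) * (circ r t / (circ r t - y)))%C by ring.
    rewrite Cmod_mult. apply Rmult_le_compat; try apply Cmod_ge_0.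
    rewrite Cmod_sub_sym. apply Hn. rewrite Cmod_circ; lra.
    rewrite Cmod_div by auto. rewrite Cmod_circ by lra. unfold k, Rdiv.
    apply Rmult_le_compat_l. lra. apply Rinv_le_contravar. lra.
    generalize (Cmod_triangle_sub (circ r t) y). rewrite Cmod_circ; lra.
Qed.

(** |S|^2 <= |F_n|^2 / (1 - s) + |F_n - S|^2 / s, where [s] is chosen before
    [n]. *)
Lemma limit_H2_bound B : (forall n, H2_bound (F n) B) -> H2_bound S B.
Proof.
  intros HB r Hr. assert (HS := limit_hol).
  assert (HB0 : 0 <= B) by (apply (H2_bound_pos (F O)); auto).
  apply le_epsilon. intros e He.
  (* [(1 - s)^-1 <= 1 + 2 s], and [2 s B] is at most [e / 2]. *)
  pose (s := Rmin (1/2) (e / (4 * (B + 1)))).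
  assert (Hs0 : 0 < s) by (apply Rmin_glb_lt; [lra|apply Rdiv_lt_0_compat; lra]).
  assert (Hs1 : s <= 1/2) by apply Rmin_l. assert (Hs2 : s <= e / (4 * (B + 1))) by apply Rmin_r.
  clearbody s.
  assert (Hes : 0 < s * e / 2) by (apply Rdiv_lt_0_compat; nra).
  assert (Hsq : 0 < sqrt (s * e / 2)) by now apply sqrt_lt_R0.
  destruct (Hlim r ltac:(lra) _ Hsq) as [n Hn].
  rewrite circle_mean_eq.
  assert (Sn := rcont_circle_sq (F n) r (HF n) ltac:(lra)).
  apply Rle_trans with (rmean (fun t => / (1 - s) * circle_sq (F n) r t + e / 2)).
  - apply rmean_le. apply rcont_circle_sq; auto; lra.
    apply rcont_plus. apply rcont_mult; auto. apply rcont_const. apply rcont_const.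
    intros t. unfold circle_sq. set (z := circ r t). assert (Hz : Cmod z <= r) by (unfold z; rewrite Cmod_circ; lra).
    replace (S z) with (F n z + - (F n z - S z))%C by ring.
    eapply Rle_trans. apply Cmod_plus_sq with (s := s). lra.
    apply Rplus_le_compat_l. rewrite Cmod_opp.
    apply Rle_trans with (/ s * (sqrt (s * e / 2)) ^ 2).
    apply Rmult_le_compat_l. apply Rlt_le, Rinv_0_lt_compat; lra. apply pow_incr. split; auto. apply Cmod_ge_0.
    rewrite pow2_sqrt by lra. right; field; lra.
  - rewrite rmean_plus, rmean_scal, rmean_const; auto.
    2: { apply rcont_mult; auto. apply rcont_const. } 2: apply rcont_const.
    assert (Hm : rmean (circle_sq (F n) r) <= B) by exact (HB n r Hr).
    assert (Hi : / (1 - s) <= 1 + 2 * s).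
    { apply Rmult_le_reg_r with (1 - s). lra. rewrite Rinv_l by lra. nra. }
    apply Rle_trans with ((1 + 2 * s) * B + e / 2).
    apply Rplus_le_compat_r. apply Rmult_le_compat; auto. apply Rlt_le, Rinv_0_lt_compat; lra.
    apply rmean_pos; auto. intros; apply pow2_ge_0.
    assert (s * (4 * (B + 1)) <= e).
    { apply Rle_trans with (e / (4 * (B + 1)) * (4 * (B + 1))). apply Rmult_le_compat_r; lra. right; field; lra. }
    nra.
Qed.
End Limit.

(** The summation proceeds from the front, so that shifting the family
    corresponds to removing the first term. *)
Fixpoint csum (g : nat -> C -> C) (n : nat) (z : C) : C :=
  match n with O => RtoC 0 | S n => (g O z + csum (fun k => g (S k)) n z)%C end.

Definition csum_inf (g : nat -> C -> C) (z : C) : C :=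
  (Series (fun k => Re (g k z)), Series (fun k => Im (g k z))).

Lemma csum_hol n : forall g, (forall k, hol (g k)) -> hol (csum g n).
Proof.
  induction n; intros g Hg. apply hol_const. apply (hol_plus (g O)); auto.
Qed.

(** The weight [s] of [H2_bound_plus_s] makes the geometric bound reproduce
    itself: C = (1 - s)^-2 solves C = 1 / (1 - s) + (s^2 / s) C. *)
Lemma csum_H2_bound s n : 0 < s < 1 -> forall g B, 0 <= B -> (forall k, hol (g k)) -> (forall k, H2_bound (g k) (B * (s ^ 2) ^ k)) ->
  H2_bound (csum g n) (B / (1 - s) ^ 2).
Proof.
  intros Hs. induction n; intros g B HB Hg HgB.
  - intros r Hr. rewrite circle_mean_eq. rewrite (rmean_ext _ (fun _ => 0)).
    rewrite rmean_const. apply Rdiv_le_0_compat; auto. apply pow_lt; lra.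
    intros t. unfold circle_sq. simpl. rewrite Cmod_0. ring.
  - apply H2_bound_le with (/ (1 - s) * B + / s * (B * s ^ 2 / (1 - s) ^ 2)).
    right; field; lra.
    apply (H2_bound_plus_s (g O)); auto. apply csum_hol; auto.
    generalize (HgB O). now rewrite pow_O, Rmult_1_r.
    apply IHn; auto. apply Rmult_le_pos; auto. apply pow2_ge_0.
    intros k. replace (B * s ^ 2 * (s ^ 2) ^ k) with (B * (s ^ 2) ^ (S k)) by (simpl; ring). auto.
Qed.

Lemma csum_inf_bound s D g z : 0 < s < 1 -> (forall k, Cmod (g k z) <= D * s ^ k) ->
  ex_series (fun k => Re (g k z)) /\ ex_series (fun k => Im (g k z)) /\
  Cmod (csum_inf g z) <= 2 * (D / (1 - s)).
Proof.
  intros Hs H.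
  assert (Hg : is_series (fun k => D * s ^ k) (D / (1 - s))).
  { apply (is_series_scal (V:=R_NormedModule) D). apply is_series_geom. rewrite Rabs_pos_eq; lra. }
  assert (Hre : forall k, Rabs (Re (g k z)) <= D * s ^ k).
  { intros k. eapply Rle_trans. apply re_le_Cmod. apply H. }
  assert (Him : forall k, Rabs (Im (g k z)) <= D * s ^ k).
  { intros k. eapply Rle_trans. 2: apply H. eapply Rle_trans. 2: apply Rmax_Cmod. apply Rmax_r. }
  assert (Hs' : forall a : nat -> R, (forall k, Rabs (a k) <= D * s ^ k) -> ex_series a /\ Rabs (Series a) <= D / (1 - s)).
  { intros a Ha.
    assert (Ea : ex_series (fun k => Rabs (a k))).
    { apply (ex_series_le (K:=R_AbsRing) (V:=R_CompleteNormedModule) _ (fun k => D * s ^ k)).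
      intros k. unfold norm; simpl. unfold abs; simpl. rewrite Rabs_Rabsolu. auto. exists (D / (1 - s)). exact Hg. }
    split. now apply ex_series_Rabs.
    eapply Rle_trans. now apply Series_Rabs. rewrite <- (is_series_unique _ _ Hg).
    apply Series_le. intros k. split. apply Rabs_pos. auto. exists (D / (1 - s)). exact Hg. }
  destruct (Hs' _ Hre) as [E1 L1]. destruct (Hs' _ Him) as [E2 L2].
  repeat split; auto. eapply Rle_trans. apply Cmod_le_abs. simpl. lra.
Qed.

Lemma csum_inf_S s D g z : 0 < s < 1 -> (forall k, Cmod (g k z) <= D * s ^ k) ->
  csum_inf g z = (g O z + csum_inf (fun k => g (S k)) z)%C.
Proof.
  intros Hs H. destruct (csum_inf_bound s D g z Hs H) as [E1 [E2 _]].
  unfold csum_inf. rewrite (Series_incr_1 _ E1), (Series_incr_1 _ E2).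
  destruct (g O z). reflexivity.
Qed.

Lemma csum_inf_tail s z n : 0 < s < 1 -> forall D g, (forall k, Cmod (g k z) <= D * s ^ k) ->
  Cmod (csum g n z - csum_inf g z) <= 2 * (D / (1 - s)) * s ^ n.
Proof.
  intros Hs. induction n; intros D g H.
  - simpl. replace (0 - csum_inf g z)%C with (- csum_inf g z)%C by ring.
    rewrite Cmod_opp, Rmult_1_r. apply csum_inf_bound; auto.
  - rewrite (csum_inf_S s D g z Hs H). simpl csum.
    replace (g O z + csum (fun k => g (S k)) n z - (g O z + csum_inf (fun k => g (S k)) z))%C
      with (csum (fun k => g (S k)) n z - csum_inf (fun k => g (S k)) z)%C by ring.
    replace (2 * (D / (1 - s)) * s ^ S n) with (2 * (D * s / (1 - s)) * s ^ n) by (simpl; field; lra).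
    apply IHn. intros k. replace (D * s * s ^ k) with (D * s ^ (S k)) by (simpl; ring). auto.
Qed.

Lemma csum_term_bound g B s z : 0 < s < 1 -> 0 <= B -> (forall k, hol (g k)) -> (forall k, H2_bound (g k) (B * (s ^ 2) ^ k)) ->
  Cmod z < 1 -> forall k, Cmod (g k z) <= sqrt (8 / (1 - Cmod z ^ 2) * B) * s ^ k.
Proof.
  intros Hs HB Hg HgB Hz k. assert (Hz0 := Cmod_ge_0 z).
  assert (HQ : 0 <= 8 / (1 - Cmod z ^ 2) * B).
  { apply Rmult_le_pos; auto. now apply eval_const_pos. }
  assert (H := point_eval (g k) _ z (Hg k) (HgB k) Hz).
  apply Rsqr_incr_0_var. 2: { apply Rmult_le_pos. apply sqrt_pos. apply pow_le; lra. }
  rewrite !Rsqr_pow2, Rpow_mult_distr, pow2_sqrt by auto.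
  rewrite <- Rmult_assoc in H. rewrite <- pow_mult, Nat.mul_comm, pow_mult. exact H.
Qed.

Theorem csum_inf_hol_H2_bound g B s : 0 < s < 1 -> 0 <= B -> (forall k, hol (g k)) -> (forall k, H2_bound (g k) (B * (s ^ 2) ^ k)) ->
  hol (csum_inf g) /\ H2_bound (csum_inf g) (B / (1 - s) ^ 2) /\
  forall z, Cmod z < 1 -> csum_inf g z = (g O z + csum_inf (fun k => g (S k)) z)%C.
Proof.
  intros Hs HB Hg HgB.
  assert (Hlim : forall r, r < 1 -> forall e, 0 < e -> exists n, forall z, Cmod z <= r -> Cmod (csum g n z - csum_inf g z) <= e).
  { intros r Hr e He.
    destruct (Rlt_le_dec r 0) as [Hneg|Hpos].
    { exists O. intros z Hz. generalize (Cmod_ge_0 z). lra. }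
    pose (D := sqrt (8 / (1 - r ^ 2) * B)).
    assert (HD : 0 <= D) by apply sqrt_pos.
    destruct (pow_lt_1_zero s) with (y := e / (2 * ((D + 1) / (1 - s)))) as [n Hn].
    rewrite Rabs_pos_eq; lra.
    apply Rdiv_lt_0_compat; auto. apply Rmult_lt_0_compat. lra. apply Rdiv_lt_0_compat; lra.
    specialize (Hn n (le_n _)). rewrite Rabs_pos_eq in Hn by (apply pow_le; lra).
    exists n. intros z Hz. assert (Hz0 := Cmod_ge_0 z).
    apply Rle_trans with (2 * ((D + 1) / (1 - s)) * s ^ n).
    - apply csum_inf_tail; auto. intros k.
      eapply Rle_trans. apply (csum_term_bound g B s); auto; lra.
      apply Rmult_le_compat_r. apply pow_le; lra.
      apply Rle_trans with D; [|lra]. apply sqrt_le_1_alt.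
      apply Rmult_le_compat_r; auto. apply Rmult_le_compat_l. lra. apply Rinv_le_contravar; nra.
    - apply Rlt_le in Hn. apply Rmult_le_compat_l with (r := 2 * ((D + 1) / (1 - s))) in Hn.
      replace (2 * ((D + 1) / (1 - s)) * (e / (2 * ((D + 1) / (1 - s))))) with e in Hn. exact Hn.
      field. lra. apply Rmult_le_pos. lra. apply Rdiv_le_0_compat; lra. }
  split; [|split].
  - apply (limit_hol (csum g)); auto. intros n. now apply csum_hol.
  - apply (limit_H2_bound (csum g)); auto. intros n. now apply csum_hol.
    intros n. now apply csum_H2_bound.
  - intros z Hz. eapply csum_inf_S. exact Hs. apply csum_term_bound with (B := B); auto.
Qed.

Lemma csum_ext_at g h z z' n : (forall k, g k z = h k z') -> csum g n z = csum h n z'.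
Proof.
  revert g h. induction n; intros g h H; simpl; auto. rewrite H. f_equal. apply IHn. auto.
Qed.

Lemma csum_inf_ext_at g h z z' : (forall k, g k z = h k z') -> csum_inf g z = csum_inf h z'.
Proof.
  intros H. unfold csum_inf. f_equal; apply Series_ext; intros n; now rewrite H.
Qed.

(** * Growth of functions of the Hardy space *)

(** Compare [f] with the Poisson integral of its values on the larger circle: at the
    centre, the kernel is constant. *)
Lemma circle_mean_mono f r q : hol f -> 0 < r -> r <= q -> q < 1 -> circle_mean f r <= circle_mean f q.
Proof.
  intros Hf H1 H2 H3. destruct (Req_dec r q) as [->|Hne]. lra.
  destruct (poisson_int_mean_value (circle_sq f q) (fun z => z) r q q) as [C1 E1]; try lra.
  - apply rcont_circle_sq; auto; lra.
  - intros; apply cdiff_id.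
  - auto.
  - rewrite !circle_mean_eq. eapply Rle_trans.
    + apply rmean_le with (v := fun t => poisson_int (circle_sq f q) q (circ r t)); auto.
      apply rcont_circle_sq; auto; lra.
      intros t. unfold circle_sq at 1. apply poisson_majorant; auto. rewrite Cmod_circ; lra.
    + rewrite E1. right. apply rmean_ext. intros t. unfold poisson.
      replace (circ q t - 0)%C with (circ q t) by ring. rewrite Cmod_0, Cmod_circ by lra. field. lra.
Qed.

Lemma cdiff_conj_conj f z : cdiff f (Cconj z) -> cdiff (fun y => Cconj (f (Cconj y))) z.
Proof.
  intros [h [Hh Hl]]. exists (fun y => Cconj (h (Cconj y))). split.
  - apply cont_Cconj. apply (continuous_comp (fun y : C => Cconj y) h); auto.
    apply cont_Cconj, continuous_id.
  - assert (Hc : continuous (fun y : C => Cconj y) z) by apply cont_Cconj, continuous_id.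
    generalize (Hc _ Hl). unfold filtermap. apply filter_imp. intros y Hy.
    rewrite Hy, Cplus_conj, Cmult_conj, Cminus_conj, !Cconj_conj. reflexivity.
Qed.

Lemma Cconj_R (x : R) : Cconj (RtoC x) = RtoC x.
Proof. unfold Cconj, RtoC; simpl. now rewrite Ropp_0. Qed.

(** The function z |-> f(z) conj(f(conj(c / z))) is holomorphic on the annulus c
    < |z| < 1, and on the circle of radius x it equals f(x e^it) conj(f((c/x)
    e^it)). As its means do not depend on x, the correlation of [f] on two
    circles only depends on the product of the radii; take c = r q. *)
Lemma mean_product_radii f r q : hol f -> 0 < q <= r -> r < 1 ->
  rmean (fun t => Re (f (circ r t) * Cconj (f (circ q t)))%C) = circle_mean f (sqrt (r * q)).
Proof.
  intros Hf Hq Hr.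
  pose (c := r * q). assert (Hc : 0 < c) by (apply Rmult_lt_0_compat; lra).
  pose (F := fun z => (f z * Cconj (f (Cconj (RtoC c / z))))%C).
  assert (HF : forall z, c < Cmod z < 1 -> cdiff F z).
  { intros z Hz. assert (Hz0 : z <> RtoC 0) by (apply Cmod_gt_0; lra).
    apply cdiff_mult. apply Hf; lra.
    apply (cdiff_comp (fun w => Cconj (f (Cconj w))) (fun z => RtoC c / z)%C).
    apply cdiff_conj_conj. apply Hf. rewrite Cmod_conj, Cmod_div, Cmod_R, Rabs_pos_eq by (auto; lra).
    apply Rmult_lt_reg_r with (Cmod z). lra. unfold Rdiv. rewrite Rmult_assoc, Rinv_l; lra.
    apply (cdiff_div (fun _ => RtoC c) (fun z => z)); auto. apply cdiff_const. apply cdiff_id. }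
  assert (Hs : q <= sqrt (r * q) <= r).
  { split. rewrite <- (sqrt_square q) at 1 by lra. apply sqrt_le_1_alt. nra.
    rewrite <- (sqrt_square r) at 2 by lra. apply sqrt_le_1_alt. nra. }
  set (s := sqrt (r * q)) in *.
  assert (Hss : s * s = r * q) by (apply sqrt_sqrt; nra).
  assert (Hcq : c < q) by (unfold c; nra).
  assert (E := annulus_mean F c 1 ltac:(lra) HF r s ltac:(lra) ltac:(lra)).
  assert (EF : forall x, 0 < x -> forall t, F (circ x t) = (f (circ x t) * Cconj (f (circ (c / x) t)))%C).
  { intros x Hx t. unfold F. do 3 f_equal.
    assert (Hx0 : circ x t <> RtoC 0) by (apply Cmod_gt_0; rewrite Cmod_circ; lra).
    assert (Ex := circ_conj x t).
    assert (Ec : circ (c / x) t = (RtoC (c / (x * x)) * circ x t)%C).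
    { unfold circ, RtoC, Cmult; simpl. f_equal; field; lra. }
    assert (Ed : (RtoC c / circ x t)%C = (RtoC (c / (x * x)) * Cconj (circ x t))%C).
    { replace (RtoC c) with (RtoC (c / (x * x)) * RtoC (x * x))%C. rewrite <- Ex. field. auto.
      rewrite <- RtoC_mult. f_equal. field. lra. }
    rewrite Ed, Ec, Cmult_conj, Cconj_conj, Cconj_R. reflexivity. }
  assert (CF : forall x, c < x < 1 -> cont (fun t => F (circ x t))).
  { intros x Hx t. apply cont_comp_circ, cdiff_continuous, HF. rewrite Cmod_circ; lra. }
  transitivity (Re (mean (fun t => F (circ r t)))).
  - rewrite Re_mean by (apply CF; lra). apply rmean_ext. intros t. rewrite EF by lra.
    replace (c / r) with q by (unfold c; field; lra). reflexivity.
  - rewrite E, Re_mean by (apply CF; lra). rewrite circle_mean_eq. apply rmean_ext. intros t. rewrite EF by lra.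
    replace (c / s) with s. unfold circle_sq. rewrite <- Cmod2_conj. reflexivity.
    unfold c. rewrite <- Hss. field. lra.
Qed.

Lemma Cmod_minus_sq (z w : C) : Cmod (z - w) ^ 2 = Cmod z ^ 2 + Cmod w ^ 2 - 2 * Re (z * Cconj w)%C.
Proof. rewrite !Cmod2_alt. destruct z, w; simpl. ring. Qed.

Lemma scal_circ r q t : (RtoC r * circ q t)%C = circ (r * q) t.
Proof. unfold circ, RtoC, Cmult; simpl; f_equal; ring. Qed.

(** [f] is the sum of its dilation f(rho z), which is bounded, and of a
    remainder of small norm, to which point evaluation applies. By
    [mean_product_radii] the squared norm of the remainder on the circle of
    radius [q] is M(q) + M(rho q) - 2 M(q sqrt rho), with M the circle means of
    [f]; these increase to a finite limit, so the expression is small for [rho]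
    close to 1. *)
Theorem growth_little_o f N : hol f -> H2_bound f N -> forall e, 0 < e ->
  exists M, forall z, Cmod z < 1 -> Cmod (f z) <= M + e / sqrt (1 - Cmod z ^ 2).
Proof.
  intros Hf HN e He.
  destruct (completeness (fun x => exists r, 0 < r < 1 /\ x = circle_mean f r)) as [L [HL1 HL2]].
  { exists N. intros x [r [Hr ->]]. now apply HN. }
  { exists (circle_mean f (1/2)), (1/2). split; auto; lra. }
  (* The squared norm allowed for the remainder; 8 is the constant of [point_eval]. *)
  pose (n := e ^ 2 / 8). assert (Hn : 0 < n) by (apply Rdiv_lt_0_compat; [apply pow_lt|]; lra).
  assert (Hr0 : exists r, 0 < r < 1 /\ L - n < circle_mean f r).
  { apply NNPP. intros Hno. assert (HLn : L <= L - n); [|lra].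
    apply HL2. intros x [r [Hr ->]]. apply Rnot_lt_le. intros Hlt. apply Hno. exists r. auto. }
  destruct Hr0 as [r0 [Hr0 Hr0L]].
  pose (rho := r0). pose (g := fun z => (f z - f (RtoC rho * z))%C).
  assert (Hrho : forall z, Cmod z < 1 -> Cmod (RtoC rho * z) <= rho).
  { intros z Hz. rewrite Cmod_mult, Cmod_R, Rabs_pos_eq; unfold rho; nra. }
  assert (Hfr : hol (fun z => f (RtoC rho * z)%C)).
  { intros z Hz. apply (cdiff_comp f (fun z => RtoC rho * z)%C). apply Hf. generalize (Hrho z Hz); unfold rho; lra.
    apply cdiff_mult. apply cdiff_const. apply cdiff_id. }
  assert (Hg : hol g) by (apply hol_minus; auto).
  assert (Hgb : H2_bound g n).
  { intros q' Hq'.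
    pose (q := Rmax q' (sqrt r0)).
    assert (Hsr : 0 < sqrt r0 < 1).
    { split. apply sqrt_lt_R0; lra. rewrite <- sqrt_1. apply sqrt_lt_1_alt; lra. }
    assert (Q1 : q' <= q) by apply Rmax_l. assert (Q2 : sqrt r0 <= q) by apply Rmax_r.
    assert (Q3 : q < 1) by (apply Rmax_lub_lt; lra). clearbody q.
    eapply Rle_trans. apply (circle_mean_mono g q' q); auto; lra.
    assert (E : circle_mean g q = circle_mean f q + circle_mean f (rho * q) - 2 * circle_mean f (sqrt (q * (rho * q)))).
    { rewrite <- (mean_product_radii f q (rho * q)); auto; unfold rho; try nra.
      rewrite !circle_mean_eq.
      assert (S1 := rcont_circle_sq f q Hf ltac:(lra)). assert (S2 := rcont_circle_sq f (r0 * q) Hf ltac:(nra)).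
      assert (C1 := hol_cont_circ f q Hf ltac:(lra)). assert (C2 := hol_cont_circ f (r0 * q) Hf ltac:(nra)).
      assert (S3 : rcont (fun t => Re (f (circ q t) * Cconj (f (circ (r0 * q) t)))%C)).
      { apply rcont_Re. apply cont_mult; auto. intros t. apply cont_Cconj, C2. }
      replace (rmean (circle_sq f q) + rmean (circle_sq f (r0 * q)) - 2 * rmean (fun t => Re (f (circ q t) * Cconj (f (circ (r0 * q) t)))%C))
        with (rmean (circle_sq f q) + rmean (circle_sq f (r0 * q)) + - 2 * rmean (fun t => Re (f (circ q t) * Cconj (f (circ (r0 * q) t)))%C)) by ring.
      rewrite <- rmean_scal, <- rmean_plus, <- rmean_plus; auto.
      2: now apply rcont_plus. 2: { apply rcont_mult; auto. apply rcont_const. }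
      apply rmean_ext. intros t. unfold circle_sq, g. rewrite Cmod_minus_sq, scal_circ. unfold rho. ring. }
    rewrite E.
    assert (Es : sqrt (q * (rho * q)) = q * sqrt r0).
    { replace (q * (rho * q)) with ((q * q) * r0) by (unfold rho; ring).
      rewrite sqrt_mult_alt, sqrt_square by nra. reflexivity. }
    assert (Esr : sqrt r0 * sqrt r0 = r0) by (apply sqrt_sqrt; lra).
    rewrite Es.
    assert (B1 : circle_mean f q <= L) by (apply HL1; exists q; split; auto; lra).
    assert (B2 : circle_mean f (rho * q) <= circle_mean f (q * sqrt r0)) by (apply circle_mean_mono; auto; unfold rho; nra).
    assert (B3 : circle_mean f r0 <= circle_mean f (q * sqrt r0)) by (apply circle_mean_mono; auto; nra).
    lra. }
  exists (sqrt (8 / (1 - rho ^ 2) * N)). intros z Hz. assert (Hz0 := Cmod_ge_0 z).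
  replace (f z) with (f (RtoC rho * z) + g z)%C by (unfold g; ring).
  eapply Rle_trans. apply Cmod_triangle. apply Rplus_le_compat.
  - specialize (Hrho z Hz). set (w := (RtoC rho * z)%C) in *. assert (Hw0 := Cmod_ge_0 w).
    assert (HN0 := H2_bound_pos _ _ Hf HN). unfold rho in *.
    rewrite <- (sqrt_pow2 (Cmod (f w))) by apply Cmod_ge_0. apply sqrt_le_1_alt.
    eapply Rle_trans. apply point_eval; eauto; lra.
    apply Rmult_le_compat_r; auto. apply Rmult_le_compat_l. lra. apply Rinv_le_contravar; nra.
  - assert (Hp : 0 < 1 - Cmod z ^ 2) by nra.
    rewrite <- (sqrt_pow2 (Cmod (g z))) by apply Cmod_ge_0.
    replace (e / sqrt (1 - Cmod z ^ 2)) with (sqrt (e ^ 2 / (1 - Cmod z ^ 2))).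
    2: { rewrite sqrt_div_alt, sqrt_pow2 by lra. reflexivity. }
    apply sqrt_le_1_alt. eapply Rle_trans. apply point_eval; eauto.
    unfold n. right. field. lra.
Qed.

(** * Affine maps of the half plane *)

Section HalfPlane.
Variables (p : C) (k : R).
Hypothesis Hp : Cmod p = 1.

(** The Cayley transform that sends [p] to infinity, followed by a vertical
    translation. The parameter [k] serves to place the second fixed point on the
    real axis. *)
Definition to_half (z : C) : C := ((p + z) / (p - z) - Ci * RtoC k)%C.
Definition of_half (w : C) : C := (p * (w + Ci * RtoC k - 1) / (w + Ci * RtoC k + 1))%C.
(** The denominator of [of_half]; its modulus is 2 / |p - of_half w|. *)
Definition shift (w : C) : C := (w + Ci * RtoC k + 1)%C.

Lemma p_neq_0 : p <> RtoC 0.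
Proof. apply Cmod_gt_0. lra. Qed.

Lemma p_minus_neq_0 z : Cmod z < 1 -> (p - z)%C <> RtoC 0.
Proof. intros H. apply Cminus_neq_0. lra. Qed.

Lemma Re_shift w : Re (shift w) = Re w + 1.
Proof. unfold shift. destruct w; simpl. ring. Qed.

Lemma Re_pos_neq_0 w : 0 < Re w -> w <> RtoC 0.
Proof. intros H E. rewrite E in H. simpl in H. lra. Qed.

Lemma shift_neq_0 w : 0 < Re w -> shift w <> RtoC 0.
Proof. intros H. apply Re_pos_neq_0. rewrite Re_shift. lra. Qed.

Lemma Re_to_half z : (p - z)%C <> 0 -> Re (to_half z) = (1 - Cmod z ^ 2) / Cmod (p - z) ^ 2.
Proof.
  intros Hn.
  assert (Hn' : Cconj (p - z) <> RtoC 0) by (apply Cmod_gt_0; rewrite Cmod_conj; now apply Cmod_gt_0).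
  unfold to_half.
  replace ((p + z) / (p - z))%C with (((p + z) * Cconj (p - z)) / RtoC (Cmod (p - z) ^ 2))%C.
  2: { rewrite Cmod2_conj. field. auto. }
  replace (1 - Cmod z ^ 2) with (Cmod p ^ 2 - Cmod z ^ 2) by (rewrite Hp; ring).
  unfold Cdiv, Rdiv. rewrite <- RtoC_inv by (apply Rgt_not_eq, pow_lt; now apply Cmod_gt_0).
  rewrite !Cmod2_alt. set (q := / _). destruct p, z; simpl. ring.
Qed.

Lemma Re_to_half_pos z : Cmod z < 1 -> 0 < Re (to_half z).
Proof.
  intros Hz. rewrite Re_to_half by now apply p_minus_neq_0. assert (Hz0 := Cmod_ge_0 z).
  apply Rdiv_lt_0_compat. nra. apply pow_lt, Cmod_gt_0, p_minus_neq_0, Hz.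
Qed.

Lemma Cmod_of_half w : 0 < Re w -> 1 - Cmod (of_half w) ^ 2 = 4 * Re w / Cmod (shift w) ^ 2.
Proof.
  intros Hw. assert (Hs := shift_neq_0 w Hw). unfold of_half. fold (shift w).
  rewrite Cmod_div, Cmod_mult, Hp, Rmult_1_l by auto.
  assert (Hs0 : 0 < Cmod (shift w)) by now apply Cmod_gt_0.
  replace (1 - (Cmod (w + Ci * k - 1) / Cmod (shift w)) ^ 2)
    with ((Cmod (shift w) ^ 2 - Cmod (w + Ci * k - 1) ^ 2) / Cmod (shift w) ^ 2) by (field; lra).
  f_equal. rewrite !Cmod2_alt. unfold shift. destruct w; simpl. ring.
Qed.

Lemma of_half_lt w : 0 < Re w -> Cmod (of_half w) < 1.
Proof.
  intros Hw. assert (H := Cmod_of_half w Hw).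
  assert (Hpos : 0 < 4 * Re w / Cmod (shift w) ^ 2).
  { apply Rdiv_lt_0_compat. lra. apply pow_lt, Cmod_gt_0, shift_neq_0, Hw. }
  assert (H0 := Cmod_ge_0 (of_half w)). nra.
Qed.

Lemma to_half_of_half w : 0 < Re w -> to_half (of_half w) = w.
Proof.
  intros Hw. assert (Hs := shift_neq_0 w Hw). assert (H0 := p_neq_0). unfold to_half, of_half.
  fold (shift w).
  replace (p - p * (w + Ci * k - 1) / shift w)%C with (RtoC 2 * p / shift w)%C.
  2: { unfold shift in *. field. auto. }
  replace (p + p * (w + Ci * k - 1) / shift w)%C with (RtoC 2 * p * (w + Ci * k) / shift w)%C.
  2: { unfold shift in *. field. auto. }
  field. repeat split; auto.
Qed.

Lemma shift_to_half z : Cmod z < 1 -> shift (to_half z) = (RtoC 2 * p / (p - z))%C.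
Proof.
  intros Hz. assert (Hn := p_minus_neq_0 z Hz). unfold shift, to_half. field. auto.
Qed.

Lemma of_half_to_half z : Cmod z < 1 -> of_half (to_half z) = z.
Proof.
  intros Hz. assert (Hn := p_minus_neq_0 z Hz). assert (H0 := p_neq_0).
  unfold of_half. fold (shift (to_half z)). rewrite shift_to_half by auto.
  unfold to_half. field. repeat split; auto.
Qed.

Lemma of_half_minus w1 w2 : shift w1 <> RtoC 0 -> shift w2 <> RtoC 0 ->
  (of_half w1 - of_half w2)%C = (RtoC 2 * p * (w1 - w2) / (shift w1 * shift w2))%C.
Proof. intros H1 H2. unfold of_half. fold (shift w1) (shift w2). unfold shift in *. field. auto. Qed.

Lemma p_minus_of_half w : shift w <> RtoC 0 -> (p - of_half w)%C = (RtoC 2 * p / shift w)%C.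
Proof. intros H1. unfold of_half. fold (shift w). unfold shift in *. field. auto. Qed.

(** The self-map of the disk that is w |-> al w + be in the half-plane
    coordinate. *)
Definition conj_affine (al be : R) (z : C) : C := of_half (RtoC al * to_half z + RtoC be)%C.

Lemma Re_affine al be w : Re (RtoC al * w + RtoC be)%C = al * Re w + be.
Proof. destruct w; simpl. ring. Qed.

Lemma Re_affine_pos al be z : 0 < al -> 0 <= be -> Cmod z < 1 ->
  0 < Re (RtoC al * to_half z + RtoC be)%C.
Proof. intros Ha Hb Hz. rewrite Re_affine. assert (H2 := Re_to_half_pos z Hz). nra. Qed.

Lemma conj_affine_comp a1 b1 a2 b2 z : 0 < a2 -> 0 <= b2 -> Cmod z < 1 ->
  conj_affine a1 b1 (conj_affine a2 b2 z) = conj_affine (a1 * a2) (a1 * b2 + b1) z.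
Proof.
  intros. unfold conj_affine. rewrite to_half_of_half by now apply Re_affine_pos.
  f_equal. rewrite !RtoC_plus, !RtoC_mult. ring.
Qed.

Lemma conj_affine_id z : Cmod z < 1 -> conj_affine 1 0 z = z.
Proof.
  intros. unfold conj_affine. rewrite <- (of_half_to_half z) at 2 by auto. f_equal. ring.
Qed.

(** For |z| <= r, the coordinate of the image has real part bounded from below
    and modulus bounded from above; by [Cmod_of_half], the image stays away from
    the circle. *)
Lemma conj_affine_selfmap al be : 0 < al -> 0 <= be -> selfmap (conj_affine al be).
Proof.
  intros Ha Hb. split.
  - intros z Hz. assert (HR := Re_affine_pos al be z Ha Hb Hz).
    assert (Hs := shift_neq_0 _ HR). unfold conj_affine.
    assert (HW : cdiff (fun z => RtoC al * to_half z + RtoC be)%C z).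
    { apply cdiff_plus. 2: apply cdiff_const. apply cdiff_mult. apply cdiff_const.
      unfold to_half. apply cdiff_minus. 2: apply cdiff_const.
      apply (cdiff_div (fun z => p + z)%C (fun z => p - z)%C). now apply p_minus_neq_0.
      apply cdiff_plus. apply cdiff_const. apply cdiff_id.
      apply cdiff_minus. apply cdiff_const. apply cdiff_id. }
    apply (cdiff_comp of_half (fun z => RtoC al * to_half z + RtoC be)%C); auto.
    unfold of_half. apply (cdiff_div (fun w => p * (w + Ci * k - 1))%C shift); auto.
    + apply cdiff_mult. apply cdiff_const. apply cdiff_minus; [apply cdiff_plus|]; try apply cdiff_const. apply cdiff_id.
    + unfold shift. apply cdiff_plus; [apply cdiff_plus|]; try apply cdiff_const. apply cdiff_id.
  - intros r Hr. destruct (Rlt_le_dec r 0) as [Hneg|Hpos].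
    { exists 0. split. lra. intros z Hz. generalize (Cmod_ge_0 z). lra. }
    pose (c := (1 - r ^ 2) / 4). pose (M := 2 / (1 - r) + Rabs k).
    pose (D := al * M + be + Rabs k + 1). pose (d := 4 * (al * c) / D ^ 2).
    assert (Hc : 0 < c) by (unfold c; nra).
    assert (HM : 0 < M). { unfold M. generalize (Rabs_pos k) (Rdiv_lt_0_compat 2 (1 - r)). lra. }
    assert (HD : 0 < D). { unfold D. generalize (Rabs_pos k). nra. }
    assert (Hd : 0 < d). { apply Rdiv_lt_0_compat. nra. now apply pow_lt. }
    exists (1 - d / 2). split. lra. intros z Hz. assert (Hz0 := Cmod_ge_0 z).
    assert (Hz1 : Cmod z < 1) by lra.
    assert (HR := Re_affine_pos al be z Ha Hb Hz1). unfold conj_affine.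
    set (w := (RtoC al * to_half z + RtoC be)%C) in *.
    assert (E := Cmod_of_half w HR). assert (Hs : 0 < Cmod (shift w)) by now apply Cmod_gt_0, shift_neq_0.
    assert (Hpz : Cmod (p - z) <= 2).
    { eapply Rle_trans. apply Cmod_triangle. rewrite Cmod_opp. lra. }
    assert (Hpz' : 1 - r <= Cmod (p - z)) by (generalize (Cmod_triangle_sub p z); lra).
    assert (HRe : al * c <= Re w).
    { unfold w. rewrite Re_affine, Re_to_half by now apply p_minus_neq_0.
      assert (c <= (1 - Cmod z ^ 2) / Cmod (p - z) ^ 2).
      { unfold c, Rdiv. apply Rmult_le_compat. nra. lra. nra.
        apply Rinv_le_contravar. apply pow_lt; lra. nra. }
      nra. }
    assert (HsD : Cmod (shift w) <= D).
    { unfold shift, D, w.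
      assert (HW : Cmod (to_half z) <= M).
      { unfold to_half, M. eapply Rle_trans. apply Cmod_triangle.
        rewrite Cmod_opp, Cmod_mult, Cmod_Ci, Cmod_R, Rmult_1_l. apply Rplus_le_compat_r.
        rewrite Cmod_div by now apply p_minus_neq_0.
        apply Rmult_le_compat. apply Cmod_ge_0. apply Rlt_le, Rinv_0_lt_compat; lra.
        eapply Rle_trans. apply Cmod_triangle. lra. apply Rinv_le_contravar; lra. }
      eapply Rle_trans. apply Cmod_triangle. rewrite Cmod_1. apply Rplus_le_compat_r.
      eapply Rle_trans. apply Cmod_triangle. rewrite Cmod_mult, Cmod_Ci, Cmod_R, Rmult_1_l. apply Rplus_le_compat_r.
      eapply Rle_trans. apply Cmod_triangle. rewrite Cmod_mult, !Cmod_R, !Rabs_pos_eq by lra. nra. }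
    assert (Hdle : d <= 1 - Cmod (of_half w) ^ 2).
    { rewrite E. unfold d. apply Rmult_le_compat. nra. apply Rlt_le, Rinv_0_lt_compat, pow_lt; auto. lra.
      apply Rinv_le_contravar. now apply pow_lt. apply pow_incr. lra. }
    assert (H0 := Cmod_ge_0 (of_half w)).
    apply Rsqr_incr_0_var; unfold Rsqr; nra.
Qed.

(** The half-plane coordinate of 0. *)
Definition base : C := (RtoC 1 - Ci * RtoC k)%C.
Lemma to_half_0 : to_half (RtoC 0) = base.
Proof. unfold to_half, base. rewrite Cplus_0_r. replace (p - 0)%C with p by ring. field. apply p_neq_0. Qed.

Let kap := 1 + Rabs k.

Lemma conj_affine_0 al be : conj_affine al be (RtoC 0) = of_half (RtoC al * base + RtoC be)%C.
Proof. unfold conj_affine. now rewrite to_half_0. Qed.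

Lemma Re_affine_base al be : Re (RtoC al * base + RtoC be)%C = al + be.
Proof. unfold base. simpl. ring. Qed.

Lemma shift_affine_base al be :
  shift (RtoC al * base + RtoC be)%C = (RtoC (al + be + 1) + Ci * RtoC (k * (1 - al)))%C.
Proof. unfold shift, base. rewrite !RtoC_plus, !RtoC_mult, !RtoC_minus. ring. Qed.

Lemma shift_affine_lower al be : 0 < al -> 0 <= be -> al + be + 1 <= Cmod (shift (RtoC al * base + RtoC be)%C).
Proof.
  intros. rewrite shift_affine_base. eapply Rle_trans. 2: apply re_le_Cmod. simpl.
  eapply Rle_trans. 2: apply Rle_abs. lra.
Qed.

Lemma shift_affine_upper al be : 0 < al -> 0 <= be ->
  Cmod (shift (RtoC al * base + RtoC be)%C) <= al + be + 1 + Rabs k * Rabs (1 - al).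
Proof.
  intros. rewrite shift_affine_base. eapply Rle_trans. apply Cmod_triangle.
  rewrite Cmod_mult, Cmod_Ci, !Cmod_R, Rmult_1_l, Rabs_mult, (Rabs_pos_eq (al + be + 1)); lra.
Qed.

Lemma conj_affine_0_modulus al be : 0 < al -> 0 <= be ->
  1 - Cmod (conj_affine al be (RtoC 0)) ^ 2 = 4 * (al + be) / Cmod (shift (RtoC al * base + RtoC be)%C) ^ 2.
Proof.
  intros. rewrite conj_affine_0, Cmod_of_half, Re_affine_base; auto. rewrite Re_affine_base. lra.
Qed.

(** The orbit of 0 under dilations approaches [p] along a ray, hence
    nontangentially, and at the speed 1 / al. *)
Lemma dilation_attract al : 1 <= al -> let a := conj_affine al 0 (RtoC 0) in
  / (al * kap ^ 2) <= 1 - Cmod a ^ 2 <= 4 / al /\ Cmod (p - a) <= kap * (1 - Cmod a ^ 2).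
Proof.
  intros Ha a. unfold a. rewrite conj_affine_0_modulus by lra. rewrite conj_affine_0.
  assert (L := shift_affine_lower al 0 ltac:(lra) ltac:(lra)).
  assert (U := shift_affine_upper al 0 ltac:(lra) ltac:(lra)).
  assert (Hs : shift (RtoC al * base + RtoC 0)%C <> RtoC 0) by (apply Cmod_gt_0; lra).
  rewrite p_minus_of_half, Cmod_div, Cmod_mult, Hp, Cmod_R, Rabs_pos_eq by (auto; lra).
  set (y := Cmod (shift (RtoC al * base + RtoC 0)%C)) in *.
  assert (Hk := Rabs_pos k). rewrite (Rabs_left1 (1 - al)) in U by lra.
  assert (U' : y <= 2 * al * kap) by (unfold kap; nra). unfold kap in *. set (c := 1 + Rabs k) in *.
  assert (Hc : 1 <= c) by (unfold c; lra).
  assert (Hy : 0 < y) by lra. assert (Hy2 : 0 < y ^ 2) by now apply pow_lt.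
  repeat split.
  - apply Rmult_le_reg_r with (y ^ 2 * (al * c ^ 2)). apply Rmult_lt_0_compat; auto. apply Rmult_lt_0_compat. lra. apply pow_lt; lra.
    replace (/ (al * c ^ 2) * (y ^ 2 * (al * c ^ 2))) with (y ^ 2) by (field; lra).
    replace (4 * (al + 0) / y ^ 2 * (y ^ 2 * (al * c ^ 2))) with ((2 * al * c) ^ 2) by (field; lra).
    apply pow_incr. lra.
  - apply Rmult_le_reg_r with (y ^ 2 * al). apply Rmult_lt_0_compat; lra.
    replace (4 * (al + 0) / y ^ 2 * (y ^ 2 * al)) with (4 * al ^ 2) by (field; lra).
    replace (4 / al * (y ^ 2 * al)) with (4 * y ^ 2) by (field; lra).
    apply Rmult_le_compat_l. lra. apply pow_incr. lra.
  - apply Rmult_le_reg_r with (y ^ 2). auto.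
    replace (2 * 1 / y * y ^ 2) with (2 * y) by (field; lra).
    replace (c * (4 * (al + 0) / y ^ 2) * y ^ 2) with (2 * (2 * al * c)) by (field; lra). lra.
Qed.

(** The point of the circle with half-plane coordinate 0, which small dilations
    approach. *)
Definition origin : C := of_half (RtoC 0).

Lemma Cmod_base : Cmod base = Cmod (1 + Ci * RtoC k)%C.
Proof. rewrite <- Cmod_conj. f_equal. unfold base, Cconj; simpl. unfold Cplus, Cmult, Ci, RtoC; simpl. f_equal; ring. Qed.

Lemma one_ik_neq_0 : (1 + Ci * RtoC k)%C <> RtoC 0.
Proof. apply Re_pos_neq_0. simpl. lra. Qed.

(** The counterpart of [dilation_attract] for small dilations, at the other end
    of the ray. *)
Lemma dilation_repel al : 0 < al <= 1 -> let a := conj_affine al 0 (RtoC 0) in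
  1 - Cmod a ^ 2 <= 4 * al /\ Cmod (origin - a) <= kap * (1 - Cmod a ^ 2).
Proof.
  intros Ha a. unfold a. rewrite conj_affine_0_modulus by lra. rewrite conj_affine_0.
  assert (L := shift_affine_lower al 0 ltac:(lra) ltac:(lra)).
  assert (U := shift_affine_upper al 0 ltac:(lra) ltac:(lra)).
  assert (Hs : shift (RtoC al * base + RtoC 0)%C <> RtoC 0) by (apply Cmod_gt_0; lra).
  assert (H1 := one_ik_neq_0).
  assert (Es0 : shift (RtoC 0) = (1 + Ci * RtoC k)%C) by (unfold shift; ring).
  unfold origin. rewrite of_half_minus; rewrite ?Es0; auto.
  assert (Em : Cmod (RtoC 2 * p * (0 - (RtoC al * base + 0)) / ((1 + Ci * k) * shift (RtoC al * base + 0)))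
     = 2 * al / Cmod (shift (RtoC al * base + RtoC 0)%C)).
  { rewrite Cmod_div by (apply Cmult_neq_0; auto). rewrite !Cmod_mult, Hp, (Cmod_R 2), Rabs_pos_eq by lra.
    replace (0 - (RtoC al * base + 0))%C with (- (RtoC al * base))%C by ring.
    rewrite Cmod_opp, Cmod_mult, Cmod_R, Cmod_base, Rabs_pos_eq by lra.
    field. split. lra. apply Rgt_not_eq. now apply Cmod_gt_0. }
  rewrite Em.
  set (y := Cmod (shift (RtoC al * base + RtoC 0)%C)) in *.
  assert (Hk := Rabs_pos k). rewrite (Rabs_pos_eq (1 - al)) in U by lra.
  assert (U' : y <= 2 * kap) by (unfold kap; nra). unfold kap in *. set (c := 1 + Rabs k) in *.
  assert (Hc : 1 <= c) by (unfold c; lra).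
  assert (Hy : 0 < y) by lra. assert (Hy2 : 0 < y ^ 2) by now apply pow_lt.
  assert (Hy1 : 1 <= y ^ 2) by (replace 1 with (1 ^ 2) by ring; apply pow_incr; lra).
  clear Em U L Hs a. clearbody y c.
  assert (Hyn : y <> 0) by (apply Rgt_not_eq; auto).
  split.
  - apply Rmult_le_reg_r with (y ^ 2). auto.
    replace (4 * (al + 0) / y ^ 2 * y ^ 2) with (4 * al)  by (field; auto). nra.
  - apply Rmult_le_reg_r with (y ^ 2). auto.
    replace (2 * al / y * y ^ 2) with (2 * al * y) by (field; auto).
    replace (c * (4 * (al + 0) / y ^ 2) * y ^ 2) with (2 * al * (2 * c)) by (field; auto). nra.
Qed.

Lemma translation_base be x : 0 <= be <= x ->
  8 / (1 - Cmod (conj_affine 1 be (RtoC 0)) ^ 2) <= 2 * (2 + x) ^ 2.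
Proof.
  intros Hb. rewrite conj_affine_0_modulus by lra.
  assert (L := shift_affine_lower 1 be ltac:(lra) ltac:(lra)).
  assert (U := shift_affine_upper 1 be ltac:(lra) ltac:(lra)).
  replace (1 - 1) with 0 in U by ring. rewrite Rabs_R0, Rmult_0_r in U.
  set (y := Cmod (shift _)) in *.
  replace (8 / (4 * (1 + be) / y ^ 2)) with (2 * y ^ 2 / (1 + be)) by (field; split; lra).
  apply Rmult_le_reg_r with (1 + be). lra.
  replace (2 * y ^ 2 / (1 + be) * (1 + be)) with (2 * y ^ 2) by (field; lra).
  assert (y ^ 2 <= (2 + x) ^ 2) by (apply pow_incr; lra).
  assert (0 <= (2 + x) ^ 2) by apply pow2_ge_0. nra.
Qed.

(** The hyperbolic distance between w + b1 and w + b2 is at most of order (b2 -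
    b1) / b1, uniformly in the half plane. *)
Lemma translations_close b1 b2 c z : 0 <= b1 -> b1 <= b2 -> 0 <= c -> b2 - b1 <= c * b1 -> Cmod z < 1 ->
  Cmod (conj_affine 1 b1 z - conj_affine 1 b2 z) <= c / 2 * (1 - Cmod (conj_affine 1 b1 z) ^ 2) /\
  Cmod (conj_affine 1 b1 z - conj_affine 1 b2 z) <= c * (1 + c) / 2 * (1 - Cmod (conj_affine 1 b2 z) ^ 2).
Proof.
  intros H1 H12 Hc Hcb Hz.
  assert (R1 := Re_affine_pos 1 b1 z ltac:(lra) H1 Hz). assert (R2 := Re_affine_pos 1 b2 z ltac:(lra) ltac:(lra) Hz).
  assert (S1 := shift_neq_0 _ R1). assert (S2 := shift_neq_0 _ R2).
  unfold conj_affine. rewrite of_half_minus by auto. rewrite !Cmod_of_half by auto.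
  assert (HW := Re_to_half_pos z Hz).
  assert (E1 : Re (RtoC 1 * to_half z + RtoC b1)%C = Re (to_half z) + b1) by (rewrite Re_affine; ring).
  assert (E2 : Re (RtoC 1 * to_half z + RtoC b2)%C = Re (to_half z) + b2) by (rewrite Re_affine; ring).
  assert (Es : shift (RtoC 1 * to_half z + RtoC b2)%C = (shift (RtoC 1 * to_half z + RtoC b1) + RtoC (b2 - b1))%C).
  { unfold shift. rewrite RtoC_minus. ring. }
  assert (Ed : ((RtoC 1 * to_half z + RtoC b1) - (RtoC 1 * to_half z + RtoC b2))%C = RtoC (b1 - b2)).
  { rewrite RtoC_minus. ring. }
  rewrite Ed, E1, E2.
  rewrite Cmod_div, !Cmod_mult, Hp, !Cmod_R, (Rabs_pos_eq 2), (Rabs_left1 (b1 - b2)) by (try lra; apply Cmult_neq_0; auto).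
  assert (Y12 : Cmod (shift (RtoC 1 * to_half z + RtoC b2)) <= Cmod (shift (RtoC 1 * to_half z + RtoC b1)) + (b2 - b1)).
  { rewrite Es. eapply Rle_trans. apply Cmod_triangle. rewrite Cmod_R, Rabs_pos_eq; lra. }
  assert (Y21 : Cmod (shift (RtoC 1 * to_half z + RtoC b1)) <= Cmod (shift (RtoC 1 * to_half z + RtoC b2))).
  { assert (Rs : Re (shift (RtoC 1 * to_half z + RtoC b1)) = Re (to_half z) + b1 + 1) by (rewrite Re_shift, E1; ring).
    rewrite Es. set (s := shift _) in *.
    apply Rsqr_incr_0_var; [|apply Cmod_ge_0]. rewrite !Rsqr_pow2, !Cmod2_alt.
    destruct s as [s1 s2]. simpl in *. subst s1. nra. }
  assert (Y1 : Re (to_half z) + b1 <= Cmod (shift (RtoC 1 * to_half z + RtoC b1))).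
  { eapply Rle_trans. 2: apply re_le_Cmod. rewrite Re_shift, E1. eapply Rle_trans. 2: apply Rle_abs. lra. }
  assert (P1 : 0 < Cmod (shift (RtoC 1 * to_half z + RtoC b1))) by now apply Cmod_gt_0.
  assert (P2 : 0 < Cmod (shift (RtoC 1 * to_half z + RtoC b2))) by now apply Cmod_gt_0.
  set (y1 := Cmod (shift (RtoC 1 * to_half z + RtoC b1))) in *.
  set (y2 := Cmod (shift (RtoC 1 * to_half z + RtoC b2))) in *.
  set (w := Re (to_half z)) in *. clearbody y1 y2 w.
  replace (2 * 1 * - (b1 - b2) / (y1 * y2)) with (2 * (b2 - b1) / (y1 * y2)) by (field; lra).
  split.
  - apply Rmult_le_reg_r with (y1 ^ 2 * y2). apply Rmult_lt_0_compat; auto. now apply pow_lt.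
    replace (2 * (b2 - b1) / (y1 * y2) * (y1 ^ 2 * y2)) with (2 * (b2 - b1) * y1) by (field; lra).
    replace (c / 2 * (4 * (w + b1) / y1 ^ 2) * (y1 ^ 2 * y2)) with (2 * (c * (w + b1)) * y2) by (field; lra).
    assert (c * b1 <= c * (w + b1)) by (apply Rmult_le_compat_l; lra).
    apply Rmult_le_compat; lra.
  - apply Rmult_le_reg_r with (y1 * y2 ^ 2). apply Rmult_lt_0_compat; auto. now apply pow_lt.
    replace (2 * (b2 - b1) / (y1 * y2) * (y1 * y2 ^ 2)) with (2 * (b2 - b1) * y2) by (field; lra).
    replace (c * (1 + c) / 2 * (4 * (w + b2) / y2 ^ 2) * (y1 * y2 ^ 2)) with (2 * (c * (w + b2)) * ((1 + c) * y1)) by (field; lra).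
    assert (c * b1 <= c * (w + b2)) by (apply Rmult_le_compat_l; lra).
    assert (c * b1 <= c * y1) by (apply Rmult_le_compat_l; lra).
    apply Rmult_le_compat; lra.
Qed.
End HalfPlane.

(** * Bounded solutions of the inhomogeneous equation *)

Section Core.
Variables (p : C) (k mu x : R).
Hypotheses (Hp : Cmod p = 1) (Hmu : 1 < mu) (Hx : 0 <= x).

Notation conj_affine := (conj_affine p k).
Let kap := 1 + Rabs k.
(** The inverse of [p - origin], so that [cut] is 1 at [p]. *)
Definition cut_scale : C := ((1 + Ci * RtoC k) / (RtoC 2 * p))%C.
(** The linear function that is 0 at [origin p k] and 1 at [p]. *)
Definition cut (z : C) : C := ((z - origin p k) * cut_scale)%C.

Lemma kap_ge_1 : 1 <= kap.
Proof. unfold kap. generalize (Rabs_pos k). lra. Qed.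

Lemma one_minus_cut z : (1 - cut z)%C = (cut_scale * (p - z))%C.
Proof.
  assert (H0 := p_neq_0 p Hp). assert (H1 := one_ik_neq_0 k).
  assert (E : (p - origin p k)%C = (RtoC 2 * p / (1 + Ci * RtoC k))%C).
  { unfold origin. assert (Es0 : shift k (RtoC 0) = (1 + Ci * RtoC k)%C) by (unfold shift; ring).
    rewrite p_minus_of_half; rewrite ?Es0; auto. }
  unfold cut. replace (origin p k) with (p - (p - origin p k))%C by ring. rewrite E.
  unfold cut_scale. field. auto.
Qed.

Lemma hol_cut : hol cut.
Proof. apply hol_mult. apply hol_minus. apply hol_id. apply hol_const. apply hol_const. Qed.

Definition cut_const := (Cmod cut_scale) ^ 2 * ((1 + 4 * kap) ^ 2 * 4).
Lemma cut_const_pos : 0 <= cut_const.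
Proof. unfold cut_const. assert (H1 := pow2_ge_0 (Cmod cut_scale)). assert (H2 := pow2_ge_0 (1 + 4 * kap)). nra. Qed.

(** Under a dilation that moves 0 towards [e], functions that vanish at [e] are
    contracted. *)
Lemma vanishing_dilation_bound e al M f N : 0 < al ->
  Cmod (e - conj_affine al 0 0) <= kap * (1 - Cmod (conj_affine al 0 0) ^ 2) ->
  1 - Cmod (conj_affine al 0 0) ^ 2 <= 4 * M -> hol f -> H2_bound f N ->
  H2_bound (fun z => cut_scale * ((e - conj_affine al 0 z) * f (conj_affine al 0 z)))%C (cut_const * M * N).
Proof.
  intros Ha H2 H1 Hf HN. assert (HN0 := H2_bound_pos f N Hf HN). assert (Hk := kap_ge_1).
  assert (Hs := conj_affine_selfmap p k Hp al 0 Ha ltac:(lra)).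
  apply H2_bound_le with (Cmod cut_scale ^ 2 * ((1 + 4 * kap) ^ 2 * (1 - Cmod (conj_affine al 0 0) ^ 2) * N)).
  - unfold cut_const. replace (Cmod cut_scale ^ 2 * ((1 + 4 * kap) ^ 2 * 4) * M * N)
      with (Cmod cut_scale ^ 2 * ((1 + 4 * kap) ^ 2 * (4 * M) * N)) by ring.
    apply Rmult_le_compat_l. apply pow2_ge_0. apply Rmult_le_compat_r; auto.
    apply Rmult_le_compat_l. apply pow2_ge_0. exact H1.
  - apply (H2_bound_mult (fun z => (e - conj_affine al 0 z) * f (conj_affine al 0 z))%C (fun _ => cut_scale)%C).
    + apply hol_mult. apply hol_minus. apply hol_const. apply Hs. now apply hol_comp.
    + apply hol_const.
    + intros z _. lra.
    + apply H2_bound_comp_vanishing; auto. lra.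
Qed.

Lemma repel_bound al f N : 0 < al <= 1 -> hol f -> H2_bound f N ->
  H2_bound (fun z => cut (conj_affine al 0 z) * f (conj_affine al 0 z))%C (cut_const * al * N).
Proof.
  intros Ha Hf HN. destruct (dilation_repel p k Hp al Ha) as [H1 H2].
  apply H2_bound_ext with (fun z => 0 - cut_scale * ((origin p k - conj_affine al 0 z) * f (conj_affine al 0 z)))%C.
  { intros z _. unfold cut. ring. }
  apply H2_bound_sub_sym, H2_bound_ext with (fun z => cut_scale * ((origin p k - conj_affine al 0 z) * f (conj_affine al 0 z)))%C.
  { intros z _. ring. }
  apply vanishing_dilation_bound; auto; lra.
Qed.

Lemma attract_bound al f N : 1 <= al -> hol f -> H2_bound f N ->
  H2_bound (fun z => (1 - cut (conj_affine al 0 z)) * f (conj_affine al 0 z))%C (cut_const * / al * N).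
Proof.
  intros Ha Hf HN. destruct (dilation_attract p k Hp al Ha) as [[_ H1] H2].
  apply H2_bound_ext with (fun z => cut_scale * ((p - conj_affine al 0 z) * f (conj_affine al 0 z)))%C.
  { intros z _. rewrite one_minus_cut. ring. }
  apply vanishing_dilation_bound; auto. lra.
Qed.

Lemma translate_H2_bound be f N : 0 <= be <= x -> hol f -> H2_bound f N ->
  H2_bound (fun z => f (conj_affine 1 be z)) (2 * (2 + x) ^ 2 * N).
Proof.
  intros Hb Hf HN. assert (HN0 := H2_bound_pos f N Hf HN).
  eapply H2_bound_le. 2: apply H2_bound_comp; eauto; apply conj_affine_selfmap; auto; lra.
  apply Rmult_le_compat_r; auto. apply translation_base; auto.
Qed.

Definition gap := / (1 - / mu).
Lemma gap_pos : 0 < gap.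
Proof. apply Rinv_0_lt_compat. assert (/ mu < 1) by (rewrite <- Rinv_1; apply Rinv_lt_contravar; lra). lra. Qed.

(** Composition with the dilation costs a factor [al] in the squared norm. The
    two translations differ by x / al, which gains a factor al^-2 by
    [H2_bound_comp_diff]; the condition mu <= al keeps the first translation
    away from 0 in proportion to [x]. *)
Lemma translation_difference_bound al f N : mu <= al -> hol f -> H2_bound f N ->
  H2_bound (fun z => f (conj_affine al 0 (conj_affine 1 (x * (1 - / al)) z)) - f (conj_affine al 0 (conj_affine 1 x z)))%C
    ((2 * gap * (1 + 2 * (gap * (1 + gap)))) ^ 2 * (2 * (2 + x) ^ 2 * (8 * kap ^ 2)) / al * N).
Proof.
  intros Ha Hf HN. assert (HN0 := H2_bound_pos f N Hf HN).
  assert (Hs := conj_affine_selfmap p k Hp al 0 ltac:(lra) ltac:(lra)).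
  destruct (dilation_attract p k Hp al ltac:(lra)) as [[H1 _] _].
  assert (Hk := kap_ge_1). assert (Hg := gap_pos).
  fold kap in H1.
  assert (Hh : H2_bound (fun z => f (conj_affine al 0 z)) (8 * (al * kap ^ 2) * N)).
  { eapply H2_bound_le. 2: apply H2_bound_comp; eauto. apply Rmult_le_compat_r; auto.
    unfold Rdiv. apply Rmult_le_compat_l. lra.
    assert (Hak : 0 < al * kap ^ 2) by (apply Rmult_lt_0_compat; [lra|apply pow_lt; lra]).
    rewrite <- (Rinv_inv (al * kap ^ 2)). apply Rinv_le_contravar; auto. now apply Rinv_0_lt_compat. }
  assert (Hia : 0 < / al <= / mu). { split. apply Rinv_0_lt_compat; lra. apply Rinv_le_contravar; lra. }
  assert (Him : / mu < 1) by (rewrite <- Rinv_1; apply Rinv_lt_contravar; lra).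
  assert (Hgm : gap * (1 - / mu) = 1) by (unfold gap; field; split; lra).
  (* the hyperbolic distance of the two translations, up to a constant *)
  pose (c := / al * gap).
  assert (Hc0 : 0 < c) by (apply Rmult_lt_0_compat; lra).
  assert (Hcg : c <= gap). { unfold c. nra. }
  assert (Hb1 : 0 <= x * (1 - / al) <= x) by nra.
  assert (Hcl : x - x * (1 - / al) <= c * (x * (1 - / al))).
  { unfold c. replace (x - x * (1 - / al)) with (x * / al * (gap * (1 - / mu))) by (rewrite Hgm; ring).
    replace (/ al * gap * (x * (1 - / al))) with (x * / al * (gap * (1 - / al))) by ring.
    apply Rmult_le_compat_l. nra. apply Rmult_le_compat_l; lra. }
  eapply H2_bound_le.
  2: { apply (H2_bound_comp_diff (fun z => f (conj_affine al 0 z)) (conj_affine 1 (x * (1 - / al))) (conj_affine 1 x)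
     (8 * (al * kap ^ 2) * N) (c / 2) (c * (1 + c) / 2)); auto; try lra.
     - now apply hol_comp.
     - apply conj_affine_selfmap; auto; lra.
     - apply conj_affine_selfmap; auto; lra.
     - nra.
     - intros z Hz. apply translations_close; auto; lra. }
  assert (HT := translation_base p k Hp (x * (1 - / al)) x Hb1).
  assert (HNN : 0 <= 8 * (al * kap ^ 2) * N).
  { apply Rmult_le_pos; auto. apply Rmult_le_pos. lra. apply Rmult_le_pos. lra. apply pow2_ge_0. }
  apply Rle_trans with ((2 * c * (1 + 2 * (gap * (1 + gap)))) ^ 2 * (2 * (2 + x) ^ 2 * (8 * (al * kap ^ 2) * N))).
  - apply Rmult_le_compat. apply pow2_ge_0. apply Rmult_le_pos; auto.
    { assert (Q := selfmap_lt _ (RtoC 0) (conj_affine_selfmap p k Hp 1 (x * (1 - / al)) ltac:(lra) ltac:(lra))).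
      rewrite Cmod_0 in Q. specialize (Q ltac:(lra)).
      now apply eval_const_pos. }
    + apply pow_incr. split. apply Rmult_le_pos; nra.
      replace (4 * (c / 2) * (1 + 4 * (c * (1 + c) / 2))) with (2 * c * (1 + 2 * (c * (1 + c)))) by field.
      apply Rmult_le_compat_l. lra. nra.
    + apply Rmult_le_compat_r; auto.
  - right. unfold c. field. lra.
Qed.

Lemma pow_mu_ge_1 j : 1 <= mu ^ j.
Proof. apply pow_R1_Rle. lra. Qed.

(** The [j]-th iterate of w |-> mu (w + x) - x, in the disk. *)
Definition phi_n (j : nat) : C -> C := conj_affine (mu ^ j) ((mu ^ j - 1) * x).

Lemma phi_n_selfmap j : selfmap (phi_n j).
Proof. assert (H := pow_mu_ge_1 j). apply conj_affine_selfmap; auto; nra. Qed.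

Lemma phi_n_0 z : Cmod z < 1 -> phi_n 0 z = z.
Proof. intros Hz. unfold phi_n. simpl. replace ((1 - 1) * x) with 0 by ring. now apply conj_affine_id. Qed.

Lemma phi_n_S j z : Cmod z < 1 -> phi_n j (phi_n 1 z) = phi_n (S j) z.
Proof.
  intros Hz. assert (H := pow_mu_ge_1 j). unfold phi_n. rewrite conj_affine_comp; auto; simpl; try nra.
  f_equal; ring.
Qed.

(** Written in this way, the iterate is compared with the dilation of the
    translate by [x]. *)
Lemma phi_n_factor j z : Cmod z < 1 -> phi_n j z = conj_affine (mu ^ j) 0 (conj_affine 1 (x * (1 - / mu ^ j)) z).
Proof.
  intros Hz. assert (H := pow_mu_ge_1 j).
  assert (/ mu ^ j <= 1) by (rewrite <- Rinv_1; apply Rinv_le_contravar; lra).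
  unfold phi_n. rewrite conj_affine_comp; auto; try lra; try nra.
  f_equal; field; lra.
Qed.

(** The translation by [x] intertwines the iterates with pure dilations, even if
    [x] > 0 and the iterates are not invertible. *)
Lemma translate_phi_n j z : Cmod z < 1 -> conj_affine 1 x (phi_n j z) = conj_affine (mu ^ j) 0 (conj_affine 1 x z).
Proof.
  intros Hz. assert (H := pow_mu_ge_1 j). unfold phi_n. rewrite !conj_affine_comp; auto; try lra; try nra.
  f_equal; ring.
Qed.

(** The [j]-th image of f - (cut f) o (w + x) under composition with the map. *)
Definition stable_part (f : C -> C) (j : nat) (z : C) : C :=
  (f (phi_n j z) - cut (conj_affine 1 x (phi_n j z)) * f (conj_affine 1 x (phi_n j z)))%C.

Lemma translate_selfmap : selfmap (conj_affine 1 x).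
Proof. apply conj_affine_selfmap; auto; lra. Qed.

Lemma stable_part_hol f j : hol f -> hol (stable_part f j).
Proof.
  intros Hf. assert (H1 := phi_n_selfmap j). assert (H2 := selfmap_comp _ _ translate_selfmap H1).
  apply hol_minus. now apply hol_comp.
  apply (hol_comp (fun z => cut z * f z)%C (fun z => conj_affine 1 x (phi_n j z))); auto.
  apply hol_mult; auto. apply hol_cut.
Qed.

Lemma stable_part_bound : exists B, 0 <= B /\ forall f N j, hol f -> H2_bound f N ->
  H2_bound (stable_part f j) (B * N * (/ mu) ^ j).
Proof.
  assert (HT0 : 0 <= 2 * (2 + x) ^ 2) by (assert (H := pow2_ge_0 (2 + x)); lra).
  assert (Hc := cut_const_pos). assert (Hg := gap_pos). assert (Hk := kap_ge_1).
  set (T := 2 * (2 + x) ^ 2) in *.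
  pose (B1 := (2 * gap * (1 + 2 * (gap * (1 + gap)))) ^ 2 * (T * (8 * kap ^ 2))).
  assert (HB1 : 0 <= B1).
  { apply Rmult_le_pos. apply pow2_ge_0. apply Rmult_le_pos; auto. assert (H := pow2_ge_0 kap). lra. }
  pose (B0 := 2 + 2 * (T * (2 * Cmod cut_scale) ^ 2)).
  assert (HB0 : 0 <= B0).
  { unfold B0. assert (0 <= T * (2 * Cmod cut_scale) ^ 2). apply Rmult_le_pos; auto. apply pow2_ge_0. lra. }
  exists (B0 + (2 * B1 + 2 * (T * cut_const))). assert (0 <= T * cut_const) by now apply Rmult_le_pos.
  split. lra. intros f N j Hf HN. assert (HN0 := H2_bound_pos f N Hf HN).
  assert (Hmc : hol (fun z => cut z * f z)%C) by (apply hol_mult; auto; apply hol_cut).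
  (* For [j = 0] there is no translation to compare with, and boundedness suffices. *)
  destruct j as [|j].
  - rewrite pow_O, Rmult_1_r. apply H2_bound_le with (2 * N + 2 * (T * ((2 * Cmod cut_scale) ^ 2 * N))).
    { unfold B0 in *. assert (0 <= (2 * B1 + 2 * (T * cut_const)) * N) by (apply Rmult_le_pos; lra). nra. }
    apply H2_bound_ext with (fun z => f z - (fun z => cut z * f z)%C (conj_affine 1 x z))%C.
    { intros z Hz. unfold stable_part.
      rewrite phi_n_0 by auto. reflexivity. }
    apply H2_bound_minus; auto. apply (hol_comp (fun z => cut z * f z)%C (conj_affine 1 x)); auto. apply translate_selfmap.
    apply (translate_H2_bound x (fun z => cut z * f z)%C); auto; try lra.
    apply H2_bound_mult; auto. apply hol_cut.
    intros z Hz. unfold cut. rewrite Cmod_mult. apply Rmult_le_compat_r. apply Cmod_ge_0.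
    eapply Rle_trans. apply Cmod_triangle. rewrite Cmod_opp.
    assert (Cmod (origin p k) <= 1).
    { assert (Hn : (Ci * k + 1)%C <> 0) by (rewrite Cplus_comm; apply one_ik_neq_0).
      unfold origin, of_half. rewrite !Cplus_0_l. rewrite Cmod_div, Cmod_mult, Hp by exact Hn.
      replace (Cmod (Ci * k - 1)) with (Cmod (Ci * k + 1)).
      rewrite Rmult_1_l. right. field. now apply Rgt_not_eq, Cmod_gt_0.
      unfold Cmod. f_equal. simpl. ring. }
    lra.
  - set (al := mu ^ S j). assert (Hal : mu <= al).
    { unfold al. simpl. assert (H1 := pow_mu_ge_1 j). nra. }
    rewrite pow_inv. fold al.
    apply H2_bound_le with (2 * (B1 / al * N) + 2 * (T * (cut_const / al * N))).
    { replace (2 * (B1 / al * N) + 2 * (T * (cut_const / al * N))) with ((2 * B1 + 2 * (T * cut_const)) * N * / al) by (field; lra).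
      assert (0 < / al) by (apply Rinv_0_lt_compat; lra).
      assert (0 <= B0 * N * / al). { apply Rmult_le_pos. now apply Rmult_le_pos. lra. } nra. }
    assert (Hs1 : selfmap (conj_affine al 0)) by (apply conj_affine_selfmap; auto; lra).
    assert (Hia : 0 < / al <= 1). { split. apply Rinv_0_lt_compat; lra. rewrite <- Rinv_1. apply Rinv_le_contravar; lra. }
    assert (Hs2 : selfmap (conj_affine 1 (x * (1 - / al)))) by (apply conj_affine_selfmap; auto; [lra|nra]).
    apply H2_bound_ext with (fun z => (f (conj_affine al 0 (conj_affine 1 (x * (1 - / al)) z)) - f (conj_affine al 0 (conj_affine 1 x z)))
       + (fun z => (1 - cut (conj_affine al 0 z)) * f (conj_affine al 0 z)) (conj_affine 1 x z))%C.
    { intros z Hz. unfold stable_part. rewrite translate_phi_n, phi_n_factor by auto. fold al. ring. }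
    assert (H1cut : hol (fun z => (1 - cut z) * f z)%C).
    { apply hol_mult; auto. apply hol_minus. apply hol_const. apply hol_cut. }
    apply H2_bound_plus.
    + apply hol_minus. apply (hol_comp f (fun z => conj_affine al 0 (conj_affine 1 (x * (1 - / al)) z))); auto. now apply selfmap_comp.
      apply (hol_comp f (fun z => conj_affine al 0 (conj_affine 1 x z))); auto. apply selfmap_comp; auto. apply translate_selfmap.
    + apply (hol_comp (fun z => (1 - cut z) * f z)%C (fun z => conj_affine al 0 (conj_affine 1 x z))); auto. apply selfmap_comp; auto. apply translate_selfmap.
    + apply translation_difference_bound; auto.
    + apply (translate_H2_bound x (fun z => (1 - cut (conj_affine al 0 z)) * f (conj_affine al 0 z))%C); auto; try lra.
      apply (hol_comp (fun z => (1 - cut z) * f z)%C (conj_affine al 0)); auto.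
      apply attract_bound; auto. lra.
Qed.

(** The term of index [j] of the backward orbit of [cut * f], before the
    translation by [x]; the exponent is [S j] because the equation is solved for
    the previous time. *)
Definition unstable_part (f : C -> C) (j : nat) (z : C) : C :=
  (cut (conj_affine (/ mu ^ S j) 0 z) * f (conj_affine (/ mu ^ S j) 0 z))%C.

Lemma inv_pow_mu j : 0 < / mu ^ j <= 1.
Proof.
  assert (H := pow_mu_ge_1 j). split. apply Rinv_0_lt_compat; lra. rewrite <- Rinv_1. apply Rinv_le_contravar; lra.
Qed.

Lemma unstable_part_hol f j : hol f -> hol (unstable_part f j).
Proof.
  intros Hf. apply (hol_comp (fun z => cut z * f z)%C (conj_affine (/ mu ^ S j) 0)).
  apply hol_mult; auto. apply hol_cut. apply conj_affine_selfmap; auto. apply inv_pow_mu. lra.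
Qed.

Lemma unstable_part_bound f N j : hol f -> H2_bound f N ->
  H2_bound (unstable_part f j) (cut_const * N * (/ mu) ^ j).
Proof.
  intros Hf HN. assert (HN0 := H2_bound_pos f N Hf HN). assert (Hc := cut_const_pos).
  eapply H2_bound_le. 2: { apply repel_bound with (N := N); auto. apply inv_pow_mu. }
  rewrite pow_inv. assert (H1 := inv_pow_mu j).
  replace (/ mu ^ S j) with (/ mu * / mu ^ j). 2: { simpl. rewrite Rinv_mult. ring. }
  assert (/ mu <= 1) by (rewrite <- Rinv_1; apply Rinv_le_contravar; lra).
  assert (0 <= cut_const * N) by now apply Rmult_le_pos.
  replace (cut_const * (/ mu * / mu ^ j) * N) with (cut_const * N * (/ mu * / mu ^ j)) by ring.
  apply Rmult_le_compat_l; auto. nra.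
Qed.

(** Each z_n is split into its stable and unstable parts; the stable parts of
    the past are pushed forward, the unstable parts of the future are pulled
    back. Both sums are geometric in the norm, with ratio s = mu^(-1/2). *)
Theorem bounded_solution : exists K, 0 <= K /\ forall (N : R) (z : nat -> C -> C),
  0 <= N -> (forall n, hol (z n)) -> (forall n, H2_bound (z n) N) ->
  exists Y : nat -> C -> C, (forall n, hol (Y n)) /\ (forall n, H2_bound (Y n) (K * N)) /\
    forall n w, Cmod w < 1 -> Y (S n) w = (Y n (phi_n 1 w) + z n w)%C.
Proof.
  destruct stable_part_bound as [B [HB0 HB]].
  assert (Hc := cut_const_pos).
  assert (Him : 0 < / mu < 1).
  { split. apply Rinv_0_lt_compat; lra. rewrite <- Rinv_1. apply Rinv_lt_contravar; lra. }
  pose (s := sqrt (/ mu)).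
  assert (Hs : 0 < s < 1).
  { split. apply sqrt_lt_R0; lra. rewrite <- sqrt_1. apply sqrt_lt_1_alt; lra. }
  assert (Hss : s ^ 2 = / mu) by (apply pow2_sqrt; lra).
  assert (Hs1 : 0 < (1 - s) ^ 2) by (apply pow_lt; lra).
  pose (T := 2 * (2 + x) ^ 2).
  assert (HT : 0 <= T) by (unfold T; assert (H := pow2_ge_0 (2 + x)); lra).
  exists (2 * (B / (1 - s) ^ 2) + 2 * (T * (cut_const / (1 - s) ^ 2))). split.
  { assert (0 <= B / (1 - s) ^ 2) by now apply Rdiv_le_0_compat.
    assert (0 <= T * (cut_const / (1 - s) ^ 2)) by (apply Rmult_le_pos; auto; now apply Rdiv_le_0_compat). lra. }
  intros N z HN Hz HzN.
  pose (P := fun n => csum (fun j => stable_part (z (n - S j)%nat) j) n).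
  pose (U := fun n => csum_inf (fun j => unstable_part (z (n + j)%nat) j)).
  assert (HP : forall n, hol (P n) /\ H2_bound (P n) (B * N / (1 - s) ^ 2)).
  { intros n. split. apply csum_hol. intros j. now apply stable_part_hol.
    apply csum_H2_bound; auto. now apply Rmult_le_pos. intros; now apply stable_part_hol.
    intros j. rewrite Hss. auto. }
  assert (HU : forall n, hol (U n) /\ H2_bound (U n) (cut_const * N / (1 - s) ^ 2) /\
     forall w, Cmod w < 1 -> U n w = (unstable_part (z (n + 0)%nat) 0 w +
        csum_inf (fun j => unstable_part (z (n + S j)%nat) (S j)) w)%C).
  { intros n. apply (csum_inf_hol_H2_bound (fun j => unstable_part (z (n + j)%nat) j)); auto. now apply Rmult_le_pos. intros; now apply unstable_part_hol.
    intros j. rewrite Hss. now apply unstable_part_bound. }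
  assert (Htr := translate_selfmap).
  exists (fun n w => P n w - U n (conj_affine 1 x w))%C. split; [|split].
  - intros n. apply hol_minus. apply HP. apply hol_comp; auto. apply HU.
  - intros n. apply H2_bound_le with (2 * (B * N / (1 - s) ^ 2) + 2 * (T * (cut_const * N / (1 - s) ^ 2))).
    right. field. lra.
    apply H2_bound_minus. apply HP. apply hol_comp; auto. apply HU. apply HP.
    apply translate_H2_bound. lra. apply HU. apply HU.
  - intros n w Hw. assert (Htw := selfmap_lt _ w Htr Hw).
    set (v := conj_affine 1 x w) in *.
    assert (Hphi := selfmap_lt _ w (phi_n_selfmap 1) Hw).
    assert (EP : P (S n) w = (stable_part (z n) 0 w + P n (phi_n 1 w))%C).
    { unfold P. simpl csum. rewrite Nat.sub_0_r. f_equal.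
      apply csum_ext_at. intros j. unfold stable_part. now rewrite phi_n_S. }
    assert (Etv : conj_affine 1 x (phi_n 1 w) = conj_affine mu 0 v).
    { rewrite translate_phi_n by auto. now rewrite pow_1. }
    assert (Hmv : Cmod (conj_affine mu 0 v) < 1).
    { apply selfmap_lt; auto. apply conj_affine_selfmap; auto; lra. }
    assert (Eback : forall j, conj_affine (/ mu ^ S j) 0 (conj_affine mu 0 v) = conj_affine (/ mu ^ j) 0 v).
    { intros j. rewrite conj_affine_comp; auto; try lra. assert (H := pow_mu_ge_1 j). f_equal; simpl; field; lra. }
    assert (EU : U n (conj_affine 1 x (phi_n 1 w)) = (cut v * z n v + U (S n) v)%C).
    { destruct (HU n) as [_ [_ ->]]. 2: now rewrite Etv. rewrite Etv. f_equal.
      - unfold unstable_part. rewrite Eback, Nat.add_0_r. simpl. rewrite Rinv_1.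
        now rewrite conj_affine_id.
      - unfold U. apply csum_inf_ext_at. intros j. unfold unstable_part. rewrite Eback.
        now rewrite Nat.add_succ_r. }
    rewrite EP, EU. unfold stable_part.
    rewrite phi_n_0 by auto. fold v. ring.
Qed.
End Core.

Theorem shadowing_of_affine_model (phi : sphere -> sphere) (p : C) (k mu x : R) :
  Cmod p = 1 -> 1 < mu -> 0 <= x ->
  (forall z, Cmod z < 1 -> phi (Some z) = Some (conj_affine p k mu ((mu - 1) * x) z)) ->
  positive_shadowing in_H2 H2_dist (composition_operator phi).
Proof.
  intros Hp Hmu Hx Hphi eps Heps.
  destruct (bounded_solution p k mu x Hp Hmu Hx) as [K [HK0 HK]].
  set (tau := phi_n p k mu x 1) in *.
  assert (Htau : selfmap tau) by (apply phi_n_selfmap; auto).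
  assert (HT : forall f z, Cmod z < 1 -> composition_operator phi f z = f (tau z)).
  { intros f z Hz. unfold composition_operator. rewrite Hphi by auto.
    unfold tau, phi_n. now rewrite pow_1. }
  pose (d := eps / sqrt (K + 1)).
  assert (HKs : 0 < sqrt (K + 1)) by (apply sqrt_lt_R0; lra).
  assert (Hd : 0 < d) by now apply Rdiv_lt_0_compat.
  exists d. split; auto. intros x0 [HX HO].
  pose (zeta := fun n z => (x0 (S n) z - x0 n (tau z))%C).
  assert (HXh : forall n, hol (x0 n)) by (intros n; apply in_H2_iff, HX).
  assert (Hz : forall n, hol (zeta n)) by (intros n; apply hol_minus; auto; now apply hol_comp).
  assert (HzN : forall n, H2_bound (zeta n) (d ^ 2)).
  { intros n. apply H2_bound_sub_sym.
    apply H2_bound_ext with (fun z => composition_operator phi (x0 n) z - x0 (S n) z)%C.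
    { intros z Hz'. now rewrite HT. }
    apply H2_norm_le. lra. exact (HO n). }
  destruct (HK (d ^ 2) zeta (pow2_ge_0 d) Hz HzN) as [Y [HY1 [HY2 HY3]]].
  exists (fun z => x0 O z - Y O z)%C. split.
  - apply in_H2_iff. split. now apply hol_minus.
    destruct (proj1 (in_H2_iff _) (HX O)) as [_ [N0 HN0]].
    exists (2 * N0 + 2 * (K * d ^ 2)). apply H2_bound_minus; auto.
  - intros n.
    assert (E : forall n z, Cmod z < 1 ->
      Nat.iter n (composition_operator phi) (fun z => x0 O z - Y O z)%C z = (x0 n z - Y n z)%C).
    { clear n. induction n; intros z Hz'. reflexivity.
      simpl Nat.iter. rewrite HT by auto. rewrite IHn by now apply selfmap_lt.
      rewrite HY3 by auto. unfold zeta. ring. }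
    apply H2_norm_le. lra.
    apply H2_bound_ext with (fun z => (- RtoC 1) * Y n z)%C.
    { intros z Hz'. rewrite E by auto. ring. }
    apply H2_bound_le with (1 ^ 2 * (K * d ^ 2)).
    + unfold d, Rdiv. rewrite Rpow_mult_distr, pow_inv, pow2_sqrt by lra.
      assert (K * / (K + 1) <= 1). { apply Rmult_le_reg_r with (K + 1). lra. rewrite Rmult_assoc, Rinv_l; lra. }
      assert (0 <= eps ^ 2) by apply pow2_ge_0.
      replace (1 ^ 2 * (K * (eps ^ 2 * / (K + 1)))) with (eps ^ 2 * (K * / (K + 1))) by ring. nra.
    + apply H2_bound_mult; auto. apply hol_const. intros. rewrite Cmod_opp, Cmod_1. lra.
Qed.

(** * Fixed points of linear fractional maps *)

Lemma Csqrt_exists (z : C) : exists s : C, (s * s)%C = z.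
Proof.
  destruct z as [x y]. set (m := Cmod (x, y)).
  assert (Hm : m * m = x * x + y * y).
  { unfold m. assert (H := Cmod2_alt (x, y)). simpl in H. nra. }
  assert (Hm0 : 0 <= m) by apply Cmod_ge_0.
  assert (H1 : 0 <= (m + x) / 2) by nra. assert (H2 : 0 <= (m - x) / 2) by nra.
  set (u := sqrt ((m + x) / 2)). set (v := sqrt ((m - x) / 2)).
  assert (Hu : u * u = (m + x) / 2) by (apply sqrt_sqrt; auto).
  assert (Hv : v * v = (m - x) / 2) by (apply sqrt_sqrt; auto).
  assert (Huv : 2 * (u * v) = Rabs y).
  { unfold u, v. rewrite <- sqrt_mult_alt by auto.
    replace ((m + x) / 2 * ((m - x) / 2)) with ((y / 2) * (y / 2)) by nra.
    replace (sqrt (y / 2 * (y / 2))) with (Rabs (y / 2)) by (symmetry; apply sqrt_Rsqr_abs).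
    unfold Rdiv. rewrite Rabs_mult, (Rabs_pos_eq (/ 2)) by lra. field. }
  destruct (Rle_dec 0 y) as [Hy|Hy].
  - exists (u, v). rewrite Rabs_pos_eq in Huv by lra. unfold Cmult; simpl. f_equal; lra.
  - exists (u, - v). rewrite Rabs_left in Huv by lra. unfold Cmult; simpl. f_equal; nra.
Qed.

(** A disk mapped into the unit disk by al z + be gives |al| + |be| <= 1, so be
    / (1 - al) is in the closed unit disk. *)
Lemma affine_fixed_point (al be : C) :
  (forall z, Cmod z < 1 -> Cmod (al * z + be) < 1) -> exists f, Cmod f <= 1 /\ (al * f + be)%C = f.
Proof.
  intros H. assert (Ha := Cmod_ge_0 al). assert (Hb := Cmod_ge_0 be).
  assert (Hr : forall r, 0 <= r < 1 -> Cmod al * r + Cmod be < 1).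
  { intros r Hr.
    destruct (Ceq_dec al 0) as [->|Ea].
    { rewrite Cmod_0. assert (HH := H (RtoC 0)). rewrite Cmod_0 in HH. specialize (HH ltac:(lra)).
      replace (0 * 0 + be)%C with be in HH by ring. lra. }
    destruct (Ceq_dec be 0) as [->|Eb].
    { rewrite Cmod_0. assert (HH := H (RtoC r)). rewrite Cmod_R, Rabs_pos_eq in HH by lra. specialize (HH ltac:(lra)).
      replace (al * r + 0)%C with (al * r)%C in HH by ring. rewrite Cmod_mult, Cmod_R, Rabs_pos_eq in HH; lra. }
    assert (Ha' : 0 < Cmod al) by now apply Cmod_gt_0. assert (Hb' : 0 < Cmod be) by now apply Cmod_gt_0.
    assert (Hbn : RtoC (Cmod be) <> 0) by (intros E; apply RtoC_inj in E; lra).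
    (* the point of modulus [r] that [al] maps to the direction of [be] *)
    pose (z := (RtoC (r * Cmod al / Cmod be) * be / al)%C).
    assert (Hz : Cmod z = r).
    { unfold z. rewrite Cmod_div, Cmod_mult, Cmod_R, Rabs_pos_eq; auto. field; lra.
      apply Rdiv_le_0_compat; auto. nra. }
    assert (HH := H z ltac:(lra)).
    replace (al * z + be)%C with (RtoC (r * Cmod al / Cmod be + 1) * be)%C in HH.
    2: { unfold z. rewrite RtoC_plus. field. auto. }
    rewrite Cmod_mult, Cmod_R, Rabs_pos_eq in HH.
    replace ((r * Cmod al / Cmod be + 1) * Cmod be) with (Cmod al * r + Cmod be) in HH by (field; lra). exact HH.
    assert (0 <= r * Cmod al / Cmod be) by (apply Rdiv_le_0_compat; nra). lra. }
  assert (H1 : Cmod al + Cmod be <= 1).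
  { apply Rnot_lt_le. intros Hlt.
    assert (Hbl : Cmod be < 1) by (generalize (Hr 0); lra).
    assert (Hal : 0 < Cmod al) by lra.
    specialize (Hr ((1 - Cmod be) / Cmod al)).
    replace (Cmod al * ((1 - Cmod be) / Cmod al)) with (1 - Cmod be) in Hr by (field; lra).
    assert (0 <= (1 - Cmod be) / Cmod al < 1); [|lra]. split. apply Rdiv_le_0_compat; lra.
    apply Rmult_lt_reg_r with (Cmod al); auto. unfold Rdiv. rewrite Rmult_assoc, Rinv_l; lra. }
  destruct (Ceq_dec al 1) as [->|Ea].
  - rewrite Cmod_1 in H1. exists (RtoC 0). rewrite Cmod_0. split. lra.
    assert (E : be = 0) by (apply Cmod_eq_0; lra). rewrite E. ring.
  - assert (En : (1 - al)%C <> 0) by (intros E; apply Ea; replace al with (1 - (1 - al))%C by ring; rewrite E; ring).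
    exists (be / (1 - al))%C. split. 2: field; auto.
    rewrite Cmod_div by auto. assert (Hd : 0 < Cmod (1 - al)) by now apply Cmod_gt_0.
    apply Rmult_le_reg_r with (Cmod (1 - al)); auto. unfold Rdiv. rewrite Rmult_assoc, Rinv_l by lra.
    generalize (Cmod_triangle_sub 1 al). rewrite Cmod_1. lra.
Qed.

(** A half plane admits only affine self-maps of the form m w + be with m >= 0
    and Re be >= 0: let w tend to infinity along the boundary, to infinity in
    the interior, and to 0. *)
Lemma half_plane_affine (al be : C) : (forall w, 0 < Re w -> 0 < Re (al * w + be)%C) ->
  Im al = 0 /\ 0 <= Re al /\ 0 <= Re be.
Proof.
  intros H. destruct al as [a1 a2], be as [b1 b2]. simpl in *.
  assert (H' : forall u v, 0 < u -> 0 < a1 * u - a2 * v + b1) by (intros u v Hu; apply (H (u, v)); simpl; auto).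
  assert (E2 : a2 = 0).
  { destruct (Req_dec a2 0) as [|Hn]; auto. specialize (H' 1 ((a1 + b1) / a2) ltac:(lra)).
    replace (a1 * 1 - a2 * ((a1 + b1) / a2) + b1) with 0 in H' by (field; auto). lra. }
  subst a2. split; auto.
  assert (E1 : 0 <= a1).
  { apply Rnot_lt_le. intros Hl. assert (Hq : 0 < (Rabs b1 + 1) / - a1).
    { apply Rdiv_lt_0_compat; generalize (Rabs_pos b1); lra. }
    specialize (H' _ 0 Hq). replace (a1 * ((Rabs b1 + 1) / - a1) - 0 * 0 + b1) with (- (Rabs b1 + 1) + b1) in H' by (field; lra).
    generalize (Rle_abs b1). lra. }
  split; auto. apply Rnot_lt_le. intros Hl.
  assert (Hq : 0 < - b1 / (2 * (a1 + 1))) by (apply Rdiv_lt_0_compat; lra).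
  specialize (H' _ 0 Hq).
  assert (Hle : a1 * (- b1 / (2 * (a1 + 1))) <= - b1 / 2).
  { replace (- b1 / 2) with ((a1 + 1) * (- b1 / (2 * (a1 + 1)))) by (field; lra). apply Rmult_le_compat_r; lra. }
  lra.
Qed.

(** The automorphism of the disk that sends [z2], a point outside of the closed
    disk, to infinity. *)
Lemma reflection_into_disk (u z2 : C) : Cmod u <= 1 -> 1 < Cmod z2 ->
  Cmod ((Cconj z2 * u - 1) / (u - z2)) <= 1 /\
  (Cmod u < 1 -> Cmod ((Cconj z2 * u - 1) / (u - z2)) < 1).
Proof.
  intros Hu Hz.
  assert (I : Cmod (u - z2) ^ 2 - Cmod (Cconj z2 * u - 1) ^ 2 = (1 - Cmod u ^ 2) * (Cmod z2 ^ 2 - 1)).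
  { rewrite !Cmod2_alt. destruct u, z2. simpl. ring. }
  assert (Hu0 := Cmod_ge_0 u). assert (A := Cmod_ge_0 (Cconj z2 * u - 1)).
  assert (Nu : (u - z2)%C <> 0) by (intros E; apply Ceq_minus in E; rewrite E in Hu; lra).
  rewrite Cmod_div by auto. assert (HD : 0 < Cmod (u - z2)) by now apply Cmod_gt_0.
  set (X := Cmod (Cconj z2 * u - 1)) in *. set (Y := Cmod (u - z2)) in *.
  split.
  - apply Rmult_le_reg_r with Y; auto. unfold Rdiv. rewrite Rmult_assoc, Rinv_l by lra.
    rewrite Rmult_1_r, Rmult_1_l. apply Rsqr_incr_0_var; try lra. unfold Rsqr.
    assert (0 <= (1 - Cmod u ^ 2) * (Cmod z2 ^ 2 - 1)) by (apply Rmult_le_pos; nra). nra.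
  - intros Hu1. apply Rmult_lt_reg_r with Y; auto. unfold Rdiv. rewrite Rmult_assoc, Rinv_l by lra.
    rewrite Rmult_1_r, Rmult_1_l. apply Rsqr_incrst_0; try lra. unfold Rsqr.
    assert (0 < (1 - Cmod u ^ 2) * (Cmod z2 ^ 2 - 1)) by (apply Rmult_lt_0_compat; nra). nra.
Qed.

Section Mobius.
Variables (a b c d : C) (phi : sphere -> sphere).
Hypothesis Hdet : Cminus (Cmult a d) (Cmult b c) <> RtoC 0.
Hypothesis Hphi : forall s, phi s = mobius a b c d s.
Hypothesis Hdisk : maps_disk_into_disk phi.

Lemma phi_Some z : (c * z + d)%C <> 0 -> phi (Some z) = Some ((a * z + b) / (c * z + d))%C.
Proof.
  intros H. rewrite Hphi. simpl. destruct (Ceq_dec (c * z + d)%C 0) as [E|E]; auto. now elim H.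
Qed.

Lemma phi_Some_inv z w : phi (Some z) = Some w -> (c * z + d)%C <> 0 /\ w = ((a * z + b) / (c * z + d))%C.
Proof.
  rewrite Hphi. simpl. destruct (Ceq_dec (c * z + d)%C 0) as [E|E]; intros H; inversion H. auto.
Qed.

Lemma fixed_Some z : phi (Some z) = Some z <-> (c * z + d)%C <> 0 /\ (a * z + b = z * (c * z + d))%C.
Proof.
  split.
  - intros H. apply phi_Some_inv in H. destruct H as [H1 H2]. split; auto. rewrite H2 at 2. field. auto.
  - intros [H1 H2]. rewrite phi_Some, H2 by auto. f_equal. field. auto.
Qed.

Lemma fixed_None : phi None = None <-> c = 0.
Proof.
  rewrite Hphi. simpl. destruct (Ceq_dec c 0) as [E|E]; split; auto; try discriminate. now intros.
Qed.

Definition tau (z : C) : C := ((a * z + b) / (c * z + d))%C.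

Lemma disk_den z : Cmod z < 1 -> (c * z + d)%C <> 0.
Proof.
  intros Hz. assert (H := Hdisk (Some z) Hz). rewrite Hphi in H. simpl in H.
  destruct (Ceq_dec (c * z + d)%C 0) as [E|E]; auto.
Qed.

Lemma phi_tau z : Cmod z < 1 -> phi (Some z) = Some (tau z).
Proof. intros. apply phi_Some. now apply disk_den. Qed.

Lemma tau_lt z : Cmod z < 1 -> Cmod (tau z) < 1.
Proof. intros Hz. assert (H := Hdisk (Some z) Hz). rewrite phi_tau in H; auto. Qed.

Lemma tau_hol : hol tau.
Proof.
  intros z Hz. apply (cdiff_div (fun z => a * z + b)%C (fun z => c * z + d)%C). now apply disk_den.
  apply cdiff_plus. apply cdiff_mult. apply cdiff_const. apply cdiff_id. apply cdiff_const.
  apply cdiff_plus. apply cdiff_mult. apply cdiff_const. apply cdiff_id. apply cdiff_const.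
Qed.

Lemma fixed_det f : (a * f + b = f * (c * f + d))%C -> (a * d - b * c = (a - f * c) * (c * f + d))%C.
Proof.
  intros H. replace b with (f * (c * f + d) - a * f)%C by (rewrite <- H; ring). ring.
Qed.

Lemma fixed_neq f : (a * f + b = f * (c * f + d))%C -> (a - f * c)%C <> 0 /\ (c * f + d)%C <> 0.
Proof.
  intros H. assert (E := fixed_det f H). split; intros E'; apply Hdet; rewrite E, E'; ring.
Qed.

Lemma tau_minus_fixed f z : (a * f + b = f * (c * f + d))%C -> (c * z + d)%C <> 0 ->
  (tau z - f)%C = ((a - f * c) * (z - f) / (c * z + d))%C.
Proof.
  intros H Hz. unfold tau.
  replace b with (f * (c * f + d) - a * f)%C by (rewrite <- H; ring). field. auto.
Qed.

(** The slope and the intercept of the map in the coordinate (f + z) / (f - z),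
    for a fixed point [f]. *)
Definition multiplier (f : C) : C := ((c * f + d) / (a - f * c))%C.
Definition offset (f : C) : C := ((d - a) / (a - f * c))%C.

(** A linear fractional map that fixes [p] is affine in every coordinate that
    sends [p] to infinity. *)
Lemma to_half_tau p z : Cmod p = 1 -> phi (Some p) = Some p -> Cmod z < 1 ->
  to_half p 0 (tau z) = (multiplier p * to_half p 0 z + offset p)%C.
Proof.
  intros Hp Hfix Hz. apply fixed_Some in Hfix. destruct Hfix as [Hp1 Hp2].
  destruct (fixed_neq p Hp2) as [N1 _].
  assert (Nz := disk_den z Hz). assert (Npz := p_minus_neq_0 p Hp z Hz).
  assert (E := tau_minus_fixed p z Hp2 Nz).
  unfold to_half. replace (p + tau z)%C with (RtoC 2 * p + (tau z - p))%C by ring.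
  replace (p - tau z)%C with (- (tau z - p))%C by ring. rewrite E.
  unfold multiplier, offset.
  assert (Nzp : (z - p)%C <> 0).
  { intros E'. apply Npz. replace (p - z)%C with (- (z - p))%C by ring. rewrite E'. ring. }
  field. repeat split; auto.
Qed.

Lemma half_plane_model p : Cmod p = 1 -> phi (Some p) = Some p ->
  multiplier p = RtoC (Re (multiplier p)) /\ 0 < Re (multiplier p) /\ 0 <= Re (offset p).
Proof.
  intros Hp Hfix.
  assert (H : forall w, 0 < Re w -> 0 < Re (multiplier p * w + offset p)%C).
  { intros w Hw. assert (Hz := of_half_lt p 0 Hp w Hw).
    rewrite <- (to_half_of_half p 0 Hp w Hw) at 1. rewrite <- to_half_tau by auto.
    apply Re_to_half_pos; auto. now apply tau_lt. }
  destruct (half_plane_affine _ _ H) as [H1 [H2 H3]].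
  assert (E : multiplier p = RtoC (Re (multiplier p))).
  { destruct (multiplier p) as [m1 m2]. simpl in *. now subst m2. }
  repeat split; auto. destruct H2 as [H2|H2]; auto. exfalso.
  apply fixed_Some in Hfix. destruct Hfix as [Hp1 Hp2]. destruct (fixed_neq p Hp2) as [N1 N2].
  apply N2. replace (c * p + d)%C with (multiplier p * (a - p * c))%C by (unfold multiplier; field; auto).
  rewrite E, <- H2. ring.
Qed.

Lemma identity_case : c = 0 -> a = d -> b = 0 -> forall s, phi s = s.
Proof.
  intros E1 E2 E3 [z|].
  - apply fixed_Some. rewrite E1, E2, E3. split; [|ring]. intros E. apply Hdet.
    rewrite E1, E2, E3. replace d with (0 * z + d)%C by ring. rewrite E. ring.
  - now apply fixed_None.
Qed.

Lemma second_fixed_point p z : phi (Some p) = Some p -> phi (Some z) = Some z -> z <> p ->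
  (c * (z + p) = a - d)%C.
Proof.
  intros Hp Hz Hne. apply fixed_Some in Hp. apply fixed_Some in Hz. destruct Hp as [_ Hp]. destruct Hz as [_ Hz].
  assert (N := Cminus_eq_contra z p Hne).
  assert (E : ((z - p) * (c * (z + p) - (a - d)))%C = 0).
  { replace ((z - p) * (c * (z + p) - (a - d)))%C with ((z * (c * z + d) - a * z) - (p * (c * p + d) - a * p))%C by ring.
    rewrite <- Hp, <- Hz. ring. }
  replace (c * (z + p))%C with (a - d + / (z - p) * ((z - p) * (c * (z + p) - (a - d))))%C by (field; auto).
  rewrite E. ring.
Qed.

(** In the half-plane coordinate of [p], the second fixed point becomes the
    fixed point w0 of w |-> m w + offset. It is in the closed left half plane,
    on the imaginary axis only if [q] is on the circle. *)
Lemma repelling_point p q : Cmod p = 1 -> phi (Some p) = Some p -> phi q = q -> q <> Some p ->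
  (on_unit_circle q \/ off_closed_disk q) -> (exists s, phi s <> s) ->
  Re (multiplier p) <> 1 /\
  exists w0, offset p = ((1 - multiplier p) * w0)%C /\ Re w0 <= 0 /\
    (Re w0 = 0 -> exists z, q = Some z /\ Cmod z = 1).
Proof.
  intros Hp Hfix Hq Hqp HQ [s0 Hs0].
  destruct (half_plane_model p Hp Hfix) as [EM [_ _]].
  assert (HM1 : multiplier p <> 1 -> Re (multiplier p) <> 1).
  { intros H E. apply H. rewrite EM, E. reflexivity. }
  assert (Hfix' := Hfix). apply fixed_Some in Hfix'. destruct Hfix' as [Hp1 Hp2].
  destruct (fixed_neq p Hp2) as [N1 N2].
  assert (E1 : (1 - multiplier p)%C = ((a - d - RtoC 2 * (c * p)) / (a - p * c))%C).
  { unfold multiplier. field. auto. }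
  destruct q as [z|].
  - assert (Hzp : z <> p) by (intros E; apply Hqp; now rewrite E).
    assert (Ez := second_fixed_point p z Hfix Hq Hzp).
    assert (Npz : (p - z)%C <> 0) by (apply Cminus_eq_contra; auto).
    rewrite <- Ez in E1. replace (c * (z + p) - RtoC 2 * (c * p))%C with (- (c * (p - z)))%C in E1 by ring.
    assert (Nc : c <> 0).
    { intros Ec. apply Hs0. assert (Ead : a = d).
      { apply Ceq_minus. rewrite <- Ez, Ec. ring. }
      apply identity_case; auto. replace b with (a * p + b - a * p)%C by ring. rewrite Hp2, Ead, Ec. ring. }
    assert (Nm : multiplier p <> 1).
    { intros E. assert (E0 : (1 - multiplier p)%C = 0) by (rewrite E; ring).
      rewrite E1 in E0. apply (Cmult_neq_0 c (p - z) Nc Npz).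
      replace (c * (p - z))%C with (- (- (c * (p - z)) / (a - p * c)) * (a - p * c))%C by (field; auto).
      rewrite E0. ring. }
    split; auto. exists (to_half p 0 z).
    assert (ER := Re_to_half p 0 Hp z Npz).
    assert (HD : 0 < Cmod (p - z) ^ 2) by (apply pow_lt; now apply Cmod_gt_0).
    assert (Hz1 : 1 <= Cmod z) by (destruct HQ as [HQ|HQ]; simpl in HQ; lra).
    split; [|split].
    + rewrite E1. unfold offset, to_half. replace (d - a)%C with (- (a - d))%C by ring. rewrite <- Ez.
      field. auto.
    + rewrite ER. apply Rmult_le_reg_r with (Cmod (p - z) ^ 2); auto. unfold Rdiv. rewrite Rmult_assoc, Rinv_l by (apply Rgt_not_eq; exact HD). nra.
    + intros E0. exists z. split; auto. rewrite ER in E0.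
      assert (E2 : 1 - Cmod z ^ 2 = 0).
      { replace (1 - Cmod z ^ 2) with ((1 - Cmod z ^ 2) / Cmod (p - z) ^ 2 * Cmod (p - z) ^ 2) by (field; apply Rgt_not_eq, Cmod_gt_0; exact Npz).
        rewrite E0. ring. } nra.
  - apply fixed_None in Hq.
    assert (Nm : multiplier p <> 1).
    { intros E. assert (E0 : (1 - multiplier p)%C = 0) by (rewrite E; ring).
      rewrite E1, Hq in E0. apply Hs0. assert (Ead : (a - d)%C = 0).
      { replace (a - d)%C with ((a - d - RtoC 2 * (0 * p)) / (a - p * 0) * (a - p * 0))%C.
        rewrite E0. ring. field. intros Ea. apply N1. rewrite Hq, Ea. ring. }
      assert (Ead' : a = d) by now apply Ceq_minus.
      apply identity_case; auto. replace b with (a * p + b - a * p)%C by ring. rewrite Hp2, Hq, Ead'. ring. }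
    split; auto. exists (- RtoC 1)%C. split; [|split].
    + assert (Na : a <> 0) by (intros Ea; apply N1; rewrite Hq, Ea; ring).
      rewrite E1. unfold offset. rewrite Hq. field. auto.
    + simpl. lra.
    + simpl. intros; lra.
Qed.

(** The imaginary part of w0 is absorbed in the parameter of the half-plane
    coordinate. *)
Lemma attracting_case p q : Cmod p = 1 -> phi (Some p) = Some p -> phi q = q -> q <> Some p ->
  (on_unit_circle q \/ off_closed_disk q) -> (exists s, phi s <> s) -> 1 < Re (multiplier p) ->
  positive_shadowing in_H2 H2_dist (composition_operator phi).
Proof.
  intros Hp Hfix Hq Hqp HQ Hs Hm.
  destruct (repelling_point p q Hp Hfix Hq Hqp HQ Hs) as [_ [w0 [Ew [Hw _]]]].
  destruct (half_plane_model p Hp Hfix) as [EM _].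
  set (mu := Re (multiplier p)) in *.
  apply shadowing_of_affine_model with (p := p) (k := Im w0) (mu := mu) (x := - Re w0); auto. lra.
  intros z Hz. rewrite phi_tau by auto. f_equal.
  rewrite <- (of_half_to_half p (Im w0) Hp (tau z)) by now apply tau_lt.
  unfold conj_affine. f_equal.
  assert (E := to_half_tau p z Hp Hfix Hz).
  assert (Es : forall y, to_half p (Im w0) y = (to_half p 0 y - Ci * RtoC (Im w0))%C).
  { intros y. unfold to_half. ring. }
  rewrite !Es, E, Ew, EM.
  rewrite (C_split w0) at 1. rewrite !RtoC_mult, RtoC_minus, RtoC_opp. ring.
Qed.

(** If the multiplier at [p] is less than 1, then [p] repels. As the half plane
    is mapped into itself, w0 cannot be in the open left half plane, so [q] is
    on the circle as well; its multiplier is the inverse one, and the roles of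
    [p] and [q] are exchanged. *)
Lemma hyperbolic_shadowing p q : Cmod p = 1 -> phi (Some p) = Some p -> phi q = q -> q <> Some p ->
  (on_unit_circle q \/ off_closed_disk q) -> (exists s, phi s <> s) ->
  positive_shadowing in_H2 H2_dist (composition_operator phi).
Proof.
  intros Hp Hfix Hq Hqp HQ Hs.
  destruct (repelling_point p q Hp Hfix Hq Hqp HQ Hs) as [Hm1 [w0 [Ew [Hw Hw0]]]].
  destruct (half_plane_model p Hp Hfix) as [EM [HM0 HB0]].
  destruct (Rtotal_order (Re (multiplier p)) 1) as [Hlt|[E|Hgt]].
  - assert (HR : Re (offset p) = (1 - Re (multiplier p)) * Re w0).
    { rewrite Ew, EM. destruct w0; simpl. ring. }
    assert (Hz0 : Re w0 = 0) by nra.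
    destruct (Hw0 Hz0) as [z [-> Hz]].
    assert (Hzp : z <> p) by (intros E; apply Hqp; now rewrite E).
    assert (Ez := second_fixed_point p z Hfix Hq Hzp).
    apply (attracting_case z (Some p)); auto.
    + assert (Em : (multiplier z * multiplier p)%C = 1).
      { unfold multiplier. apply fixed_Some in Hfix. destruct Hfix as [Hp1 Hp2].
        destruct (fixed_neq p Hp2) as [N1 N2].
        replace (c * z + d)%C with (a - p * c)%C.
        2: { replace a with (a - d + d)%C by ring. rewrite <- Ez. ring. }
        replace (a - z * c)%C with (c * p + d)%C.
        2: { replace a with (a - d + d)%C by ring. rewrite <- Ez. ring. }
        field. auto. }
      destruct (half_plane_model z Hz Hq) as [EZ [HZ0 _]].
      rewrite EM, EZ, <- RtoC_mult in Em. apply RtoC_inj in Em. nra.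
  - now elim Hm1.
  - now apply (attracting_case p q).
Qed.

(** * Necessity: the pseudo-orbit of constants *)

(** The constants n delta form a pseudo-orbit, because constants are fixed by
    every composition operator. Point evaluation turns the norm bound for a
    shadowing function into a bound along every orbit. *)
Lemma shadowing_growth : positive_shadowing in_H2 H2_dist (composition_operator phi) ->
  exists dl y N, 0 < dl /\ hol y /\ H2_bound y N /\ forall z, Cmod z < 1 -> forall n,
    Cmod (y (Nat.iter n tau z) - RtoC (INR n * dl)) ^ 2 <= 8 / (1 - Cmod z ^ 2).
Proof.
  intros HS. destruct (HS 1 ltac:(lra)) as [dl [Hdl H]].
  destruct (H (fun n _ => RtoC (INR n * dl))) as [y [Hy Hn]].
  { split.
    - intros n. apply in_H2_iff. split. apply hol_const. eexists. apply H2_bound_const.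
    - intros n. apply H2_norm_le. lra.
      apply H2_bound_ext with (fun _ => RtoC (- dl)).
      { intros z Hz. unfold composition_operator. rewrite phi_tau by auto.
        rewrite <- RtoC_minus. f_equal. rewrite S_INR. ring. }
      apply H2_bound_le with (Cmod (RtoC (- dl)) ^ 2). 2: apply H2_bound_const.
      rewrite Cmod_R, Rabs_Ropp, Rabs_pos_eq; lra. }
  apply in_H2_iff in Hy. destruct Hy as [Hy [N HN]].
  exists dl, y, N. repeat split; auto. intros z Hz n.
  assert (Hit : forall n f, hol f -> hol (Nat.iter n (composition_operator phi) f) /\
     forall w, Cmod w < 1 -> Nat.iter n (composition_operator phi) f w = f (Nat.iter n tau w)).
  { clear n. intros n f Hf. induction n as [|n [IH1 IH2]]. split; auto.
    assert (HT : forall w, Cmod w < 1 -> composition_operator phi (Nat.iter n (composition_operator phi) f) w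
       = Nat.iter n (composition_operator phi) f (tau w)).
    { intros w Hw. unfold composition_operator at 1. now rewrite phi_tau. }
    split.
    - simpl. apply hol_ext with (fun w => Nat.iter n (composition_operator phi) f (tau w)).
      intros w Hw. now rewrite HT. apply hol_comp_lt; auto. apply tau_hol. apply tau_lt.
    - intros w Hw. simpl. rewrite HT, IH2 by (auto; now apply tau_lt).
      f_equal. now rewrite <- Nat.iter_succ_r. }
  destruct (Hit n y Hy) as [Hh He]. rewrite <- He by auto.
  assert (HE := point_eval (fun w => Nat.iter n (composition_operator phi) y w - RtoC (INR n * dl))%C (1 ^ 2) z).
  rewrite pow1, Rmult_1_r in HE. apply HE; auto.
  - apply hol_minus; auto. apply hol_const.
  - rewrite <- (pow1 2). apply H2_norm_le. lra. exact (Hn n).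
Qed.

Lemma no_interior_fixed_point z : positive_shadowing in_H2 H2_dist (composition_operator phi) ->
  Cmod z < 1 -> tau z <> z.
Proof.
  intros HS Hz E. destruct (shadowing_growth HS) as [dl [y [N [Hdl [Hy [HN H]]]]]].
  assert (Hit : forall n, Nat.iter n tau z = z).
  { induction n; simpl; auto. now rewrite IHn. }
  set (K := sqrt (8 / (1 - Cmod z ^ 2))) in *.
  destruct (INR_unbounded ((Cmod (y z) + K) / dl)) as [n Hn].
  specialize (H z Hz n). rewrite Hit in H.
  assert (H1 : Cmod (y z - RtoC (INR n * dl)) <= K).
  { rewrite <- (sqrt_pow2 (Cmod _)) by apply Cmod_ge_0. now apply sqrt_le_1_alt. }
  assert (H2 := Cmod_triangle_sub (RtoC (INR n * dl)) (y z)).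
  rewrite Cmod_sub_sym, Cmod_R, Rabs_pos_eq in H2 by (apply Rmult_le_pos; [apply pos_INR|lra]).
  assert (H3 : Cmod (y z) + K < INR n * dl).
  { apply Rmult_lt_reg_r with (/ dl). now apply Rinv_0_lt_compat. rewrite Rmult_assoc, Rinv_r, Rmult_1_r; lra. }
  lra.
Qed.

(** In the half plane, the orbit of 0 is 1 + n be, at distance at least c / n^2
    from the boundary of the disk in the sense of 1 - |z|^2. There
    [growth_little_o] gives |y| <= M + (delta / 2) n, which contradicts the
    growth n delta. *)
Lemma no_parabolic p be : positive_shadowing in_H2 H2_dist (composition_operator phi) ->
  Cmod p = 1 -> 0 <= Re be ->
  (forall z, Cmod z < 1 -> to_half p 0 (tau z) = (to_half p 0 z + be)%C) -> False.
Proof.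
  intros HS Hp Hbe Htau. destruct (shadowing_growth HS) as [dl [y [N [Hdl [Hy [HN H]]]]]].
  (* [dl / B] is small enough for the bound on [y] to grow at the rate [dl / 2]. *)
  pose (B := Cmod be + 1). assert (HB : 1 <= B) by (unfold B; generalize (Cmod_ge_0 be); lra).
  destruct (growth_little_o y N Hy HN (dl / B)) as [M HM]. apply Rdiv_lt_0_compat; lra.
  assert (H0 : Cmod (RtoC 0) < 1) by (rewrite Cmod_0; lra).
  assert (Horb : forall n, Cmod (Nat.iter n tau 0) < 1 /\
     to_half p 0 (Nat.iter n tau 0) = (1 + RtoC (INR n) * be)%C).
  { induction n as [|n [IH1 IH2]].
    - simpl. split; auto. rewrite to_half_0 by auto. unfold base. ring.
    - rewrite S_INR, RtoC_plus. simpl Nat.iter. split. now apply tau_lt. rewrite Htau, IH2 by auto. ring. }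
  set (K := sqrt (8 / (1 - Cmod 0 ^ 2))) in *.
  destruct (INR_unbounded ((M + dl + K) / (dl / 2))) as [n Hn].
  specialize (H (RtoC 0) H0 n). destruct (Horb n) as [Hw Ew].
  set (w := Nat.iter n tau 0) in *. assert (Hn0 := pos_INR n).
  assert (H1 : Cmod (y w - RtoC (INR n * dl)) <= K).
  { rewrite <- (sqrt_pow2 (Cmod _)) by apply Cmod_ge_0. now apply sqrt_le_1_alt. }
  assert (H2 := Cmod_triangle_sub (RtoC (INR n * dl)) (y w)).
  rewrite Cmod_sub_sym, Cmod_R, Rabs_pos_eq in H2 by (apply Rmult_le_pos; lra).
  specialize (HM w Hw).
  assert (HR := Re_to_half_pos p 0 Hp w Hw).
  assert (Emod := Cmod_of_half p 0 Hp _ HR). rewrite of_half_to_half in Emod by auto.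
  assert (Hs0 : 0 < Cmod (shift 0 (to_half p 0 w))) by (apply Cmod_gt_0, shift_neq_0; auto).
  set (s := Cmod (shift 0 (to_half p 0 w))) in *.
  assert (HRe : 1 <= Re (to_half p 0 w)).
  { rewrite Ew. replace (Re (1 + INR n * be)) with (1 + INR n * Re be) by (destruct be; simpl; ring).
    assert (0 <= INR n * Re be) by now apply Rmult_le_pos. lra. }
  assert (Hs : s <= 2 + INR n * B).
  { unfold s, shift. rewrite Ew. replace (1 + INR n * be + Ci * 0 + 1)%C with (RtoC 2 + INR n * be)%C.
    2: { replace (RtoC 2) with (1 + 1)%C. ring. rewrite <- RtoC_plus. f_equal. }
    eapply Rle_trans. apply Cmod_triangle. rewrite Cmod_mult, !Cmod_R, !Rabs_pos_eq by lra.
    unfold B. nra. }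
  assert (Hsq : 2 / s <= sqrt (1 - Cmod w ^ 2)).
  { rewrite Emod. rewrite <- (sqrt_pow2 (2 / s)) by (apply Rlt_le, Rdiv_lt_0_compat; lra).
    apply sqrt_le_1_alt. replace ((2 / s) ^ 2) with (4 * 1 / s ^ 2) by (field; lra).
    apply Rmult_le_compat_r. apply Rlt_le, Rinv_0_lt_compat, pow_lt; auto. lra. }
  assert (H2s : 0 < 2 / s) by (apply Rdiv_lt_0_compat; lra).
  assert (Hy' : Cmod (y w) <= M + dl + INR n * (dl / 2)).
  { eapply Rle_trans. exact HM.
    assert (HdB : 0 < dl / B) by (apply Rdiv_lt_0_compat; lra).
    assert (dl / B / sqrt (1 - Cmod w ^ 2) <= dl / B * ((2 + INR n * B) / 2)).
    { apply Rmult_le_compat_l. lra. apply Rle_trans with (/ (2 / s)).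
      apply Rinv_le_contravar; auto. replace (/ (2 / s)) with (s / 2) by (field; lra). lra. }
    replace (dl / B * ((2 + INR n * B) / 2)) with (dl / B + INR n * (dl / 2)) in H3 by (field; lra).
    assert (dl / B <= dl). { apply Rmult_le_reg_r with B. lra. unfold Rdiv. rewrite Rmult_assoc, Rinv_l by lra. nra. }
    lra. }
  assert (H3 : M + dl + K < INR n * (dl / 2)).
  { apply Rmult_lt_reg_r with (/ (dl / 2)). apply Rinv_0_lt_compat; lra. rewrite Rmult_assoc, Rinv_r by lra. unfold Rdiv in Hn at 1. lra. }
  lra.
Qed.

(** The fixed points are the roots of a polynomial of degree two. *)
Lemma quadratic_root : c <> 0 -> exists f, (a * f + b = f * (c * f + d))%C.
Proof.
  intros Hc. destruct (Csqrt_exists ((d - a) * (d - a) + RtoC 4 * b * c)%C) as [s Hs].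
  exists ((a - d + s) / (RtoC 2 * c))%C.
  assert (E : (s * s - ((d - a) * (d - a) + RtoC 4 * b * c))%C = 0) by (rewrite Hs; ring).
  set (f := ((a - d + s) / (RtoC 2 * c))%C).
  assert (Ef : (f * (c * f + d) - (a * f + b))%C = ((s * s - ((d - a) * (d - a) + RtoC 4 * b * c)) / (RtoC 4 * c))%C).
  { unfold f. field. auto. }
  rewrite E in Ef. replace (a * f + b)%C with (f * (c * f + d) - (f * (c * f + d) - (a * f + b)))%C by ring.
  rewrite Ef. field. auto.
Qed.

(** A finite fixed point [z2] outside of the closed disk is sent to infinity by
    an automorphism of the disk. The map becomes an affine self-map of the disk,
    to which [affine_fixed_point] applies. *)
Lemma closed_disk_fixed_point : exists f, Cmod f <= 1 /\ phi (Some f) = Some f.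
Proof.
  destruct (Ceq_dec c 0) as [Ec|Nc].
  - assert (Nd : d <> 0) by (intros Ed; apply Hdet; rewrite Ec, Ed; ring).
    destruct (affine_fixed_point (a / d)%C (b / d)%C) as [f [Hf Ef]].
    { intros z Hz. assert (H := tau_lt z Hz). unfold tau in H.
      replace (a / d * z + b / d)%C with ((a * z + b) / (c * z + d))%C. exact H.
      rewrite Ec. replace (0 * z + d)%C with d by ring. field. auto. }
    exists f. split; auto. apply fixed_Some. rewrite Ec. replace (0 * f + d)%C with d by ring. split; auto.
    rewrite <- Ef at 2. field. auto.
  - destruct (quadratic_root Nc) as [z2 H2]. destruct (fixed_neq z2 H2) as [N1 N2].
    destruct (Rle_lt_dec (Cmod z2) 1) as [Hz|Hz].
    { exists z2. split; auto. now apply fixed_Some. }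
    pose (S := (Cconj z2 * z2 - 1)%C).
    assert (ES : S = RtoC (Cmod z2 ^ 2 - 1)).
    { unfold S. rewrite RtoC_minus, Cmod2_conj. ring. }
    assert (NS : S <> 0) by (rewrite ES; intros E; apply RtoC_inj in E; nra).
    (* In the variable [1 / (z - z2)] the map is [al * h + be]; the automorphism of the
       disk is [u = Cconj z2 + S / (z - z2)]. *)
    pose (al := ((c * z2 + d) / (a - z2 * c))%C). pose (be := (c / (a - z2 * c))%C).
    assert (HU : forall u, Cmod u <= 1 -> (u - Cconj z2)%C <> 0).
    { intros u Hu E. apply Ceq_minus in E. rewrite E, Cmod_conj in Hu. lra. }
    assert (HZ : forall u, Cmod u <= 1 -> Cmod ((u * z2 - 1) / (u - Cconj z2)) <= 1 /\
       (Cmod u < 1 -> Cmod ((u * z2 - 1) / (u - Cconj z2)) < 1)).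
    { intros u Hu. assert (H := reflection_into_disk u (Cconj z2) Hu).
      rewrite Cmod_conj, Cconj_conj, (Cmult_comm z2 u) in H. auto. }
    assert (HF : forall f, Cmod f < 1 -> (f - z2)%C <> 0 /\ Cmod ((Cconj z2 * f - 1) / (f - z2)) < 1).
    { intros f Hf. split. intros E. apply Ceq_minus in E. rewrite E in Hf. lra.
      apply reflection_into_disk; lra. }
    assert (Einv : forall u, Cmod u <= 1 -> ((u * z2 - 1) / (u - Cconj z2) - z2)%C = (S / (u - Cconj z2))%C).
    { intros u Hu. assert (Nu := HU u Hu). unfold S. field. auto. }
    destruct (affine_fixed_point al (S * be + Cconj z2 * (1 - al))%C) as [u [Hu Eu]].
    { intros u Hu. set (z := ((u * z2 - 1) / (u - Cconj z2))%C).
      assert (Hz1 : Cmod z < 1) by (apply HZ; lra).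
      destruct (HF (tau z) (tau_lt z Hz1)) as [Nt Ht].
      assert (Et := tau_minus_fixed z2 z H2 (disk_den z Hz1)).
      assert (Ez : (z - z2)%C = (S / (u - Cconj z2))%C) by (apply Einv; lra).
      assert (Nu := HU u ltac:(lra)).
      assert (Nz := disk_den z Hz1).
      assert (Nzz : (z - z2)%C <> 0) by (apply HF; auto).
      replace (al * u + (S * be + Cconj z2 * (1 - al)))%C with ((Cconj z2 * tau z - 1) / (tau z - z2))%C. exact Ht.
      replace (Cconj z2 * tau z - 1)%C with (Cconj z2 * (tau z - z2) + S)%C by (unfold S; ring).
      assert (Eh : (/ (tau z - z2))%C = (al * (/ (z - z2)) + be)%C).
      { rewrite Et. unfold al, be. field. auto. }
      replace ((Cconj z2 * (tau z - z2) + S) / (tau z - z2))%C with (Cconj z2 + S * / (tau z - z2))%C by (field; auto).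
      rewrite Eh, Ez. field. auto. }
    exists ((u * z2 - 1) / (u - Cconj z2))%C. split. now apply HZ.
    assert (Ef := Einv u Hu). set (f := ((u * z2 - 1) / (u - Cconj z2))%C) in *.
    assert (Nu := HU u Hu).
    assert (Nf : (f - z2)%C <> 0).
    { rewrite Ef. intros E. apply NS. replace S with (S / (u - Cconj z2) * (u - Cconj z2))%C by (field; auto). rewrite E. ring. }
    assert (Eden : (c * f + d = a - z2 * c)%C).
    { assert (E1 : (u - Cconj z2 = S / (f - z2))%C) by (rewrite Ef; field; auto).
      assert (E2 : (al * (u - Cconj z2) + S * be = u - Cconj z2)%C).
      { replace (al * (u - Cconj z2) + S * be)%C with (al * u + (S * be + Cconj z2 * (1 - al)) - Cconj z2)%C by ring.
        rewrite Eu. reflexivity. }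
      rewrite E1 in E2.
      replace (c * f + d)%C with ((al * (S / (f - z2)) + S * be) * ((f - z2) * (a - z2 * c) / S))%C.
      rewrite E2. field. auto.
      unfold al, be. field. auto. }
    apply fixed_Some. rewrite Eden. split; auto.
    replace (a * f + b)%C with ((a * f + b) - z2 * (c * f + d) + z2 * (c * f + d))%C by ring.
    replace (a * f + b - z2 * (c * f + d))%C with ((a - z2 * c) * (f - z2))%C.
    rewrite Eden. ring.
    replace b with (z2 * (c * z2 + d) - a * z2)%C by (rewrite <- H2; ring). ring.
Qed.

(** A fixed point [p] in the closed disk cannot be inside. If its multiplier
    were 1, the map would be a translation of the half plane, possibly the
    identity, which [no_parabolic] excludes; so there is a second fixed point,
    given by an explicit formula. *)
Lemma shadowing_hyperbolic : positive_shadowing in_H2 H2_dist (composition_operator phi) ->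
  exists p q, Some p <> q /\ (forall s, phi s = s <-> s = Some p \/ s = q) /\ Cmod p = 1 /\
    (on_unit_circle q \/ off_closed_disk q).
Proof.
  intros HS. destruct closed_disk_fixed_point as [p [Hp Hfix]].
  assert (Hint : forall z, phi (Some z) = Some z -> 1 <= Cmod z).
  { intros z Hz. apply Rnot_lt_le. intros Hlt. apply (no_interior_fixed_point z HS Hlt).
    rewrite phi_tau in Hz by auto. injection Hz. auto. }
  assert (Hp1 : Cmod p = 1) by (specialize (Hint p Hfix); lra). clear Hp.
  destruct (half_plane_model p Hp1 Hfix) as [EM [HM0 HB0]].
  assert (Hfix' := Hfix). apply fixed_Some in Hfix'. destruct Hfix' as [Hd1 Hd2].
  destruct (fixed_neq p Hd2) as [N1 N2].
  assert (Nm : multiplier p <> 1).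
  { intros E. apply (no_parabolic p (offset p) HS); auto.
    intros z Hz. rewrite to_half_tau, E by auto. ring. }
  assert (Hdis : forall q, phi q = q -> on_unit_circle q \/ off_closed_disk q).
  { intros [z|] Hz. 2: right; exact I. assert (H := Hint z Hz). simpl. lra. }
  assert (E1 : (1 - multiplier p)%C = ((a - d - RtoC 2 * (c * p)) / (a - p * c))%C).
  { unfold multiplier. field. auto. }
  assert (Nq : (a - d - RtoC 2 * (c * p))%C <> 0).
  { intros E. apply Nm. replace (multiplier p) with (1 - (1 - multiplier p))%C by ring. rewrite E1, E. field. auto. }
  assert (Hroot : forall z, z <> p -> phi (Some z) = Some z -> (c * (z + p) = a - d)%C).
  { intros z Hne Hz. now apply second_fixed_point. }
  destruct (Ceq_dec c 0) as [Ec|Nc].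
  - exists p, None. assert (HN : phi None = None) by now apply fixed_None.
    split; [discriminate|]. split; [|split; auto].
    intros s. split.
    + intros Hs. destruct s as [z|]; auto. left. f_equal.
      destruct (Ceq_dec z p) as [|Hne]; auto. exfalso. apply Nq.
      rewrite <- (Hroot z Hne Hs), Ec. ring.
    + intros [-> | ->]; auto.
  - set (q := ((a - d) / c - p)%C).
    assert (Eq : (c * (q + p) = a - d)%C) by (unfold q; field; auto).
    assert (Hqp : q <> p).
    { intros E. apply Nq. rewrite <- Eq, E. ring. }
    assert (E2 : (a * q + b = q * (c * q + d))%C).
    { replace (a * q + b)%C with (q * (c * q + d) - ((q - p) * (c * (q + p) - (a - d))) - ((p * (c * p + d)) - (a * p + b)))%C by ring.
      rewrite Eq, <- Hd2. ring. }
    assert (Hq : phi (Some q) = Some q).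
    { apply fixed_Some. split; auto. apply (fixed_neq q E2). }
    exists p, (Some q). split; [|split; [|split; auto]].
    + intros E. inversion E. auto.
    + intros s. split.
      * intros Hs. destruct s as [z|].
        -- destruct (Ceq_dec z p) as [->|Hne]; auto. right. f_equal.
           assert (Ez := Hroot z Hne Hs). rewrite <- Eq in Ez.
           replace z with (/ c * (c * (z + p)) - p)%C by (field; auto). rewrite Ez. field. auto.
        -- apply fixed_None in Hs. now elim Nc.
      * intros [-> | ->]; auto.
Qed.
End Mobius.

Theorem theorem2p6 (phi : sphere -> sphere)
    (Hphi : linear_fractional phi) (Hdisk : maps_disk_into_disk phi) :
  positive_shadowing in_H2 H2_dist (composition_operator phi) <->
  (hyperbolic_automorphism phi \/ hyperbolic_nonautomorphism_I phi).
Proof.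
  destruct Hphi as [a [b [c [d [Hdet Hphi]]]]]. split.
  - intros HS. destruct (shadowing_hyperbolic a b c d phi Hdet Hphi Hdisk HS) as [p [q [H1 [H2 [H3 H4]]]]].
    destruct H4 as [H4|H4]; [left|right]; exists (Some p), q; auto.
  - assert (HH : forall Q : sphere -> Prop, (forall s, Q s -> on_unit_circle s \/ off_closed_disk s) ->
      hyperbolic_with Q phi -> positive_shadowing in_H2 H2_dist (composition_operator phi)).
    { intros Q HQ [p [q [Hne [Hfix [Hp Hq]]]]]. destruct p as [p|]; [|elim Hp]. simpl in Hp.
      apply (hyperbolic_shadowing a b c d phi Hdet Hphi Hdisk p q); auto.
      - apply Hfix; auto.
      - apply Hfix; auto.
      (* 0 is inside the disk, hence neither [p] nor [q]: it witnesses that [phi] is not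
         the identity. *)
      - exists (Some (RtoC 0)). intros E. apply Hfix in E. destruct E as [E|E].
        + inversion E as [E']. rewrite <- E', Cmod_0 in Hp. lra.
        + subst q. specialize (HQ _ Hq). simpl in HQ. rewrite Cmod_0 in HQ. lra. }
    intros [H|H]; [apply (HH on_unit_circle)|apply (HH off_closed_disk)]; auto.
Qed.
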